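(* Let $p\in2\mathbb{N}$ (a positive even integer), fix an arbitrary sequence $\omega=\{\omega_j\}_{j=1}^\infty\in\mathbb{R}^{\mathbb{N}}$, and let $\lambda\in\mathbb{C}$, $f\in\mathcal{A}_\omega(\mathbb{R})$. Let $u\in C(I;\mathcal{A}_\omega(\mathbb{R}))$ be the solution to $$i\partial_tu+\partial_x^2u=\lambda|u|^p,\qquad u|_{t=0}=f,\qquad (t,x)\in\mathbb{R}\times\mathbb{R},$$ where $I=(-T_-,T_+)$, $T_\pm\in(0,\infty]$, is the maximal time interval of existence containing $t=0$. Suppose that $$\operatorname{Re}\lambda\cdot\operatorname{Im}M(f)\neq0\quad\text{or}\quad\operatorname{Im}\lambda\cdot\operatorname{Re}M(f)\neq0.$$ Then $\min(T_-,T_+)<\infty$. More precisely: (i) If $\operatorname{Re}\lambda\cdot\operatorname{Im}M(f)<0$ or $\operatorname{Im}\lambda\cdot\operatorname{Re}M(f)>0$, then $T_+<\infty$ and $\liminf_{t\nearrow T_+}\|u(t)\|_{\mathcal{A}_\omega(\mathbb{R})}=\infty$. (ii) If $\operatorname{Re}\lambda\cdot\operatorname{Im}M(f)>0$ or $\operatorname{Im}\lambda\cdot\operatorname{Re}M(f)<0$, then $T_-<\infty$ and $\liminf_{t\searrow-T_-}\|u(t)\|_{\mathcal{A}_\omega(\mathbb{R})}=\infty$.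
   Context: $\mathbb{N}=\{1,2,3,\dots\}$. A continuous function $f:\mathbb{R}\to\mathbb{C}$ is almost periodic, written $f\in AP(\mathbb{R})$, if for every $\varepsilon>0$ there is $L>0$ such that every interval of length $L$ contains a number $\tau$ with $\sup_{x\in\mathbb{R}}|f(x-\tau)-f(x)|<\varepsilon$. For $f\in AP(\mathbb{R})$ the mean value $M(f)=\lim_{L\to\infty}\frac1{2L}\int_{-L}^Lf(x)\,dx$ exists; the Fourier coefficients are $\widehat f(\alpha)=M(fe^{-i\alpha x})$, $\alpha\in\mathbb{R}$, which vanish for all but countably many $\alpha$, and $\sigma(f)=\{\alpha\in\mathbb{R}:\widehat f(\alpha)\neq0\}$. Given $\omega=\{\omega_j\}_{j=1}^\infty\in\mathbb{R}^{\mathbb{N}}$ (no linear independence over $\mathbb{Q}$ is assumed), let $\Omega_\omega=\{\sum_jn_j\omega_j: n_j\in\mathbb{Z},\text{ only finitely many } n_j\ne0\}$, a countable subgroup of $\mathbb{R}$. Define $\mathcal{A}_\omega(\mathbb{R})=\{f\in AP(\mathbb{R}):\sigma(f)\subset\Omega_\omega,\ \|f\|_{\mathcal{A}_\omega(\mathbb{R})}<\infty\}$ with $\|f\|_{\mathcal{A}_\omega(\mathbb{R})}=\sum_{\alpha\in\Omega_\omega}|\widehat f(\alpha)|$. For $f\in\mathcal{A}_\omega(\mathbb{R})$ and $t\in\mathbb{R}$, $S(t)=e^{it\partial_x^2}$ is defined by $(S(t)f)(x)=\sum_{\alpha\in\Omega_\omega}\widehat f(\alpha)e^{-i\alpha^2t}e^{i\alpha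 x}$. The integral $\int_0^tS(t-t')F(t')\,dt'$ denotes the function $x\mapsto\int_0^t\sum_{\alpha\in\Omega_\omega}\widehat F(t',\alpha)e^{-i\alpha^2(t-t')}e^{i\alpha x}\,dt'$, where $\widehat F(t',\alpha)$ is the Fourier coefficient of $F(t')$. A solution on an open interval $J\ni0$ is a function $u\in C(J;\mathcal{A}_\omega(\mathbb{R}))$ satisfying the Duhamel formula $u(t)=S(t)f-i\lambda\int_0^tS(t-t')|u(t')|^p\,dt'$ for all $t\in J$. Solutions exist locally and are unique, and $I$ is the largest open interval containing $0$ on which the solution exists. *)

(* Defs.v *)
From Stdlib Require Import Reals List Arith.
From Coquelicot Require Import Coquelicot.
Open Scope R_scope.

(** Functions [R -> C] carry the Coquelicot structure of [C] as a normed space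
    over [R], so that [RInt] is the (oriented) Riemann integral. *)

Definition expi (theta : R) : C := (cos theta, sin theta).

Definition sup_norm (g : R -> C) : Rbar :=
  Lub_Rbar (fun y => exists x, y = Cmod (g x)).

Definition almost_periodic (f : R -> C) : Prop :=
  (forall x, continuous f x) /\
  forall eps, 0 < eps ->
    exists L, 0 < L /\
      forall a, exists tau, a <= tau <= a + L /\
        Rbar_lt (sup_norm (fun x => Cminus (f (x - tau)) (f x))) eps.

(** The limit is taken with the total choice operator [iota]; it is meaningful
    whenever the limit exists, in particular for almost periodic [f]. *)
Definition mean (f : R -> C) : C :=
  iota (fun m : C_R_CompleteNormedModule =>
    filterlim
      (fun L => (RtoC (/ (2 * L)) * RInt (V := C_R_CompleteNormedModule) f (- L) L)%C)
      (Rbar_locally p_infty) (locally m)).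

Definition fourier (f : R -> C) (alpha : R) : C :=
  mean (fun x => (f x * expi (- (alpha * x)))%C).

Definition spectrum (f : R -> C) (alpha : R) : Prop :=
  fourier f alpha <> RtoC 0.

Definition finite_subset (A : R -> Prop) (l : list R) : Prop :=
  NoDup l /\ forall alpha, In alpha l -> A alpha.

(** The filter of "sufficiently large" finite subsets of [A], represented by
    duplicate-free lists. *)
Definition finite_subsets (A : R -> Prop) (P : list R -> Prop) : Prop :=
  exists l0, finite_subset A l0 /\
    forall l, finite_subset A l -> incl l0 l -> P l.

Definition list_sum_C (a : R -> C) (l : list R) : C :=
  fold_right (fun alpha s => (a alpha + s)%C) (RtoC 0) l.

Definition list_sum_R (a : R -> R) (l : list R) : R :=
  fold_right (fun alpha s => a alpha + s) 0 l.

Definition sum_over (A : R -> Prop) (a : R -> C) : C :=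
  iota (fun s : C_R_CompleteNormedModule =>
    filterlim (list_sum_C a) (finite_subsets A) (locally s)).

(** Sum of a family of nonnegative reals, with value in [[0, +oo]]. *)
Definition nonneg_sum_over (A : R -> Prop) (a : R -> R) : Rbar :=
  Lub_Rbar (fun s => exists l, finite_subset A l /\ s = list_sum_R a l).

(** The sequence is indexed from [0] here: [omega j] stands for the
    [(j+1)]-st frequency. *)
Definition Omega (omega : nat -> R) (alpha : R) : Prop :=
  exists (n : nat -> Z) (N : nat),
    (forall j, (N < j)%nat -> n j = 0%Z) /\
    alpha = sum_n (fun j => IZR (n j) * omega j) N.

Definition normA (omega : nat -> R) (f : R -> C) : Rbar :=
  nonneg_sum_over (Omega omega) (fun alpha => Cmod (fourier f alpha)).

Definition in_A (omega : nat -> R) (f : R -> C) : Prop :=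
  almost_periodic f /\
  (forall alpha, spectrum f alpha -> Omega omega alpha) /\
  Rbar_lt (normA omega f) p_infty.

Definition schrodinger (omega : nat -> R) (t : R) (f : R -> C) (x : R) : C :=
  sum_over (Omega omega)
    (fun alpha =>
       (fourier f alpha * expi (- (alpha ^ 2 * t)) * expi (alpha * x))%C).

(** The open intervals containing [0] are the [(-Tm, Tp)] with
    [Tm, Tp] in [(0, +oo]]. *)
Definition in_interval (Tm Tp : Rbar) (t : R) : Prop :=
  Rbar_lt (Rbar_opp Tm) t /\ Rbar_lt t Tp.

(** [u t x] is the value at time [t] and position [x]; values of [u] at times
    outside the interval are irrelevant. *)
Definition continuous_in_A (omega : nat -> R) (Tm Tp : Rbar) (u : R -> R -> C) : Prop :=
  forall t, in_interval Tm Tp t ->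
    in_A omega (u t) /\
    filterlim (fun s => normA omega (fun x => (u s x - u t x)%C))
      (locally t) (Rbar_locally 0).

Definition is_solution (p : nat) (omega : nat -> R) (lambda : C) (f : R -> C)
    (Tm Tp : Rbar) (u : R -> R -> C) : Prop :=
  continuous_in_A omega Tm Tp u /\
  forall t, in_interval Tm Tp t -> forall x,
    u t x =
      (schrodinger omega t f x -
       Ci * lambda *
         RInt (V := C_R_CompleteNormedModule)
           (fun t' =>
              schrodinger omega (t - t') (fun y => RtoC (Cmod (u t' y) ^ p)) x)
           0 t)%C.

Definition is_maximal_solution (p : nat) (omega : nat -> R) (lambda : C)
    (f : R -> C) (Tm Tp : Rbar) (u : R -> R -> C) : Prop :=
  Rbar_lt 0 Tm /\ Rbar_lt 0 Tp /\
  is_solution p omega lambda f Tm Tp u /\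
  forall (Sm Sp : Rbar) (v : R -> R -> C),
    Rbar_lt 0 Sm -> Rbar_lt 0 Sp ->
    is_solution p omega lambda f Sm Sp v ->
    Rbar_le Sm Tm /\ Rbar_le Sp Tp.

Definition LimInf_filter {T : Type} (F : (T -> Prop) -> Prop) (g : T -> Rbar) : Rbar :=
  Rbar_lub (fun m =>
    exists A, F A /\ m = Rbar_glb (fun y => exists t, A t /\ y = g t)).

(* Main.v *)
(** Since [p] is even, [|u|^p = (u conj u)^(p/2)] is a polynomial in [u] and [conj u], so the nonlinearity is locally
    Lipschitz on the Banach algebra of the theorem, where the free Schroedinger group acts by isometries.  The Picard
    iteration therefore gives a solution on a time interval whose length depends only on the norm of the data.
    Restarting from a time close to a finite end point of the maximal interval at which the norm were bounded would
    extend the solution; so the norm tends to infinity there.  The mean value [Z] of [u] satisfies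
    [i Z' = lambda M(|u|^p)], and [M(|u|^p) >= |Z|^p] by convexity.  Hence [y = Im lambda Re Z] and
    [y = - Re lambda Im Z] satisfy [y' >= K |y|^p] with [p >= 2], which is impossible for all later times if [y(0) > 0]
    and for all earlier times if [y(0) < 0].

    That an element of the algebra is the sum of its Fourier series rests on Bohr's uniqueness theorem: an almost
    periodic function [f] all of whose Fourier coefficients vanish is zero.  If they vanish, the averages of
    [f exp(-i alpha x)] over long intervals are small uniformly in [alpha].  By Plancherel on a finite cyclic group,
    applied to samples of [f], this makes the correlations of [f] with its translates small on average, whereas the
    translates by almost periods, which have positive density, correlate with [f] like [f] itself. *)

Require Import Defs.
From Stdlib Require Import Reals Arith.
From Coquelicot Require Import Coquelicot.
From Stdlib Require Import List Permutation Lra Lia Psatz Classical ClassicalEpsilon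
  FunctionalExtensionality PropExtensionality ProofIrrelevance.
Open Scope R_scope.

(** The norm sees only Fourier coefficients, so without uniqueness it controls no value of [f]. With
    uniqueness, evaluation at a point and the coefficient at a frequency are bounded functionals,
    and the pointwise Duhamel formula becomes an identity between integrals with values in a
    complete space. The obstacle in the uniqueness theorem is that frequencies range over the whole
    line, where compactness fails. Means of [f] over cells of length [1 / Q] replace the line by a
    circle of angles, but the parameters then have to be chosen in the right order: the required
    smallness of the exponential sums depends on the density of the almost periods, and the mesh
    depends on that smallness. Almost periods are therefore counted in runs of consecutive mesh
    points, because the density of such runs survives every refinement of the mesh. The zero mode is
    treated in integrated form, since [u] is only continuous in time. *)

Notation CV := C_R_CompleteNormedModule.

(** * Complex numbers, continuity and the unit character *)

Lemma norm_C_R (c : CV) : norm c = Cmod c.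
Proof.
  unfold norm; simpl. unfold prod_norm, Cmod. f_equal. unfold norm; simpl.
  unfold abs; simpl.
  unfold Rabs; destruct (Rcase_abs (fst c)), (Rcase_abs (snd c)); ring.
Qed.

Lemma Cmod_minus_sym (a b : C) : Cmod (a - b) = Cmod (b - a).
Proof. replace (a - b)%C with (- (b - a))%C by ring. apply Cmod_opp. Qed.

Lemma Cmod_triangle3 (a b c : C) : Cmod (a - c) <= Cmod (a - b) + Cmod (b - c).
Proof. replace (a - c)%C with ((a - b) + (b - c))%C by ring. apply Cmod_triangle. Qed.

Lemma Cmod_le_add (a b : C) : Cmod a <= Cmod b + Cmod (a - b).
Proof. replace a with (b + (a - b))%C at 1 by ring. apply Cmod_triangle. Qed.

Lemma Cmod_eq_zero_of_small (z : C) : (forall eps, 0 < eps -> Cmod z <= eps) -> z = RtoC 0.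
Proof.
  intros H. apply Cmod_eq_0.
  destruct (Rle_lt_dec (Cmod z) 0) as [h|h].
  - pose proof (Cmod_ge_0 z). lra.
  - specialize (H (Cmod z / 2) ltac:(lra)). lra.
Qed.

Lemma Re_le_Cmod (z : C) : Re z <= Cmod z.
Proof. pose proof (re_le_Cmod z). pose proof (Rle_abs (Re z)). lra. Qed.

Lemma Im_le_Cmod (z : C) : Rabs (Im z) <= Cmod z.
Proof. pose proof (Rmax_Cmod z). pose proof (Rmax_r (Rabs (fst z)) (Rabs (snd z))). unfold Im. lra. Qed.

Lemma Cmod_le_Re_Im (z : C) : Cmod z <= Rabs (Re z) + Rabs (Im z).
Proof.
  pose proof (Rabs_pos (Re z)). pose proof (Rabs_pos (Im z)).
  apply Rsqr_incr_0; [|apply Cmod_ge_0|lra].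
  rewrite Rsqr_pow2, Cmod2_alt. rewrite <- (pow2_abs (Re z)), <- (pow2_abs (Im z)).
  unfold Rsqr. nra.
Qed.

Lemma Cmod2_Re (z : C) : Cmod z ^ 2 = Re (z * Cconj z).
Proof. rewrite Cmod2_alt. destruct z; simpl; ring. Qed.

(** The uniform structure of [CV] is that of a product; passing through the equivalent norm balls
    gives the form with [Cmod] on which all later estimates rely. *)
Lemma filterlim_CV {T : Type} (F : (T -> Prop) -> Prop) {FF : Filter F} (f : T -> C) (l : C) :
  filterlim f F (locally (T := CV) l) <->
  (forall eps, 0 < eps -> F (fun x => Cmod (f x - l) < eps)).
Proof.
  split.
  - intros H eps He.
    apply (proj1 (filterlim_locally_ball_norm (K := R_AbsRing) (U := CV) f l)) with (eps := mkposreal eps He) in H.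
    revert H. apply filter_imp. intros x. unfold ball_norm. rewrite norm_C_R. auto.
  - intros H.
    apply (proj2 (filterlim_locally_ball_norm (K := R_AbsRing) (U := CV) f l)).
    intros eps. specialize (H eps (cond_pos eps)). revert H. apply filter_imp.
    intros x. unfold ball_norm. rewrite norm_C_R. auto.
Qed.

Lemma locally_R_iff (x : R) (P : R -> Prop) :
  locally x P <-> exists d, 0 < d /\ forall y, Rabs (y - x) < d -> P y.
Proof.
  split.
  - intros [d H]. exists d. split. apply cond_pos. intros y Hy. apply H. exact Hy.
  - intros [d [Hd H]]. exists (mkposreal d Hd). intros y Hy. apply H. exact Hy.
Qed.

Definition Ccont (f : R -> C) : Prop := forall x, continuous f x.

Lemma continuous_C_iff (f : R -> C) (x : R) :
  continuous f x <->
  (forall eps, 0 < eps -> exists d, 0 < d /\ forall y, Rabs (y - x) < d -> Cmod (f y - f x) < eps).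
Proof.
  unfold continuous. change (filterlim f (locally x) (locally (T := CV) (f x)) <->
  (forall eps, 0 < eps -> exists d, 0 < d /\ forall y, Rabs (y - x) < d -> Cmod (f y - f x) < eps)).
  rewrite (filterlim_CV (locally x) f (f x)).
  split; intros H eps He; specialize (H eps He); [rewrite locally_R_iff in H | rewrite locally_R_iff]; exact H.
Qed.

Lemma Ccont_const (c : C) : Ccont (fun _ => c).
Proof. intros x. apply (continuous_const (U := R_UniformSpace) (V := CV) c x). Qed.

Lemma Ccont_plus (f g : R -> C) : Ccont f -> Ccont g -> Ccont (fun x => f x + g x)%C.
Proof. intros Hf Hg x. apply (continuous_plus (V := CV) f g x); [apply Hf | apply Hg]. Qed.

Lemma Ccont_mult (f g : R -> C) : Ccont f -> Ccont g -> Ccont (fun x => f x * g x)%C.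
Proof.
  intros Hf Hg x. apply continuous_C_iff. intros eps He.
  pose proof (Cmod_ge_0 (f x)) as Pf. pose proof (Cmod_ge_0 (g x)) as Pg.
  set (A := Cmod (f x) + Cmod (g x) + 1).
  assert (HA : 0 < A) by (unfold A; lra).
  (* The bound [e <= 1] makes the product of the two increments linear in [e], so the three terms of
     the product rule add up to at most [e * A <= eps / 2]. *)
  set (e := Rmin 1 (eps / (2 * A))).
  assert (h0 : 0 < eps / (2 * A)) by (apply Rdiv_lt_0_compat; lra).
  assert (he : 0 < e) by (apply Rmin_glb_lt; lra).
  assert (he1 : e <= 1) by apply Rmin_l.
  assert (he2 : e * (2 * A) <= eps).
  { unfold e. apply Rle_trans with (eps / (2 * A) * (2 * A)).
    apply Rmult_le_compat_r. lra. apply Rmin_r. right. field. lra. }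
  destruct (proj1 (continuous_C_iff f x) (Hf x) e he) as [d1 [h1 H1]].
  destruct (proj1 (continuous_C_iff g x) (Hg x) e he) as [d2 [h2 H2]].
  exists (Rmin d1 d2). split. apply Rmin_glb_lt; auto. intros y Hy.
  specialize (H1 y ltac:(pose proof (Rmin_l d1 d2); lra)).
  specialize (H2 y ltac:(pose proof (Rmin_r d1 d2); lra)).
  replace (f y * g y - f x * g x)%C with ((f y - f x) * (g y - g x) + ((f y - f x) * g x + f x * (g y - g x)))%C by ring.
  eapply Rle_lt_trans. apply Cmod_triangle.
  eapply Rle_lt_trans. apply Rplus_le_compat_l. apply Cmod_triangle.
  rewrite !Cmod_mult.
  set (a := Cmod (f y - f x)) in *. set (b := Cmod (g y - g x)) in *.
  assert (0 <= a) by apply Cmod_ge_0. assert (0 <= b) by apply Cmod_ge_0.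
  assert (a * b <= e * 1) by (apply Rmult_le_compat; lra).
  assert (a * Cmod (g x) <= e * Cmod (g x)) by (apply Rmult_le_compat_r; lra).
  assert (Cmod (f x) * b <= Cmod (f x) * e) by (apply Rmult_le_compat_l; lra).
  unfold A in he2. unfold A in *. nra.
Qed.

Lemma Ccont_shift (f : R -> C) (c : R) : Ccont f -> Ccont (fun x => f (x + c)).
Proof.
  intros Hf x. apply (continuous_comp (fun x => x + c) f).
  apply (continuous_plus (V := R_NormedModule) (fun x : R => x) (fun _ => c)). apply continuous_id. apply continuous_const.
  apply Hf.
Qed.

Lemma expi_plus (a b : R) : expi (a + b) = (expi a * expi b)%C.
Proof. unfold expi, Cmult; simpl. rewrite cos_plus, sin_plus. f_equal; ring. Qed.

Lemma expi_0 : expi 0 = RtoC 1.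
Proof. unfold expi. rewrite cos_0, sin_0. reflexivity. Qed.

Lemma expi_opp (a : R) : expi (- a) = Cconj (expi a).
Proof. unfold expi, Cconj; simpl. rewrite cos_neg, sin_neg. reflexivity. Qed.

Lemma expi_opp_r (a : R) : (expi a * expi (- a))%C = RtoC 1.
Proof. rewrite <- expi_plus. replace (a + - a) with 0 by ring. apply expi_0. Qed.

Lemma Cmod_expi (a : R) : Cmod (expi a) = 1.
Proof.
  unfold Cmod, expi; simpl fst; simpl snd. rewrite <- !Rsqr_pow2.
  rewrite Rplus_comm, sin2_cos2. apply sqrt_1.
Qed.

Lemma Rabs_sin_le (x : R) : Rabs (sin x) <= Rabs x.
Proof.
  assert (P : forall y, 0 <= y -> Rabs (sin y) <= y).
  { intros y Hy. destruct (Req_dec y 0) as [->|Hn].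
    - rewrite sin_0, Rabs_R0. lra.
    - destruct (Rle_lt_dec y 1) as [h|h].
      + rewrite Rabs_pos_eq. left. apply sin_lt_x. lra.
        apply sin_ge_0. lra. pose proof PI2_1. lra.
      + pose proof (SIN_bound y). apply Rabs_le. lra. }
  destruct (Rle_lt_dec 0 x) as [h|h].
  - rewrite (Rabs_pos_eq x h). auto.
  - rewrite (Rabs_left x h). replace (sin x) with (- sin (- x)) by (rewrite sin_neg; ring).
    rewrite Rabs_Ropp. apply P. lra.
Qed.

(** The chord has length [2 * Rabs (sin (a / 2))]. *)
Lemma Cmod_expi_minus_one (a : R) : Cmod (expi a - 1) <= Rabs a.
Proof.
  apply Rsqr_incr_0; [|apply Cmod_ge_0|apply Rabs_pos].
  rewrite <- Rsqr_abs. rewrite Rsqr_pow2, Cmod2_alt. unfold expi; simpl Re; simpl Im.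
  replace a with (2 * (a / 2)) at 1 2 by field.
  rewrite cos_2a_sin, sin_2a.
  pose proof (Rabs_sin_le (a / 2)) as H. apply Rsqr_le_abs_1 in H.
  pose proof (sin2_cos2 (a / 2)) as H2. unfold Rsqr in *.
  set (s := sin (a / 2)) in *. set (c := cos (a / 2)) in *.
  apply Rle_trans with (4 * (s * s) * (s * s + c * c)); [right; simpl; ring | rewrite H2; lra].
Qed.

Lemma Cmod_expi_minus (a b : R) : Cmod (expi a - expi b) <= Rabs (a - b).
Proof.
  replace (expi a - expi b)%C with (expi b * (expi (a - b) - 1))%C.
  - rewrite Cmod_mult, Cmod_expi, Rmult_1_l. apply Cmod_expi_minus_one.
  - replace (expi a) with (expi (b + (a - b))) by (f_equal; ring). rewrite expi_plus. ring.
Qed.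

(** The cosine is nonpositive between a quarter and half a turn, so the real part of [1 - expi a] is
    already at least 1. In [wsum_high] this factor is divided out. *)
Lemma Cmod_expi_far (a : R) : PI / 2 <= Rabs a <= PI -> 1 <= Cmod (1 - expi a).
Proof.
  intros H. apply Rle_trans with (Re (1 - expi a)); [|apply Re_le_Cmod].
  simpl. assert (cos a <= 0); [|lra].
  replace (cos a) with (cos (Rabs a)).
  - apply cos_le_0; lra.
  - unfold Rabs. destruct (Rcase_abs a). apply cos_neg. reflexivity.
Qed.

Lemma Ccont_expi (al : R) : Ccont (fun x => expi (al * x)).
Proof.
  intros x. apply continuous_C_iff. intros eps He.
  pose proof (Rabs_pos al).
  exists (eps / (Rabs al + 1)). split. apply Rdiv_lt_0_compat; lra.
  intros y Hy. eapply Rle_lt_trans. apply Cmod_expi_minus.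
  replace (al * y - al * x) with (al * (y - x)) by ring. rewrite Rabs_mult.
  apply Rle_lt_trans with ((Rabs al + 1) * Rabs (y - x)).
  - apply Rmult_le_compat_r. apply Rabs_pos. lra.
  - replace eps with ((Rabs al + 1) * (eps / (Rabs al + 1))) by (field; lra).
    apply Rmult_lt_compat_l; lra.
Qed.

Lemma Ccont_expi_opp (al : R) : Ccont (fun x => expi (- (al * x))).
Proof.
  assert (E : (fun x => expi (- (al * x))) = (fun x => expi (- al * x))).
  { apply functional_extensionality. intro x. f_equal. ring. }
  rewrite E. apply Ccont_expi.
Qed.

(** * Integrals of complex-valued functions *)

Lemma Riemann_sum_linear {U V : NormedModule R_AbsRing} (l : U -> V) (f : R -> U) (ptd : SF_seq) :
  is_linear l -> Riemann_sum (fun x => l (f x)) ptd = l (Riemann_sum f ptd).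
Proof.
  intros Hl. revert ptd. apply SF_cons_ind.
  - intros x0. unfold Riemann_sum; simpl. symmetry. exact (linear_zero l Hl).
  - intros h s IH. rewrite !Riemann_sum_cons, IH. rewrite (linear_plus l Hl), (linear_scal l Hl). reflexivity.
Qed.

(** Riemann sums commute with [l], and continuity of [l] carries this to the limit. It serves
    multiplication by a constant, conjugation, evaluation at a point, Fourier coefficients and the
    free flow. *)
Lemma is_RInt_linear {U V : NormedModule R_AbsRing} (l : U -> V) (f : R -> U) (a b : R) (If : U) :
  is_linear l -> is_RInt f a b If -> is_RInt (fun x => l (f x)) a b (l If).
Proof.
  intros Hl H. unfold is_RInt in *.
  apply filterlim_ext with (f := fun ptd => l (scal (sign (b - a)) (Riemann_sum f ptd))).
  - intros x. rewrite (linear_scal l Hl). f_equal. symmetry. apply Riemann_sum_linear; auto.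
  - eapply filterlim_comp. exact H. apply (linear_cont l If Hl).
Qed.

Lemma is_linear_Cmult (c : C) : is_linear (U := CV) (V := CV) (fun z : C => (c * z)%C).
Proof.
  split.
  - intros x y. change (@eq C (c * (x + y))%C (c * x + c * y)%C). ring.
  - intros k x. rewrite !scal_R_Cmult. change (@eq C (c * (k * x))%C (k * (c * x))%C). ring.
  - exists (Cmod c + 1). pose proof (Cmod_ge_0 c). split. lra.
    intros x. rewrite !norm_C_R, Cmod_mult. apply Rmult_le_compat_r. apply Cmod_ge_0. lra.
Qed.

Lemma is_linear_Cconj : is_linear (U := CV) (V := CV) (fun z : C => Cconj z).
Proof.
  split.
  - intros x y. destruct x, y. unfold Cconj. change ((r + r1, - (r0 + r2)) = (r + r1, - r0 + - r2)). f_equal; ring.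
  - intros k x. rewrite !scal_R_Cmult. destruct x. unfold Cconj, Cmult; simpl. f_equal; ring.
  - exists 1. split. lra. intros x. rewrite !norm_C_R, Cmod_conj. lra.
Qed.

Lemma Ccont_conj (f : R -> C) : Ccont f -> Ccont (fun x => Cconj (f x)).
Proof.
  intros Hf x. apply (continuous_comp (V := CV) (W := CV) f (fun z => Cconj z)). apply Hf.
  apply (linear_cont (U := CV) (V := CV)), is_linear_Cconj.
Qed.

Definition Cint (f : R -> C) (a b : R) : C := RInt (V := CV) f a b.

Lemma Cint_correct (f : R -> C) (a b : R) : Ccont f -> is_RInt (V := CV) f a b (Cint f a b).
Proof. intros H. apply (RInt_correct (V := CV)). apply (ex_RInt_continuous (V := CV)). intros; apply H. Qed.

Lemma Cint_unique (f : R -> C) (a b : R) (l : C) : is_RInt (V := CV) f a b l -> Cint f a b = l.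
Proof. apply (is_RInt_unique (V := CV)). Qed.

Lemma Cint_ext (f g : R -> C) (a b : R) : (forall x, f x = g x) -> Cint f a b = Cint g a b.
Proof. intros H. apply (RInt_ext (V := CV)). intros; apply H. Qed.

Lemma Cint_plus (f g : R -> C) (a b : R) : Ccont f -> Ccont g ->
  Cint (fun x => f x + g x)%C a b = (Cint f a b + Cint g a b)%C.
Proof.
  intros Hf Hg. apply Cint_unique.
  apply (is_RInt_plus (V := CV) f g a b); apply Cint_correct; auto.
Qed.

Lemma Cint_mult (c : C) (f : R -> C) (a b : R) : Ccont f ->
  Cint (fun x => c * f x)%C a b = (c * Cint f a b)%C.
Proof.
  intros Hf. apply Cint_unique.
  apply (is_RInt_linear (U := CV) (V := CV) (fun z => c * z)%C).
  apply is_linear_Cmult. apply Cint_correct; auto.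
Qed.

Lemma Cint_conj (f : R -> C) (a b : R) : Ccont f ->
  Cint (fun x => Cconj (f x)) a b = Cconj (Cint f a b).
Proof.
  intros Hf. apply Cint_unique.
  apply (is_RInt_linear (U := CV) (V := CV) (fun z => Cconj z)).
  apply is_linear_Cconj. apply Cint_correct; auto.
Qed.

Lemma Cint_Chasles (f : R -> C) (a b c : R) : Ccont f ->
  (Cint f a b + Cint f b c)%C = Cint f a c.
Proof.
  intros Hf. symmetry. apply Cint_unique.
  apply (is_RInt_Chasles (V := CV) f a b c); apply Cint_correct; auto.
Qed.

Lemma Cint_bound (f : R -> C) (a b M : R) : Ccont f -> a <= b ->
  (forall x, a <= x <= b -> Cmod (f x) <= M) -> Cmod (Cint f a b) <= (b - a) * M.
Proof.
  intros Hf Hab H. rewrite <- norm_C_R.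
  apply (norm_RInt_le_const (V := CV) f a b); auto.
  - intros x Hx. rewrite norm_C_R. auto.
  - apply Cint_correct; auto.
Qed.

Lemma Cint_shift (f : R -> C) (a b c : R) : Ccont f ->
  Cint (fun x => f (x + c)) a b = Cint f (a + c) (b + c).
Proof.
  intros Hf. apply Cint_unique.
  pose proof (is_RInt_comp_lin (V := CV) f 1 c a b (Cint f (a + c) (b + c))) as H.
  eapply (is_RInt_ext (V := CV)); [|apply H].
  - intros x _. transitivity (f (1 * x + c)).
    exact (scal_one (V := CV) (f (1 * x + c))). f_equal. ring.
  - rewrite !Rmult_1_l. apply Cint_correct; auto.
Qed.

Lemma Cint_const (c : C) (a b : R) : Cint (fun _ => c) a b = (RtoC (b - a) * c)%C.
Proof. apply Cint_unique. rewrite <- scal_R_Cmult. apply (is_RInt_const (V := CV)). Qed.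

Lemma Cint_Re_ge0 (f : R -> C) (a b : R) : Ccont f -> a <= b ->
  (forall x, 0 <= Re (f x)) -> 0 <= Re (Cint f a b).
Proof.
  intros Hf Hab H.
  pose proof (is_RInt_fct_extend_fst (U := R_NormedModule) (V := R_NormedModule) f a b _ (Cint_correct f a b Hf)) as Hi.
  apply (is_RInt_ge_0 (fun t => fst (f t)) a b); auto.
Qed.

(** The explicit antiderivative has modulus [1 / Rabs al] at both ends. The bound does not depend on
    the interval, so the means of a nonconstant character vanish uniformly in the position of the
    window. *)
Lemma Cint_expi_bound (al a b : R) : al <> 0 -> Cmod (Cint (fun x => expi (al * x)) a b) <= 2 / Rabs al.
Proof.
  intros Hal.
  assert (E : Cint (fun x => expi (al * x)) a b = ((expi (al * b) - expi (al * a)) * (/ (Ci * al)))%C).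
  { apply Cint_unique.
    assert (H : is_RInt (V := CV) (fun x => expi (al * x)) a b
      ((sin (al * b) / al - sin (al * a) / al, (- cos (al * b) / al) - (- cos (al * a) / al)) : C)).
    { apply (is_RInt_fct_extend_pair (U := R_NormedModule) (V := R_NormedModule)); simpl.
      - apply (is_RInt_derive (V := R_CompleteNormedModule) (fun x => sin (al * x) / al) (fun x => cos (al * x))).
        + intros x _. auto_derive; auto. field. auto.
        + intros x _. apply continuity_pt_filterlim. reg.
      - apply (is_RInt_derive (V := R_CompleteNormedModule) (fun x => - cos (al * x) / al) (fun x => sin (al * x))).
        + intros x _. auto_derive; auto. field. auto.
        + intros x _. apply continuity_pt_filterlim. reg. }
    replace ((expi (al * b) - expi (al * a)) * (/ (Ci * al)))%C with
      ((sin (al * b) / al - sin (al * a) / al, (- cos (al * b) / al) - (- cos (al * a) / al)) : C); auto.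
    replace (/ (Ci * al))%C with (- Ci * RtoC (/ al))%C.
    - unfold expi, Ci, RtoC, Cmult, Cminus, Cplus, Copp; simpl. f_equal; field; auto.
    - rewrite RtoC_inv by auto. assert (RtoC al <> 0) by (intro h; apply Hal; apply RtoC_inj; auto).
      replace (- Ci)%C with (/ Ci)%C.
      + field. split; auto. apply Ci_nz.
      + assert (h : (Ci * - Ci)%C = 1) by (unfold Ci, Copp, Cmult, RtoC; simpl; f_equal; ring).
        transitivity (/ Ci * (Ci * - Ci))%C. rewrite h; ring. field. apply Ci_nz. }
  rewrite E, Cmod_mult. assert (RtoC al <> 0) by (intro h; apply Hal; apply RtoC_inj; auto).
  rewrite Cmod_inv by (apply Cmult_neq_0; auto; apply Ci_nz).
  rewrite Cmod_mult, Cmod_Ci, Cmod_R, Rmult_1_l.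
  unfold Rdiv. apply Rmult_le_compat_r.
  - left. apply Rinv_0_lt_compat. apply Rabs_pos_lt; auto.
  - unfold Cminus. eapply Rle_trans. apply Cmod_triangle. rewrite Cmod_opp, !Cmod_expi. lra.
Qed.

(** * Finite sums over initial segments *)

Fixpoint csum (n : nat) (f : nat -> C) : C :=
  match n with O => RtoC 0 | S m => (csum m f + f m)%C end.

Fixpoint rsum (n : nat) (f : nat -> R) : R :=
  match n with O => 0 | S m => rsum m f + f m end.

Lemma csum_ext n f g : (forall i, (i < n)%nat -> f i = g i) -> csum n f = csum n g.
Proof. induction n; simpl; intros H; auto. rewrite IHn, H; auto. Qed.

Lemma rsum_ext n f g : (forall i, (i < n)%nat -> f i = g i) -> rsum n f = rsum n g.
Proof. induction n; simpl; intros H; auto. rewrite IHn, H; auto. Qed.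

Lemma csum_plus n f g : csum n (fun i => f i + g i)%C = (csum n f + csum n g)%C.
Proof. induction n; simpl. ring. rewrite IHn. ring. Qed.

Lemma csum_mult n c f : csum n (fun i => c * f i)%C = (c * csum n f)%C.
Proof. induction n; simpl. ring. rewrite IHn. ring. Qed.

Lemma csum_conj n f : csum n (fun i => Cconj (f i)) = Cconj (csum n f).
Proof.
  induction n; simpl. unfold Cconj, RtoC; simpl; f_equal; ring.
  rewrite IHn. unfold Cconj, Cplus; simpl. f_equal; ring.
Qed.

Lemma csum_zero n : csum n (fun _ => RtoC 0) = RtoC 0.
Proof. induction n; simpl. auto. rewrite IHn. ring. Qed.

Lemma csum_swap n m (f : nat -> nat -> C) :
  csum n (fun i => csum m (fun j => f i j)) = csum m (fun j => csum n (fun i => f i j)).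
Proof.
  induction n; simpl. symmetry. apply csum_zero.
  rewrite IHn, <- csum_plus. reflexivity.
Qed.

Lemma csum_add n m f : csum (n + m) f = (csum n f + csum m (fun i => f (n + i)%nat))%C.
Proof.
  induction m; simpl. rewrite Nat.add_0_r. ring.
  rewrite Nat.add_succ_r. simpl. rewrite IHm. ring.
Qed.

Lemma rsum_add n m f : rsum (n + m) f = rsum n f + rsum m (fun i => f (n + i)%nat).
Proof.
  induction m; simpl. rewrite Nat.add_0_r. ring.
  rewrite Nat.add_succ_r. simpl. rewrite IHm. ring.
Qed.

Lemma rsum_le n f g : (forall i, (i < n)%nat -> f i <= g i) -> rsum n f <= rsum n g.
Proof. induction n; simpl; intros H. lra. pose proof (IHn ltac:(auto)). pose proof (H n ltac:(auto)). lra. Qed.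

Lemma rsum_const n c : rsum n (fun _ => c) = INR n * c.
Proof. induction n. simpl; ring. rewrite S_INR. simpl. rewrite IHn. ring. Qed.

Lemma rsum_plus n f g : rsum n (fun i => f i + g i) = rsum n f + rsum n g.
Proof. induction n; simpl. ring. rewrite IHn. ring. Qed.

Lemma rsum_mult n c f : rsum n (fun i => c * f i) = c * rsum n f.
Proof. induction n; simpl. ring. rewrite IHn. ring. Qed.

Lemma Cmod_csum n f : Cmod (csum n f) <= rsum n (fun i => Cmod (f i)).
Proof.
  induction n; simpl. rewrite Cmod_0. lra.
  eapply Rle_trans. apply Cmod_triangle. lra.
Qed.

Lemma Cmod_csum_le n f B : (forall i, (i < n)%nat -> Cmod (f i) <= B) -> Cmod (csum n f) <= INR n * B.
Proof. intros H. eapply Rle_trans. apply Cmod_csum. rewrite <- rsum_const. apply rsum_le. auto. Qed.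

Lemma Re_csum n f : Re (csum n f) = rsum n (fun i => Re (f i)).
Proof. induction n; simpl. auto. rewrite <- IHn. reflexivity. Qed.

Lemma rsum_block n m f : rsum (n * m) f = rsum n (fun i => rsum m (fun j => f (i * m + j)%nat)).
Proof. induction n; simpl. auto. rewrite Nat.add_comm, rsum_add, IHn. reflexivity. Qed.

Lemma csum_single n k c : (k < n)%nat -> csum n (fun i => if Nat.eqb i k then c else RtoC 0) = c.
Proof.
  induction n; intros H. lia. simpl. destruct (Nat.eq_dec k n) as [->|Hn].
  - rewrite Nat.eqb_refl. rewrite (csum_ext n _ (fun _ => RtoC 0)). rewrite csum_zero. ring.
    intros i Hi. destruct (Nat.eqb_spec i n); auto. lia.
  - rewrite IHn by lia. destruct (Nat.eqb_spec n k). lia. ring.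
Qed.

(** * Almost periodic functions *)

Definition period (f : R -> C) (eps tau : R) : Prop := forall x, Cmod (f (x + tau) - f x) <= eps.

Definition AP (f : R -> C) : Prop :=
  Ccont f /\ forall eps, 0 < eps -> exists L, 0 < L /\
    forall a, exists tau, a <= tau <= a + L /\ period f eps tau.

Lemma period_opp f eps tau : period f eps tau -> period f eps (- tau).
Proof.
  intros H x. specialize (H (x + - tau)). rewrite Cmod_minus_sym.
  replace (x + - tau + tau) with x in H by ring. auto.
Qed.

Lemma period_plus f e1 e2 t1 t2 : period f e1 t1 -> period f e2 t2 -> period f (e1 + e2) (t1 + t2).
Proof.
  intros H1 H2 x. eapply Rle_trans. apply (Cmod_triangle3 _ (f (x + t1))).
  specialize (H1 x). specialize (H2 (x + t1)). replace (x + (t1 + t2)) with (x + t1 + t2) by ring. lra.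
Qed.

Lemma Cmod_le_of_sup_norm_lt (g : R -> C) eps : Rbar_lt (sup_norm g) (Finite eps) -> forall x, Cmod (g x) <= eps.
Proof.
  intros H x. unfold sup_norm in H.
  pose proof (proj1 (Lub_Rbar_correct (fun y => exists x, y = Cmod (g x))) (Cmod (g x)) (ex_intro _ x eq_refl)) as P.
  pose proof (Rbar_le_lt_trans _ _ _ P H) as Q. simpl in Q. lra.
Qed.

Lemma sup_norm_le (g : R -> C) eps : (forall x, Cmod (g x) <= eps) -> Rbar_le (sup_norm g) (Finite eps).
Proof.
  intros H. apply (proj2 (Lub_Rbar_correct (fun y => exists x, y = Cmod (g x)))).
  intros y [x ->]. simpl. auto.
Qed.

(** The two forms differ in the sign of [tau] and in a strict inequality for the supremum: the
    opposite of an almost period is an almost period, and passing to [eps / 2] restores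
    strictness. *)
Lemma almost_periodic_iff (f : R -> C) : almost_periodic f <-> AP f.
Proof.
  split; intros [Hc H]; split; auto; intros eps He.
  - destruct (H eps He) as [L [HL H']]. exists L. split; auto. intros a.
    destruct (H' a) as [tau [Ht Hs]]. exists tau. split; auto.
    replace tau with (- - tau) by ring. apply period_opp.
    intros x. apply (Cmod_le_of_sup_norm_lt _ _ Hs x).
  - destruct (H (eps / 2) ltac:(lra)) as [L [HL H']]. exists L. split; auto. intros a.
    destruct (H' a) as [tau [Ht Hs]]. exists tau. split; auto.
    apply Rbar_le_lt_trans with (Finite (eps / 2)).
    + apply sup_norm_le. intros x. apply (period_opp _ _ _ Hs x).
    + simpl. lra.
Qed.

(** An almost period carries any point into [[0, L]], where a continuous function has a maximum. *)
Lemma AP_bounded (f : R -> C) : AP f -> exists B, 0 < B /\ forall x, Cmod (f x) <= B.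
Proof.
  intros [Hc H]. destruct (H 1 ltac:(lra)) as [L [HL HH]].
  destruct (continuity_ab_maj (fun x => Cmod (f x)) 0 L ltac:(lra)) as [M [HM _]].
  - intros c _. apply continuity_pt_filterlim. apply filterlim_locally. intros eps.
    apply locally_R_iff.
    destruct (proj1 (continuous_C_iff f c) (Hc c) eps (cond_pos eps)) as [d [Hd Hd']].
    exists d. split; auto. intros y Hy. specialize (Hd' y Hy).
    change (Rabs (Cmod (f y) - Cmod (f c)) < eps).
    pose proof (Cmod_le_add (f y) (f c)). pose proof (Cmod_le_add (f c) (f y)).
    rewrite (Cmod_minus_sym (f c)) in H1. apply Rabs_def1; lra.
  - exists (Cmod (f M) + 1). pose proof (Cmod_ge_0 (f M)). split. lra. intros x.
    destruct (HH (- x)) as [tau [Ht Hp]]. specialize (HM (x + tau) ltac:(lra)).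
    specialize (Hp x). pose proof (Cmod_le_add (f x) (f (x + tau))).
    rewrite Cmod_minus_sym in H1. simpl in HM. lra.
Qed.

Lemma AP_unifcont (f : R -> C) : AP f -> forall eps, 0 < eps ->
  exists d, 0 < d /\ forall x y, Rabs (x - y) < d -> Cmod (f x - f y) <= eps.
Proof.
  intros [Hc H] eps He. destruct (H (eps / 3) ltac:(lra)) as [L [HL HH]].
  (* The margin 1 on either side keeps [y + tau] in the compact interval when [x + tau] lies in
     [[0, L]] and [y] is within 1 of [x]. *)
  destruct (unifcont_normed_1d (K := R_AbsRing) (V := CV) f (- 1) (L + 1)
    ltac:(intros; apply Hc) (mkposreal (eps / 3) ltac:(lra))) as [d Hd].
  exists (Rmin d 1). split. apply Rmin_glb_lt. apply cond_pos. lra.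
  intros x y Hxy. pose proof (Rmin_l d 1). pose proof (Rmin_r d 1).
  destruct (HH (- x)) as [tau [Ht Hp]].
  apply Rabs_def2 in Hxy.
  specialize (Hd (x + tau) (y + tau) ltac:(lra) ltac:(lra)).
  assert (Hb : ball (x + tau) d (y + tau)).
  { change (Rabs ((y + tau) - (x + tau)) < d). apply Rabs_def1; lra. }
  specialize (Hd Hb). unfold ball_norm in Hd. rewrite norm_C_R in Hd.
  change (Cmod (f (y + tau) - f (x + tau)) < eps / 3) in Hd.
  pose proof (Hp x) as Hx. pose proof (Hp y) as Hy.
  eapply Rle_trans. apply (Cmod_triangle3 _ (f (x + tau))).
  pose proof (Cmod_triangle3 (f (x + tau)) (f (y + tau)) (f y)).
  rewrite Cmod_minus_sym in Hx. rewrite Cmod_minus_sym in Hd. lra.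
Qed.

(** Total boundedness of the set of translates, encoded by a finite colouring of the translations. *)
Definition tot_bounded (f : R -> C) : Prop :=
  forall eps, 0 < eps -> exists (n : nat) (c : R -> nat),
    (forall t, (c t < n)%nat) /\ forall t s, c t = c s -> period f eps (t - s).

(** One half of Bochner's criterion. Subtracting an almost period [p] moves a translation [t] into
    [[0, L]]; its colour is the index of the piece of length [d] that contains [t - p], and uniform
    continuity compares translations in the same piece. *)
Lemma AP_tot_bounded f : AP f -> tot_bounded f.
Proof.
  intros Hf eps He. destruct (AP_unifcont f Hf (eps / 3) ltac:(lra)) as [d [Hd Hu]].
  destruct Hf as [Hc H]. destruct (H (eps / 3) ltac:(lra)) as [L [HL HH]].
  assert (P : forall t, {p : R * nat | (0 <= t - fst p <= L /\ period f (eps / 3) (fst p)) /\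
     INR (snd p) <= (t - fst p) / d < INR (snd p) + 1}).
  { intros t. apply constructive_indefinite_description.
    destruct (HH (t - L)) as [p [Hp Hp']].
    destruct (nfloor_ex ((t - p) / d)) as [k Hk].
    - apply Rdiv_le_0_compat; lra.
    - exists (p, k). simpl. split; auto. split; auto. lra. }
  destruct (nfloor_ex (L / d)) as [n Hn]. apply Rdiv_le_0_compat; lra.
  exists (S n), (fun t => snd (proj1_sig (P t))). split.
  - intros t. destruct (P t) as [[p k] [[H1 H2] H3]]; simpl in *.
    apply INR_lt. rewrite S_INR. apply Rle_lt_trans with ((t - p) / d). lra.
    apply Rle_lt_trans with (L / d); [|lra]. apply Rmult_le_compat_r. left. apply Rinv_0_lt_compat; auto. lra.
  - intros t s. destruct (P t) as [[p k] [[H1 H2] H3]]; destruct (P s) as [[q j] [[H4 H5] H6]]; simpl in *.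
    intros <-. intros x.
    assert (Hr : Rabs ((t - p) - (s - q)) < d).
    { assert (Rabs ((t - p) / d - (s - q) / d) < 1) by (apply Rabs_def1; lra).
      replace ((t - p) / d - (s - q) / d) with (((t - p) - (s - q)) / d) in H0 by (field; lra).
      unfold Rdiv in H0. rewrite Rabs_mult, (Rabs_pos_eq (/ d)) in H0 by (left; apply Rinv_0_lt_compat; auto).
      apply Rmult_lt_compat_r with (r := d) in H0; auto. rewrite Rmult_assoc, Rinv_l in H0 by lra. lra. }
    pose proof (period_plus _ _ _ _ _ H2 (period_opp _ _ _ H5)) as Hp.
    specialize (Hp (x + ((t - p) - (s - q)))).
    replace (x + (t - p - (s - q)) + (p + - q)) with (x + (t - s)) in Hp by ring.
    eapply Rle_trans. apply Cmod_triangle3.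
    specialize (Hu (x + ((t - p) - (s - q))) x).
    replace (x + (t - p - (s - q)) - x) with (t - p - (s - q)) in Hu by ring.
    specialize (Hu Hr). eapply Rle_trans. apply Rplus_le_compat. apply Hp. apply Hu. lra.
Qed.

(** Choosing one representative for each of the finitely many colours that occur gives a bounded set
    of representatives. This bound becomes the inclusion length of the almost periods. *)
Lemma pigeonhole_repr (c : R -> nat) (n : nat) :
  exists M, 0 <= M /\ forall t, (c t < n)%nat -> exists s, c s = c t /\ Rabs s <= M.
Proof.
  induction n as [|n [M [HM IH]]].
  - exists 0. split. lra. intros; lia.
  - destruct (classic (exists s, c s = n)) as [[s Hs]|Hn].
    + exists (Rmax M (Rabs s)). split. eapply Rle_trans. apply HM. apply Rmax_l.
      intros t Ht. destruct (Nat.eq_dec (c t) n) as [E|E].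
      * exists s. split. lia. apply Rmax_r.
      * destruct (IH t ltac:(lia)) as [s' [H1 H2]]. exists s'. split; auto. eapply Rle_trans. apply H2. apply Rmax_l.
    + exists M. split; auto. intros t Ht. destruct (Nat.eq_dec (c t) n) as [E|E].
      * exfalso. apply Hn. exists t; auto.
      * apply IH. lia.
Qed.

Lemma pair_code_inj (a b a' b' n : nat) : (b < n)%nat -> (b' < n)%nat ->
  (a * n + b = a' * n + b')%nat -> a = a' /\ b = b'.
Proof.
  intros H H' E. pose proof (Nat.div_unique (a * n + b) n a b H ltac:(lia)).
  pose proof (Nat.div_unique (a' * n + b') n a' b' H' ltac:(lia)). split.
  congruence. assert (a = a') by congruence. subst a'. lia.
Qed.

(** Common almost periods of two functions are not visible in the definition of almost periodicity,
    whereas two finite colourings have a product colouring. This is why sums and products are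
    handled through [tot_bounded]. *)
Lemma tot_bounded_pair f g : tot_bounded f -> tot_bounded g -> forall eps, 0 < eps -> exists (n : nat) (c : R -> nat),
    (forall t, (c t < n)%nat) /\ forall t s, c t = c s -> period f eps (t - s) /\ period g eps (t - s).
Proof.
  intros Hf Hg eps He. destruct (Hf eps He) as [n [c [H1 H2]]]. destruct (Hg eps He) as [m [e [H3 H4]]].
  exists (n * m)%nat, (fun t => c t * m + e t)%nat. split.
  - intros t. specialize (H1 t). specialize (H3 t). nia.
  - intros t s E. destruct (pair_code_inj _ _ _ _ _ (H3 t) (H3 s) E). auto.
Qed.

Lemma AP_of_tot_bounded f : Ccont f -> tot_bounded f -> AP f.
Proof.
  intros Hc H. split; auto. intros eps He. destruct (H eps He) as [n [c [H1 H2]]].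
  destruct (pigeonhole_repr c n) as [M [HM HH]].
  exists (2 * M + 1). split. lra. intros a.
  (* The translation [a + M] shares its colour with some [s] of size at most [M], so [a + M - s] is
     an almost period in [[a, a + 2 * M]]. *)
  destruct (HH (a + M) (H1 _)) as [s [Hs Hs']]. exists (a + M - s).
  apply Rabs_le_between in Hs'. split. lra. apply H2. auto.
Qed.

Lemma tot_bounded_combine f g h : tot_bounded f -> tot_bounded g ->
  (exists K, 0 < K /\ forall eps t, period f eps t -> period g eps t -> period h (K * eps) t) -> tot_bounded h.
Proof.
  intros Hf Hg [K [HK H]] eps He. destruct (tot_bounded_pair f g Hf Hg (eps / K)) as [n [c [H1 H2]]].
  apply Rdiv_lt_0_compat; auto.
  exists n, c. split; auto. intros t s E. destruct (H2 t s E) as [P Q].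
  pose proof (H _ _ P Q) as HH. replace (K * (eps / K)) with eps in HH by (field; lra). auto.
Qed.

Lemma AP_plus f g : AP f -> AP g -> AP (fun x => f x + g x)%C.
Proof.
  intros Hf Hg. apply AP_of_tot_bounded. apply Ccont_plus; [apply Hf | apply Hg].
  apply (tot_bounded_combine f g); try (apply AP_tot_bounded; auto). exists 2. split. lra.
  intros eps t H1 H2 x. specialize (H1 x). specialize (H2 x).
  replace (f (x + t)%R + g (x + t)%R - (f x + g x))%C with ((f (x + t)%R - f x) + (g (x + t)%R - g x))%C by ring.
  eapply Rle_trans. apply Cmod_triangle. lra.
Qed.

Lemma AP_mult f g : AP f -> AP g -> AP (fun x => f x * g x)%C.
Proof.
  intros Hf Hg. apply AP_of_tot_bounded. apply Ccont_mult; [apply Hf | apply Hg].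
  destruct (AP_bounded f Hf) as [A [HA HA']]. destruct (AP_bounded g Hg) as [B [HB HB']].
  apply (tot_bounded_combine f g); try (apply AP_tot_bounded; auto). exists (A + B). split. lra.
  intros eps t H1 H2 x. specialize (H1 x). specialize (H2 x).
  replace (f (x + t)%R * g (x + t)%R - (f x * g x))%C with ((f (x + t)%R - f x) * g (x + t)%R + f x * (g (x + t)%R - g x))%C by ring.
  eapply Rle_trans. apply Cmod_triangle. rewrite !Cmod_mult.
  specialize (HA' x). specialize (HB' (x + t)).
  pose proof (Cmod_ge_0 (f (x + t) - f x)). pose proof (Cmod_ge_0 (g (x + t) - g x)).
  pose proof (Cmod_ge_0 (f x)). pose proof (Cmod_ge_0 (g (x + t))).
  assert (Cmod (f (x + t) - f x) * Cmod (g (x + t)) <= eps * B) by (apply Rmult_le_compat; lra).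
  assert (Cmod (f x) * Cmod (g (x + t) - g x) <= A * eps) by (apply Rmult_le_compat; lra).
  lra.
Qed.

Lemma AP_const c : AP (fun _ => c).
Proof.
  split. apply Ccont_const. intros eps He. exists 1. split. lra. intros a. exists a. split. lra.
  intros x. replace (c - c)%C with (RtoC 0) by ring. rewrite Cmod_0. lra.
Qed.

Lemma AP_scal c f : AP f -> AP (fun x => c * f x)%C.
Proof. intros. apply (AP_mult (fun _ => c) f); auto. apply AP_const. Qed.

Lemma AP_minus f g : AP f -> AP g -> AP (fun x => f x - g x)%C.
Proof.
  intros Hf Hg. replace (fun x => f x - g x)%C with (fun x => f x + (RtoC (-1)) * g x)%C.
  apply AP_plus; auto. apply AP_scal; auto. apply functional_extensionality. intros x.
  ring.
Qed.

Lemma AP_conj f : AP f -> AP (fun x => Cconj (f x)).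
Proof.
  intros [Hc H]. split. apply Ccont_conj; auto. intros eps He. destruct (H eps He) as [L [HL H']].
  exists L. split; auto. intros a. destruct (H' a) as [tau [Ht Hp]]. exists tau. split; auto.
  intros x. specialize (Hp x).
  replace (Cconj (f (x + tau)%R) - Cconj (f x))%C with (Cconj (f (x + tau)%R - f x)).
  rewrite Cmod_conj. auto. destruct (f (x + tau)), (f x). unfold Cconj, Cminus, Cplus, Copp; simpl. f_equal; ring.
Qed.

Lemma AP_shift f c : AP f -> AP (fun x => f (x + c)).
Proof.
  intros [Hc H]. split. apply Ccont_shift; auto. intros eps He. destruct (H eps He) as [L [HL H']].
  exists L. split; auto. intros a. destruct (H' a) as [tau [Ht Hp]]. exists tau. split; auto.
  intros x. specialize (Hp (x + c)). replace (x + tau + c) with (x + c + tau) by ring. auto.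
Qed.

Lemma AP_limit f : (forall eps, 0 < eps -> exists g, AP g /\ forall x, Cmod (f x - g x) <= eps) -> AP f.
Proof.
  intros H. split.
  - intros x. apply continuous_C_iff. intros eps He. destruct (H (eps / 4) ltac:(lra)) as [g [[Hg _] Hfg]].
    destruct (proj1 (continuous_C_iff g x) (Hg x) (eps / 4) ltac:(lra)) as [d [Hd Hd']].
    exists d. split; auto. intros y Hy. specialize (Hd' y Hy).
    pose proof (Hfg x) as Hx. pose proof (Hfg y). rewrite Cmod_minus_sym in Hx.
    pose proof (Cmod_triangle3 (f y) (g y) (f x)). pose proof (Cmod_triangle3 (g y) (g x) (f x)). lra.
  - intros eps He. destruct (H (eps / 3) ltac:(lra)) as [g [[_ Hg] Hfg]].
    destruct (Hg (eps / 3) ltac:(lra)) as [L [HL H']].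
    exists L. split; auto. intros a. destruct (H' a) as [tau [Ht Hp]]. exists tau. split; auto.
    intros x. specialize (Hp x). pose proof (Hfg x) as Hx. pose proof (Hfg (x + tau)). rewrite Cmod_minus_sym in Hx.
    pose proof (Cmod_triangle3 (f (x + tau)) (g (x + tau)) (f x)). pose proof (Cmod_triangle3 (g (x + tau)) (g x) (f x)). lra.
Qed.

Lemma real_grid (d : R) : 0 < d -> exists (n : nat) (c : R -> nat),
  (forall y, (c y < n)%nat) /\ forall y z, -1 <= y <= 1 -> -1 <= z <= 1 -> c y = c z -> Rabs (y - z) < d.
Proof.
  intros Hd. destruct (nfloor_ex (2 / d)) as [n Hn]. apply Rdiv_le_0_compat; lra.
  assert (P : forall y, {k : nat | (k < S n)%nat /\ (-1 <= y <= 1 -> INR k <= (y + 1) / d < INR k + 1)}).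
  { intros y. apply constructive_indefinite_description.
    destruct (classic (-1 <= y <= 1)) as [h|h].
    - destruct (nfloor_ex ((y + 1) / d)) as [k Hk]. apply Rdiv_le_0_compat; lra.
      exists k. split; auto. apply INR_lt. rewrite S_INR. apply Rle_lt_trans with ((y + 1) / d). lra.
      apply Rle_lt_trans with (2 / d); [|lra]. apply Rmult_le_compat_r. left. apply Rinv_0_lt_compat; auto. lra.
    - exists 0%nat. split. lia. intros; contradiction. }
  exists (S n), (fun y => proj1_sig (P y)). split.
  - intros y. destruct (P y); simpl; tauto.
  - intros y z Hy Hz. destruct (P y) as [k [Hk0 Hk]]; destruct (P z) as [j [Hj0 Hj]]; simpl. intros <-.
    specialize (Hk Hy). specialize (Hj Hz).
    assert (H0 : Rabs ((y + 1) / d - (z + 1) / d) < 1) by (apply Rabs_def1; lra).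
    replace ((y + 1) / d - (z + 1) / d) with ((y - z) / d) in H0 by (field; lra).
    unfold Rdiv in H0. rewrite Rabs_mult, (Rabs_pos_eq (/ d)) in H0 by (left; apply Rinv_0_lt_compat; auto).
    apply Rmult_lt_compat_r with (r := d) in H0; auto. rewrite Rmult_assoc, Rinv_l in H0 by lra. lra.
Qed.

(** A translation [t] is coloured by the grid cells of [cos (al * t)] and [sin (al * t)]; equal
    colours make the characters at [t] and [s] close. The frequency 0 is included without a separate
    case. *)
Lemma AP_expi al : AP (fun x => expi (al * x)).
Proof.
  apply AP_of_tot_bounded. apply Ccont_expi. intros eps He.
  destruct (real_grid (eps / 2) ltac:(lra)) as [n [c [H1 H2]]].
  exists (n * n)%nat, (fun t => c (cos (al * t)) * n + c (sin (al * t)))%nat. split.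
  - intros t. pose proof (H1 (cos (al * t))). pose proof (H1 (sin (al * t))). nia.
  - intros t s E. destruct (pair_code_inj _ _ _ _ _ (H1 _) (H1 _) E) as [Ec Es].
    apply H2 in Ec; try apply COS_bound. apply H2 in Es; try apply SIN_bound.
    intros x. replace (al * (x + (t - s))) with (al * x + (al * t - al * s)) by ring.
    rewrite expi_plus. replace (expi (al * x)%R * expi (al * t - al * s)%R - expi (al * x)%R)%C
     with (expi (al * x)%R * expi (- (al * s))%R * (expi (al * t)%R - expi (al * s)%R))%C.
    2:{ replace (al * t - al * s) with (al * t + - (al * s)) by ring. rewrite expi_plus.
      replace (expi (al * x)%R * (expi (al * t)%R * expi (- (al * s))%R) - expi (al * x)%R)%C with
        (expi (al * x)%R * (expi (al * t)%R * expi (- (al * s))%R) - expi (al * x)%R * 1)%C by ring.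
      rewrite <- (expi_opp_r (al * s)). ring. }
    rewrite !Cmod_mult, !Cmod_expi, !Rmult_1_l.
    set (p := (expi (al * t)%R - expi (al * s)%R)%C).
    eapply Rle_trans. apply Cmod_le_Re_Im. unfold p, expi; simpl. unfold Rminus in *. lra.
Qed.

Lemma AP_expi_opp al : AP (fun x => expi (- (al * x))).
Proof.
  replace (fun x => expi (- (al * x))) with (fun x => expi (- al * x)). apply AP_expi.
  apply functional_extensionality. intro x. f_equal. ring.
Qed.

Lemma AP_twist f al : AP f -> AP (fun x => f x * expi (- (al * x)))%C.
Proof. intros. apply AP_mult; auto. apply AP_expi_opp. Qed.

(** * Mean values *)

Definition window_mean (f : R -> C) (b T : R) : C := (RtoC (/ T) * Cint f b (b + T)%R)%C.

(** The limit is uniform in the position [b] of the window, which is more than [mean] asks for.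
    Almost periodicity provides it, and it makes means invariant under translation. *)
Definition is_mean (f : R -> C) (m : C) : Prop :=
  forall eps, 0 < eps -> exists S0, 0 < S0 /\ forall S, S0 <= S -> forall b, Cmod (window_mean f b S - m) <= eps.

(** The windows starting at [b] and at [tau] differ by two pieces of length [tau - b], and the
    window at [tau] is compared pointwise with the one at 0. *)
Lemma Cint_translate_bound f B e tau b T : Ccont f -> (forall x, Cmod (f x) <= B) -> period f e tau ->
  b <= tau -> 0 <= T ->
  Cmod (Cint f b (b + T) - Cint f 0 T) <= 2 * (tau - b) * B + T * e.
Proof.
  intros Hc HB Hp Hb HT.
  assert (E1 : Cint f b (b + T) = (Cint f b tau + Cint f tau (tau + T)%R - Cint f (b + T)%R (tau + T)%R)%C).
  { rewrite Cint_Chasles by auto. rewrite <- (Cint_Chasles f b (b + T) (tau + T)) by auto. ring. }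
  assert (E2 : Cint f tau (tau + T) = Cint (fun x => f (x + tau)) 0 T).
  { rewrite Cint_shift by auto. f_equal; ring. }
  assert (E3 : (Cint (fun x => f (x + tau)%R) 0 T - Cint f 0 T)%C = Cint (fun x => f (x + tau)%R + RtoC (-1) * f x)%C 0 T).
  { rewrite Cint_plus, Cint_mult; auto. ring. apply Ccont_shift; auto.
    apply (Ccont_mult (fun _ => RtoC (-1))); auto. apply Ccont_const. }
  replace (Cint f b (b + T)%R - Cint f 0 T)%C with
   (Cint f b tau + (- Cint f (b + T)%R (tau + T)%R + (Cint (fun x => f (x + tau)%R) 0 T - Cint f 0 T)))%C.
  2:{ rewrite E1, E2. ring. }
  rewrite E3. eapply Rle_trans. apply Cmod_triangle.
  eapply Rle_trans. apply Rplus_le_compat_l. apply Cmod_triangle. rewrite Cmod_opp.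
  assert (Cmod (Cint f b tau) <= (tau - b) * B) by (apply Cint_bound; auto).
  assert (Cmod (Cint f (b + T) (tau + T)) <= (tau + T - (b + T)) * B) by (apply Cint_bound; auto; lra).
  assert (Cmod (Cint (fun x => f (x + tau)%R + RtoC (-1) * f x)%C 0 T) <= (T - 0) * e).
  { apply Cint_bound; auto.
    - apply Ccont_plus. apply Ccont_shift; auto. apply (Ccont_mult (fun _ => RtoC (-1))); auto. apply Ccont_const.
    - intros x _. specialize (Hp x).
      replace (f (x + tau)%R + RtoC (-1) * f x)%C with (f (x + tau)%R - f x)%C by ring. auto. }
  lra.
Qed.

Lemma window_shift f : AP f -> forall eps, 0 < eps -> exists T0, 0 < T0 /\
  forall T, T0 <= T -> forall b, Cmod (Cint f b (b + T) - Cint f 0 T) <= T * eps.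
Proof.
  intros Hf eps He. destruct (AP_bounded f Hf) as [B [HB HB']].
  destruct Hf as [Hc H]. destruct (H (eps / 2) ltac:(lra)) as [L [HL HH]].
  assert (0 < 4 * L * B / eps) by (apply Rdiv_lt_0_compat; nra).
  (* The two end pieces cost at most [2 * L * B], which is half of [T * eps] for such [T]; the
     almost period costs the other half. *)
  exists (4 * L * B / eps). split; auto. intros T HT b.
  destruct (HH b) as [tau [Ht Hp]].
  eapply Rle_trans. apply (Cint_translate_bound f B (eps / 2) tau b T); auto; lra.
  assert (2 * (tau - b) * B <= 2 * L * B) by nra.
  assert (4 * L * B <= T * eps).
  { apply Rmult_le_compat_r with (r := eps) in HT; [|lra]. replace (4 * L * B / eps * eps) with (4 * L * B) in HT by (field; lra). auto. }
  lra.
Qed.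

Lemma Cint_windows f (w : C) b T e n : Ccont f -> 0 <= T ->
  (forall b, Cmod (Cint f b (b + T) - RtoC T * w) <= T * e) ->
  Cmod (Cint f b (b + INR n * T) - RtoC (INR n * T) * w) <= INR n * T * e.
Proof.
  intros Hc HT H. induction n.
  - simpl INR. rewrite !Rmult_0_l, Rplus_0_r.
    assert (Cint f b b = RtoC 0) by (apply Cint_unique, (is_RInt_point (V := CV))).
    rewrite H0. replace (0 - 0 * w)%C with (RtoC 0) by ring. rewrite Cmod_0. lra.
  - rewrite S_INR. specialize (H (b + INR n * T)).
    rewrite <- (Cint_Chasles f b (b + INR n * T)) by auto.
    replace (b + (INR n + 1) * T) with (b + INR n * T + T) by ring.
    replace ((INR n + 1) * T) with (INR n * T + T) by ring. rewrite RtoC_plus.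
    match goal with |- Cmod (?A + ?B - (?x + ?y) * w) <= _ => replace (A + B - (x + y) * w)%C with ((A - x * w) + (B - y * w))%C by ring end.
    eapply Rle_trans. apply Cmod_triangle. lra.
Qed.

(** A long window is tiled by windows of length [T], each with nearly the same integral; the
    incomplete last tile changes the integral and its prediction by at most [T * B] each. *)
Lemma window_mean_long f : AP f -> forall eps, 0 < eps -> exists T0, 0 < T0 /\ forall T, T0 <= T ->
  exists S0, 0 < S0 /\ forall S, S0 <= S -> forall b, Cmod (window_mean f b S - window_mean f 0 T) <= eps.
Proof.
  intros Hf eps He. destruct (AP_bounded f Hf) as [B [HB HB']].
  destruct (window_shift f Hf (eps / 2) ltac:(lra)) as [T0 [HT0 H]].
  destruct Hf as [Hc _]. exists T0. split; auto. intros T HT. specialize (H T HT).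
  assert (HT' : 0 < T) by lra.
  set (w := window_mean f 0 T).
  assert (Hw : (RtoC T * w)%C = Cint f 0 T).
  { unfold w, window_mean. rewrite Rplus_0_l, Cmult_assoc, <- RtoC_mult, Rinv_r by lra. ring. }
  assert (Hwb : Cmod w <= B).
  { unfold w, window_mean. rewrite Cmod_mult, Cmod_R, Rabs_pos_eq by (left; apply Rinv_0_lt_compat; lra).
    apply Rmult_le_reg_l with T; auto. rewrite <- Rmult_assoc, Rinv_r, Rmult_1_l by lra.
    eapply Rle_trans. apply (Cint_bound f 0 (0 + T) B); auto. lra. right; ring. }
  assert (0 < 4 * T * B / eps) by (apply Rdiv_lt_0_compat; nra).
  exists (4 * T * B / eps). split; auto. intros S HS b.
  assert (HS' : 0 < S) by lra.
  destruct (nfloor_ex (S / T)) as [n Hn]. apply Rdiv_le_0_compat; lra.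
  assert (Hn1 : INR n * T <= S).
  { apply Rle_trans with (S / T * T). apply Rmult_le_compat_r; lra. right; field; lra. }
  assert (Hn2 : S < INR n * T + T).
  { replace S with (S / T * T) by (field; lra). replace (INR n * T + T) with ((INR n + 1) * T) by ring. apply Rmult_lt_compat_r; lra. }
  assert (Hmain : Cmod (Cint f b (b + S) - RtoC S * w) <= S * eps).
  { rewrite <- (Cint_Chasles f b (b + INR n * T) (b + S)) by auto.
    replace S with (INR n * T + (S - INR n * T)) at 2 by ring. rewrite RtoC_plus.
    match goal with |- Cmod (?A + ?B - (?x + ?y) * w) <= _ => replace (A + B - (x + y) * w)%C with ((A - x * w) + (B - y * w))%C by ring end.
    eapply Rle_trans. apply Cmod_triangle.
    eapply Rle_trans. apply Rplus_le_compat. apply (Cint_windows f w b T (eps / 2) n); auto. lra.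
    intros b'. rewrite Hw. apply H.
    unfold Cminus. apply Cmod_triangle. rewrite Cmod_opp, Cmod_mult, Cmod_R, Rabs_pos_eq by lra.
    assert (Cmod (Cint f (b + INR n * T) (b + S)) <= (b + S - (b + INR n * T)) * B) by (apply Cint_bound; auto; lra).
    assert (4 * T * B <= S * eps).
    { apply Rmult_le_compat_r with (r := eps) in HS; [|lra]. replace (4 * T * B / eps * eps) with (4 * T * B) in HS by (field; lra). auto. }
    assert ((S - INR n * T) * Cmod w <= T * B). { apply Rmult_le_compat; try lra. apply Cmod_ge_0. }
    assert ((b + S - (b + INR n * T)) * B <= T * B) by (apply Rmult_le_compat_r; lra).
    assert (INR n * T * (eps / 2) <= S * (eps / 2)) by (apply Rmult_le_compat_r; lra).
    lra. }
  unfold window_mean. replace (RtoC (/ S) * Cint f b (b + S)%R - w)%C with (RtoC (/ S) * (Cint f b (b + S)%R - RtoC S * w))%C.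
  - rewrite Cmod_mult, Cmod_R, Rabs_pos_eq by (left; apply Rinv_0_lt_compat; lra).
    apply Rmult_le_reg_l with S; auto. rewrite <- Rmult_assoc, Rinv_r, Rmult_1_l by lra. auto.
  - replace (RtoC (/ S) * (Cint f b (b + S)%R - RtoC S * w))%C with (RtoC (/ S) * Cint f b (b + S)%R - (RtoC (/ S) * RtoC S) * w)%C by ring.
    rewrite <- RtoC_mult, Rinv_l by lra. ring.
Qed.

Lemma AP_is_mean_ex f : AP f -> exists m, is_mean f m.
Proof.
  intros Hf.
  assert (HC : exists m : CV, filterlim (fun S => window_mean f 0 S : CV) (Rbar_locally p_infty) (locally m)).
  { apply (filterlim_locally_cauchy (U := CV)). intros eps.
    pose proof (cond_pos eps) as He.
    destruct (window_mean_long f Hf (eps / 4) ltac:(lra)) as [T0 [HT0 H]].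
    destruct (H T0 ltac:(lra)) as [S0 [HS0 HH]].
    exists (fun S => S0 <= S). split.
    - exists S0. intros; lra.
    - intros u v Hu Hv. apply (norm_compat1 (V := CV)). rewrite norm_C_R.
      change (Cmod (window_mean f 0 v - window_mean f 0 u) < eps).
      pose proof (HH u Hu 0) as Q1. pose proof (HH v Hv 0) as Q2. rewrite Cmod_minus_sym in Q1.
      pose proof (Cmod_triangle3 (window_mean f 0 v) (window_mean f 0 T0) (window_mean f 0 u)). lra. }
  destruct HC as [m Hm]. exists m. intros eps He.
  destruct (window_mean_long f Hf (eps / 2) ltac:(lra)) as [T0 [HT0 H]].
  pose proof (proj1 (filterlim_CV _ _ _) Hm (eps / 2) ltac:(lra)) as [M HM].
  set (T := Rmax T0 (M + 1)).
  assert (T0 <= T) by apply Rmax_l. assert (M + 1 <= T) by apply Rmax_r.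
  destruct (H T H0) as [S0 [HS0 HH]]. exists S0. split; auto. intros S HS b.
  specialize (HH S HS b). specialize (HM T ltac:(lra)).
  pose proof (Cmod_triangle3 (window_mean f b S) (window_mean f 0 T) m). lra.
Qed.

Lemma mean_of_is_mean f m : is_mean f m -> mean f = m.
Proof.
  intros H. unfold mean. apply (iota_filterlim_locally (V := CV)).
  apply filterlim_CV. apply Rbar_locally_filter. intros eps He.
  destruct (H (eps / 2) ltac:(lra)) as [S0 [HS0 HH]]. exists S0. intros L HL.
  specialize (HH (2 * L) ltac:(lra) (- L)). unfold window_mean in HH. replace (- L + 2 * L) with L in HH by ring.
  eapply Rle_lt_trans. apply HH. lra.
Qed.

Lemma AP_mean f : AP f -> is_mean f (mean f).
Proof. intros Hf. destruct (AP_is_mean_ex f Hf) as [m Hm]. rewrite (mean_of_is_mean f m Hm). auto. Qed.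

Lemma is_mean_ext f g m : (forall x, f x = g x) -> is_mean f m -> is_mean g m.
Proof. intros H. replace g with f; auto. apply functional_extensionality; auto. Qed.

Lemma is_mean_plus f g a b : Ccont f -> Ccont g -> is_mean f a -> is_mean g b -> is_mean (fun x => f x + g x)%C (a + b)%C.
Proof.
  intros Cf Cg Hf Hg eps He. destruct (Hf (eps / 2) ltac:(lra)) as [S1 [HS1 H1]].
  destruct (Hg (eps / 2) ltac:(lra)) as [S2 [HS2 H2]].
  exists (Rmax S1 S2). pose proof (Rmax_l S1 S2). pose proof (Rmax_r S1 S2). split. lra.
  intros S HS c. specialize (H1 S ltac:(lra) c). specialize (H2 S ltac:(lra) c). unfold window_mean in *. rewrite Cint_plus by auto.
  match goal with |- Cmod (?k * (?A + ?B) - _) <= _ => replace (k * (A + B) - (a + b))%C with ((k * A - a) + (k * B - b))%C by ring end.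
  eapply Rle_trans. apply Cmod_triangle. lra.
Qed.

Lemma is_mean_mult c f a : Ccont f -> is_mean f a -> is_mean (fun x => c * f x)%C (c * a)%C.
Proof.
  intros Cf Hf eps He. pose proof (Cmod_ge_0 c).
  destruct (Hf (eps / (Cmod c + 1))) as [S1 [HS1 H1]]. apply Rdiv_lt_0_compat; lra.
  exists S1. split; auto. intros S HS b. specialize (H1 S HS b). unfold window_mean in *. rewrite Cint_mult by auto.
  replace (RtoC (/ S) * (c * Cint f b (b + S)%R) - c * a)%C with (c * (RtoC (/ S) * Cint f b (b + S)%R - a))%C by ring.
  rewrite Cmod_mult. apply Rle_trans with (Cmod c * (eps / (Cmod c + 1))). apply Rmult_le_compat_l; auto.
  apply Rle_trans with ((Cmod c + 1) * (eps / (Cmod c + 1))).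
  apply Rmult_le_compat_r; [|lra]. left. apply Rdiv_lt_0_compat; lra. right. field. lra.
Qed.

Lemma is_mean_conj f a : Ccont f -> is_mean f a -> is_mean (fun x => Cconj (f x))%C (Cconj a)%C.
Proof.
  intros Cf Hf eps He. destruct (Hf eps He) as [S1 [HS1 H1]]. exists S1. split; auto. intros S HS b.
  specialize (H1 S HS b). unfold window_mean in *. rewrite Cint_conj by auto. rewrite <- Cmod_conj in H1.
  match goal with H : Cmod ?A <= _ |- Cmod ?B <= _ => replace B with A; auto end.
  destruct (Cint f b (b + S)), a. unfold Cconj, Cminus, Cplus, Copp, Cmult, RtoC; simpl. f_equal; ring.
Qed.

Lemma is_mean_const c : is_mean (fun _ => c) c.
Proof.
  intros eps He. exists 1. split. lra. intros S HS b. unfold window_mean. rewrite Cint_const.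
  replace (b + S - b) with S by ring. rewrite Cmult_assoc, <- RtoC_mult, Rinv_l by lra.
  replace (1 * c - c)%C with (RtoC 0) by ring. rewrite Cmod_0. lra.
Qed.

Lemma is_mean_expi al : al <> 0 -> is_mean (fun x => expi (al * x)) (RtoC 0).
Proof.
  intros Hal eps He. pose proof (Rabs_pos_lt al Hal).
  assert (0 < 2 / Rabs al / eps). { repeat apply Rdiv_lt_0_compat; lra. }
  exists (2 / Rabs al / eps). split; auto. intros S HS b.
  unfold window_mean. replace (RtoC (/ S) * Cint (fun x => expi (al * x)%R) b (b + S)%R - 0)%C with (RtoC (/ S) * Cint (fun x => expi (al * x)%R) b (b + S)%R)%C by ring.
  rewrite Cmod_mult, Cmod_R, Rabs_pos_eq by (left; apply Rinv_0_lt_compat; lra).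
  apply Rmult_le_reg_l with S. lra. rewrite <- Rmult_assoc, Rinv_r, Rmult_1_l by lra.
  eapply Rle_trans. apply Cint_expi_bound; auto.
  apply Rmult_le_compat_r with (r := eps) in HS; [|lra].
  replace (2 / Rabs al / eps * eps) with (2 / Rabs al) in HS by (field; lra). auto.
Qed.

Lemma is_mean_shift f a c : Ccont f -> is_mean f a -> is_mean (fun x => f (x + c)) a.
Proof.
  intros Cf Hf eps He. destruct (Hf eps He) as [S1 [HS1 H1]]. exists S1. split; auto. intros S HS b.
  specialize (H1 S HS (b + c)). unfold window_mean in *. rewrite Cint_shift by auto.
  replace (b + S + c) with (b + c + S) by ring. auto.
Qed.

Lemma is_mean_Re_ge0 f a : Ccont f -> is_mean f a -> (forall x, 0 <= Re (f x)) -> 0 <= Re a.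
Proof.
  intros Cf Hf H. apply Rnot_lt_le. intros Hn. destruct (Hf (- Re a / 2) ltac:(lra)) as [S0 [HS0 HH]].
  specialize (HH S0 ltac:(lra) 0). pose proof (Re_le_Cmod (window_mean f 0 S0 - a)) as P.
  assert (Q : 0 <= Re (window_mean f 0 S0)).
  { unfold window_mean. rewrite re_scal_l. apply Rmult_le_pos. left; apply Rinv_0_lt_compat; auto. apply Cint_Re_ge0; auto. lra. }
  change (Re (window_mean f 0 S0 - a)) with (Re (window_mean f 0 S0) - Re a) in P. lra.
Qed.

Lemma is_mean_bound f a B : Ccont f -> is_mean f a -> (forall x, Cmod (f x) <= B) -> Cmod a <= B.
Proof.
  intros Cf Hf H. apply Rnot_lt_le. intros Hn. destruct (Hf ((Cmod a - B) / 2) ltac:(lra)) as [S0 [HS0 HH]].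
  specialize (HH S0 ltac:(lra) 0).
  assert (Q : Cmod (window_mean f 0 S0) <= B).
  { unfold window_mean. rewrite Cmod_mult, Cmod_R, Rabs_pos_eq by (left; apply Rinv_0_lt_compat; lra).
    apply Rmult_le_reg_l with S0; auto. rewrite <- Rmult_assoc, Rinv_r, Rmult_1_l by lra.
    eapply Rle_trans. apply (Cint_bound f 0 (0 + S0) B); auto. lra. right; ring. }
  pose proof (Cmod_le_add a (window_mean f 0 S0)). rewrite Cmod_minus_sym in H0. lra.
Qed.

(** * Plancherel on a finite cyclic group *)

(** The [2 * K] equally spaced angles starting at [- PI], a copy of the dual of a cyclic group of
    order [2 * K]. The doubling leaves room for shifting a sequence of length [K] by up to [K]
    places without wrapping around. *)
Definition gridpt (K k : nat) : R := PI * (INR k - INR K) / INR K.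

Definition grid_mean (K : nat) (h : R -> C) : C := (RtoC (/ INR (2 * K)) * csum (2 * K) (fun k => h (gridpt K k)))%C.

Definition grid_meanR (K : nat) (h : R -> R) : R := / INR (2 * K) * rsum (2 * K) (fun k => h (gridpt K k)).

Lemma gridpt_bound K k : (k < 2 * K)%nat -> Rabs (gridpt K k) <= PI.
Proof.
  intros H. assert (HK : 0 < INR K) by (apply lt_0_INR; lia).
  assert (H1 : INR k <= 2 * INR K). { replace 2 with (INR 2) by (simpl; ring). rewrite <- mult_INR. apply le_INR. lia. }
  pose proof (pos_INR k). pose proof PI_RGT_0.
  unfold gridpt, Rdiv. rewrite !Rabs_mult, (Rabs_pos_eq PI), (Rabs_pos_eq (/ INR K)) by (try (left; apply Rinv_0_lt_compat); lra).
  assert (Rabs (INR k - INR K) <= INR K) by (apply Rabs_le; lra).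
  rewrite Rmult_assoc. rewrite <- (Rmult_1_r PI) at 2. apply Rmult_le_compat_l. lra.
  replace 1 with (INR K * / INR K) by (field; lra). apply Rmult_le_compat_r; auto.
  left; apply Rinv_0_lt_compat; auto.
Qed.

Lemma expi_INR_mult (x : R) (n : nat) : expi (x * INR n) = (expi x ^ n)%C.
Proof.
  induction n. simpl. rewrite Rmult_0_r. apply expi_0.
  rewrite S_INR. replace (x * (INR n + 1)) with (x + x * INR n) by ring.
  rewrite expi_plus, IHn. simpl. ring.
Qed.

Lemma expi_neq_1 x : 0 < x < 2 * PI -> expi x <> RtoC 1.
Proof.
  intros Hx E. assert (Hc : cos x = 1) by (apply (f_equal fst) in E; exact E).
  replace x with (2 * (x / 2)) in Hc by field. rewrite cos_2a_sin in Hc.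
  assert (0 < sin (x / 2)) by (apply sin_gt_0; lra). nra.
Qed.

Lemma expi_2PI_nat n : expi (2 * PI * INR n) = RtoC 1.
Proof.
  rewrite expi_INR_mult. replace (expi (2 * PI)) with (RtoC 1).
  apply Cpow_1_l. unfold expi. rewrite cos_2PI, sin_2PI. reflexivity.
Qed.

Lemma csum_geom (z : C) n : ((z - 1) * csum n (fun k => z ^ k) = z ^ n - 1)%C.
Proof. induction n; simpl. ring. rewrite Cmult_plus_distr_l, IHn. ring. Qed.

(** The sum is geometric, and its ratio is a root of unity different from 1; the constant factor
    appears because the grid starts at [- PI] and not at 0. *)
Lemma grid_mean_pos_freq K m : (0 < m < 2 * K)%nat -> grid_mean K (fun th => expi (th * INR m)) = RtoC 0.
Proof.
  intros Hm. assert (HK : 0 < INR K) by (apply lt_0_INR; lia).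
  unfold grid_mean.
  set (z := expi (PI * INR m / INR K)).
  rewrite (csum_ext _ _ (fun k => expi (- (PI * INR m)) * z ^ k)%C).
  2:{ intros k _. unfold z. rewrite <- expi_INR_mult, <- expi_plus. f_equal. unfold gridpt. field. lra. }
  rewrite (csum_mult _ _ (fun k => z ^ k)%C).
  assert (Hz : (z - 1)%C <> RtoC 0).
  { apply Cminus_eq_contra. apply expi_neq_1. pose proof PI_RGT_0.
    assert (0 < INR m) by (apply lt_0_INR; lia).
    assert (INR m < 2 * INR K). { replace 2 with (INR 2) by (simpl; ring). rewrite <- mult_INR. apply lt_INR. lia. }
    split. apply Rdiv_lt_0_compat; auto. apply Rmult_lt_0_compat; auto.
    apply Rmult_lt_reg_r with (INR K); auto. replace (PI * INR m / INR K * INR K) with (PI * INR m) by (field; lra). nra. }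
  assert (E : csum (2 * K) (fun k => z ^ k)%C = RtoC 0).
  { assert (E : ((z - 1) * csum (2 * K) (fun k => z ^ k) = 0)%C).
    { rewrite csum_geom. unfold z. rewrite <- expi_INR_mult.
      replace (PI * INR m / INR K * INR (2 * K)) with (2 * PI * INR m).
      rewrite expi_2PI_nat. ring. rewrite mult_INR. simpl. field. lra. }
    destruct (classic (csum (2 * K) (fun k => z ^ k)%C = RtoC 0)) as [h|h]; auto.
    exfalso. apply (Cmult_neq_0 _ _ Hz h). auto. }
  rewrite E. ring.
Qed.

Lemma grid_mean_orth K a b : (a < 2 * K)%nat -> (b < 2 * K)%nat ->
  grid_mean K (fun th => expi (th * INR a) * expi (- (th * INR b)))%C = if Nat.eqb a b then RtoC 1 else RtoC 0.
Proof.
  intros Ha Hb. destruct (Nat.eqb_spec a b) as [->|Hn].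
  - unfold grid_mean. rewrite (csum_ext _ _ (fun _ => RtoC 1 * RtoC 1)%C).
    2:{ intros. rewrite expi_opp_r. ring. }
    rewrite csum_mult. assert (P : forall n, csum n (fun _ => RtoC 1) = RtoC (INR n)).
    { induction n. auto. rewrite S_INR. simpl. rewrite IHn, RtoC_plus. auto. }
    rewrite P. rewrite Cmult_1_l, <- RtoC_mult, Rinv_l. auto. apply not_0_INR. lia.
  - destruct (Nat.lt_ge_cases b a) as [h|h].
    + rewrite <- (grid_mean_pos_freq K (a - b)) by lia. unfold grid_mean. f_equal. apply csum_ext. intros k _.
      rewrite <- expi_plus. f_equal. rewrite minus_INR by lia. ring.
    + replace (RtoC 0) with (Cconj (grid_mean K (fun th => expi (th * INR (b - a))))).
      2:{ rewrite grid_mean_pos_freq by lia. unfold Cconj, RtoC; simpl. f_equal; ring. }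
      unfold grid_mean. rewrite <- (csum_ext _ (fun k => Cconj (expi (gridpt K k * INR (b - a))))).
      * rewrite csum_conj. destruct (csum (2 * K) (fun k => expi (gridpt K k * INR (b - a)))).
        unfold Cconj, Cmult, RtoC; simpl. f_equal; ring.
      * intros k _. rewrite <- expi_opp, <- expi_plus. f_equal. rewrite minus_INR by lia. ring.
Qed.

Lemma grid_mean_ext K f g : (forall th, f th = g th) -> grid_mean K f = grid_mean K g.
Proof. intros H. unfold grid_mean. f_equal. apply csum_ext. auto. Qed.

Lemma grid_mean_csum K n (f : nat -> R -> C) : grid_mean K (fun th => csum n (fun i => f i th)) = csum n (fun i => grid_mean K (f i)).
Proof. unfold grid_mean. rewrite csum_swap, csum_mult. reflexivity. Qed.

Lemma grid_mean_mult K c f : grid_mean K (fun th => c * f th)%C = (c * grid_mean K f)%C.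
Proof. unfold grid_mean. rewrite csum_mult. ring. Qed.

Lemma csum_prod n m (u v : nat -> C) :
  (csum n u * csum m v)%C = csum n (fun i => csum m (fun j => u i * v j))%C.
Proof.
  rewrite Cmult_comm, <- csum_mult. apply csum_ext. intros i _. rewrite Cmult_comm, <- csum_mult. auto.
Qed.

(** The index map [phi] is there for shifts: with [phi l = s + l] the right side is the correlation
    of two sequences at shift [s], and an index shifted beyond [m] meets no partner and contributes
    0. *)
Lemma Plancherel_bilinear K n m (u v : nat -> C) (phi : nat -> nat) :
  (forall i, (i < n)%nat -> (phi i < 2 * K)%nat) -> (m <= 2 * K)%nat ->
  grid_mean K (fun th => csum n (fun i => u i * expi (th * INR (phi i))) * csum m (fun j => v j * expi (- (th * INR j))))%C
  = csum n (fun i => u i * (if Nat.ltb (phi i) m then v (phi i) else RtoC 0))%C.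
Proof.
  intros H1 H2.
  rewrite (grid_mean_ext _ _ (fun th => csum n (fun i => csum m (fun j => (u i * v j) * (expi (th * INR (phi i)) * expi (- (th * INR j))))))%C).
  2:{ intros th. rewrite csum_prod. apply csum_ext. intros i _. apply csum_ext. intros j _. ring. }
  rewrite grid_mean_csum. apply csum_ext. intros i Hi. rewrite grid_mean_csum.
  rewrite (csum_ext _ _ (fun j => if Nat.eqb j (phi i) then (u i * v (phi i))%C else RtoC 0)).
  - destruct (Nat.ltb_spec (phi i) m). apply csum_single; auto.
    rewrite (csum_ext _ _ (fun _ => RtoC 0)). rewrite csum_zero. ring.
    intros j Hj. destruct (Nat.eqb_spec j (phi i)); auto. lia.
  - intros j Hj. rewrite grid_mean_mult, grid_mean_orth by (auto; lia). rewrite Nat.eqb_sym.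
    destruct (Nat.eqb_spec j (phi i)). subst. ring. ring.
Qed.

Lemma Re_grid_mean K (h : R -> C) : Re (grid_mean K h) = grid_meanR K (fun th => Re (h th)).
Proof. unfold grid_mean, grid_meanR. rewrite re_scal_l, Re_csum. auto. Qed.

Lemma grid_meanR_le K (f g : R -> R) : (0 < K)%nat -> (forall th, Rabs th <= PI -> f th <= g th) -> grid_meanR K f <= grid_meanR K g.
Proof.
  intros HK H. unfold grid_meanR. apply Rmult_le_compat_l.
  - left. apply Rinv_0_lt_compat. apply lt_0_INR. lia.
  - apply rsum_le. intros i Hi. apply H. apply gridpt_bound; auto.
Qed.

Lemma grid_meanR_comb K a b (f g : R -> R) : grid_meanR K (fun th => a * f th + b * g th) = a * grid_meanR K f + b * grid_meanR K g.
Proof. unfold grid_meanR. rewrite rsum_plus, !rsum_mult. ring. Qed.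

Lemma csum_ext_conj_expi n (u : nat -> C) th :
  Cconj (csum n (fun i => u i * expi (- (th * INR i)))%C) = csum n (fun i => Cconj (u i) * expi (th * INR i))%C.
Proof.
  rewrite <- csum_conj. apply csum_ext. intros i _. rewrite expi_opp.
  destruct (u i), (expi (th * INR i)). unfold Cconj, Cmult; simpl. f_equal; ring.
Qed.

Lemma Plancherel_norm K n (u : nat -> C) : (n <= 2 * K)%nat ->
  grid_meanR K (fun th => Cmod (csum n (fun i => u i * expi (- (th * INR i)))%C) ^ 2) = rsum n (fun i => Cmod (u i) ^ 2).
Proof.
  intros Hn.
  transitivity (Re (grid_mean K (fun th => csum n (fun i => Cconj (u i) * expi (th * INR i)) * csum n (fun j => u j * expi (- (th * INR j)))))%C).
  - rewrite Re_grid_mean. unfold grid_meanR. f_equal. apply rsum_ext. intros k _.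
    rewrite Cmod2_Re, csum_ext_conj_expi, Cmult_comm. reflexivity.
  - rewrite (Plancherel_bilinear K n n (fun i => Cconj (u i)) u (fun i => i)); auto; [|intros; lia].
    rewrite Re_csum. apply rsum_ext. intros i Hi. destruct (Nat.ltb_spec i n); [|lia].
    rewrite Cmod2_Re, Cmult_comm. reflexivity.
Qed.

(** * Uniqueness of the Fourier series *)

(** Means over cells are used in place of point samples so that an exponential sum differs from the
    corresponding integral of [f] only by the variation of the phase over one cell, see
    [wsum_low]. *)
Definition cell_mean (f : R -> C) (Q j : nat) : C := (RtoC (INR Q) * Cint f (INR j / INR Q) ((INR j + 1) / INR Q))%C.

Section Sampling.
Variables (f : R -> C) (B : R) (Q : nat).
Hypothesis Hf : AP f.
Hypothesis HfB : forall x, Cmod (f x) <= B.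
Hypothesis HQ : (0 < Q)%nat.

Let b := cell_mean f Q.
Let HQR : 0 < INR Q := lt_0_INR Q HQ.

Lemma bmean_cell (h : R -> C) j M : Ccont h -> (forall x, INR j / INR Q <= x <= (INR j + 1) / INR Q -> Cmod (h x) <= M) ->
  Cmod (RtoC (INR Q) * Cint h (INR j / INR Q) ((INR j + 1) / INR Q))%C <= M.
Proof.
  intros Hc H. rewrite Cmod_mult, Cmod_R, Rabs_pos_eq by lra.
  apply Rle_trans with (INR Q * (((INR j + 1) / INR Q - INR j / INR Q) * M)).
  apply Rmult_le_compat_l. lra. apply Cint_bound; auto.
  apply Rmult_le_compat_r. left; apply Rinv_0_lt_compat; auto. lra.
  right. field. lra.
Qed.

Lemma bmean_bound j : Cmod (b j) <= B.
Proof. apply bmean_cell; auto. apply Hf. Qed.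

Lemma bmean_shift j s e : period f e (INR s / INR Q) -> Cmod (b (j + s)%nat - b j) <= e.
Proof.
  intros Hp. unfold b, cell_mean. rewrite plus_INR.
  replace ((INR j + INR s) / INR Q) with (INR j / INR Q + INR s / INR Q) by (field; lra).
  replace ((INR j + INR s + 1) / INR Q) with ((INR j + 1) / INR Q + INR s / INR Q) by (field; lra).
  rewrite <- Cint_shift by apply Hf.
  assert (Ccont (fun x => f (x + INR s / INR Q))) by (apply Ccont_shift; apply Hf).
  assert (Ccont (fun x => RtoC (-1) * f x)%C) by (apply (Ccont_mult (fun _ => RtoC (-1))); [apply Ccont_const | apply Hf]).
  match goal with |- Cmod (?k * ?X - ?k * ?Y) <= _ => replace (k * X - k * Y)%C with (k * (X + RtoC (-1) * Y))%C by ring end.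
  rewrite <- Cint_mult, <- Cint_plus by (auto; apply Hf).
  apply bmean_cell. apply Ccont_plus; auto.
  intros x _. replace (f (x + INR s / INR Q)%R + RtoC (-1) * f x)%C with (f (x + INR s / INR Q)%R - f x)%C by ring. apply Hp.
Qed.

Lemma bmean_0_near e : (forall x y, Rabs (x - y) <= / INR Q -> Cmod (f x - f y) <= e) -> Cmod (b 0%nat - f 0) <= e.
Proof.
  intros H. unfold b, cell_mean.
  assert (E : f 0 = (RtoC (INR Q) * Cint (fun _ => f 0) (INR 0 / INR Q) ((INR 0 + 1) / INR Q))%C).
  { rewrite Cint_const, Cmult_assoc, <- RtoC_mult. replace (INR Q * _) with 1. ring. simpl. field. lra. }
  rewrite E.
  match goal with |- Cmod (?k * ?X - ?k * ?Y) <= _ => replace (k * X - k * Y)%C with (k * (X + RtoC (-1) * Y))%C by ring end.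
  rewrite <- Cint_mult, <- Cint_plus; try apply Hf; try apply Ccont_const.
  apply bmean_cell. apply Ccont_plus. apply Hf. apply Ccont_const.
  simpl. intros x Hx. replace (f x + RtoC (-1) * f 0)%C with (f x - f 0)%C by ring. apply H.
  replace (0 / INR Q) with 0 in Hx by (field; lra). replace ((0 + 1) / INR Q) with (/ INR Q) in Hx by (field; lra).
  rewrite Rminus_0_r, Rabs_pos_eq; lra.
Qed.

(** A window of the exponential sum, with phases relative to its first index [c]. *)
Definition wsum (c M : nat) (th : R) : C := csum M (fun j => b (c + j)%nat * expi (- (th * INR j)))%C.

Lemma wsum_split c M1 M2 th : wsum c (M1 + M2) th = (wsum c M1 th + expi (- (th * INR M1)) * wsum (c + M1) M2 th)%C.
Proof.
  unfold wsum. rewrite csum_add. f_equal. rewrite <- csum_mult. apply csum_ext. intros i _.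
  rewrite plus_INR. replace (- (th * (INR M1 + INR i))) with (- (th * INR M1) + - (th * INR i)) by ring.
  rewrite expi_plus, Nat.add_assoc. ring.
Qed.

Lemma wsum_bound c M th : Cmod (wsum c M th) <= INR M * B.
Proof. apply Cmod_csum_le. intros i _. rewrite Cmod_mult, Cmod_expi, Rmult_1_r. apply bmean_bound. Qed.

Lemma wsum_shift c s M th e : period f e (INR s / INR Q) -> Cmod (wsum (c + s) M th - wsum c M th) <= INR M * e.
Proof.
  intros Hp. replace (wsum (c + s) M th - wsum c M th)%C with
    (csum M (fun j => (b (c + j + s)%nat - b (c + j)%nat) * expi (- (th * INR j))))%C.
  - apply Cmod_csum_le. intros i _. rewrite Cmod_mult, Cmod_expi, Rmult_1_r. apply bmean_shift; auto.
  - unfold wsum. replace (csum M (fun j => b (c + j)%nat * expi (- (th * INR j)))%C) with (RtoC (-1) * (csum M (fun j => RtoC (-1) * (b (c + j)%nat * expi (- (th * INR j))))))%C.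
    2:{ rewrite csum_mult. ring. }
    match goal with |- _ = (?X - RtoC (-1) * ?Y)%C => replace (X - RtoC (-1) * Y)%C with (X + Y)%C by ring end.
    rewrite <- csum_plus. apply csum_ext. intros i _. replace (c + s + i)%nat with (c + i + s)%nat by lia. ring.
Qed.

(** The stretch from [c] to [s + M] is split in two ways, after [s - c] and after [M] terms. Hence
    the windows at [c] and [s] differ, up to a factor of modulus 1, by two pieces of [s - c] terms;
    the almost period then leads from [s] back to 0. *)
Lemma wsum_compare c s M th e : (c <= s)%nat -> period f e (INR s / INR Q) ->
  Cmod (wsum c M th) <= Cmod (wsum 0 M th) + INR M * e + 2 * INR (s - c) * B.
Proof.
  intros Hcs Hp.
  pose proof (wsum_split c (s - c) M th) as E1. pose proof (wsum_split c M (s - c) th) as E2.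
  rewrite Nat.add_comm in E2. rewrite E1 in E2. replace (c + (s - c))%nat with s in E2 by lia.
  assert (E : wsum c M th = (wsum c (s - c) th + (expi (- (th * INR (s - c))) * wsum s M th + (- (expi (- (th * INR M)) * wsum (c + M) (s - c) th))))%C).
  { transitivity (wsum c M th + expi (- (th * INR M)) * wsum (c + M) (s - c) th - expi (- (th * INR M)) * wsum (c + M) (s - c) th)%C. ring.
    rewrite <- E2. ring. }
  rewrite E. eapply Rle_trans. apply Cmod_triangle. eapply Rle_trans. apply Rplus_le_compat_l, Cmod_triangle.
  rewrite Cmod_opp, !Cmod_mult, !Cmod_expi, !Rmult_1_l.
  pose proof (wsum_bound c (s - c) th). pose proof (wsum_bound (c + M) (s - c) th).
  pose proof (wsum_shift 0 s M th e Hp) as H1. rewrite Nat.add_0_l in H1.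
  pose proof (Cmod_le_add (wsum s M th) (wsum 0 M th)). lra.
Qed.

(** Shifting the summation by an almost period of [m] places multiplies the sum by [z] up to errors,
    while [1 - z] has modulus at least 1. So the sum is controlled by [m] terms at either end and
    the error of the almost period. *)
Lemma wsum_high m M th e : (m <= M)%nat -> period f e (INR m / INR Q) -> PI / 2 <= Rabs (th * INR m) <= PI ->
  0 <= e -> Cmod (wsum 0 M th) <= 2 * INR m * B + INR M * e.
Proof.
  intros HmM Hp Hth He. set (M' := (M - m)%nat). assert (EM : M = (m + M')%nat) by (unfold M'; lia).
  pose proof (wsum_split 0 m M' th) as E1. pose proof (wsum_split 0 M' m th) as E2.
  rewrite (Nat.add_comm M' m), <- EM in E2. rewrite <- EM in E1. rewrite !Nat.add_0_l in *.
  pose proof (wsum_shift 0 m M' th e Hp) as H1. rewrite Nat.add_0_l in H1.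
  set (z := expi (- (th * INR m))) in *.
  assert (E : ((1 - z) * wsum 0 M th)%C = (wsum 0 m th + (z * (wsum m M' th - wsum 0 M' th) + (- (z * (expi (- (th * INR M')) * wsum M' m th)))))%C).
  { replace ((1 - z) * wsum 0 M th)%C with (wsum 0 M th - z * wsum 0 M th)%C by ring. rewrite E1 at 1. rewrite E2. ring. }
  assert (Hz : 1 <= Cmod (1 - z)).
  { apply Cmod_expi_far. rewrite Rabs_Ropp. auto. }
  apply Rle_trans with (Cmod ((1 - z) * wsum 0 M th)).
  { rewrite Cmod_mult. pose proof (Cmod_ge_0 (wsum 0 M th)). nra. }
  rewrite E. eapply Rle_trans. apply Cmod_triangle. eapply Rle_trans. apply Rplus_le_compat_l, Cmod_triangle.
  assert (Hz1 : Cmod z = 1) by apply Cmod_expi.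
  rewrite Cmod_opp, !Cmod_mult, Hz1, Cmod_expi, !Rmult_1_l.
  pose proof (wsum_bound 0 m th). pose proof (wsum_bound M' m th).
  assert (INR M' * e <= INR M * e). { apply Rmult_le_compat_r; auto. apply le_INR. unfold M'; lia. }
  lra.
Qed.

Lemma Cint_cells (h : R -> C) M : Ccont h ->
  Cint h 0 (INR M / INR Q) = csum M (fun j => Cint h (INR j / INR Q) ((INR j + 1) / INR Q)).
Proof.
  intros Hc. induction M.
  - simpl. replace (0 / INR Q) with 0 by (field; lra). apply Cint_unique, (is_RInt_point (V := CV)).
  - rewrite S_INR. simpl. rewrite <- IHM. symmetry. apply Cint_Chasles; auto.
Qed.

(** Within a cell the phase [th * INR Q * x] exceeds its value at the left end by at most [Rabs th]
    in modulus, and the integral of [f] over the cell is kept exactly. *)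
Lemma wsum_low M th : Cmod (wsum 0 M th - RtoC (INR Q) * Cint (fun x => f x * expi (- (th * INR Q * x)))%C 0 (INR M / INR Q))
   <= INR M * (B * Rabs th).
Proof.
  assert (Hc : Ccont (fun x => f x * expi (- (th * INR Q * x)))%C).
  { apply Ccont_mult. apply Hf. apply Ccont_expi_opp. }
  rewrite Cint_cells by auto. rewrite <- csum_mult.
  replace (wsum 0 M th - csum M (fun j => RtoC (INR Q) * Cint (fun x => f x * expi (- (th * INR Q * x))) (INR j / INR Q) ((INR j + 1) / INR Q)))%C with
   (csum M (fun j => RtoC (INR Q) * Cint (fun x => expi (- (th * INR j)) * f x + RtoC (-1) * (f x * expi (- (th * INR Q * x)))) (INR j / INR Q)%R ((INR j + 1) / INR Q)%R))%C.
  - apply Cmod_csum_le. intros j _. apply bmean_cell.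
    + apply Ccont_plus; apply (Ccont_mult (fun _ => _)); auto; try apply Ccont_const; apply Hf.
    + intros x Hx. replace (expi (- (th * INR j)) * f x + RtoC (-1) * (f x * expi (- (th * INR Q * x))))%C with
       (f x * (expi (- (th * INR j)) - expi (- (th * INR Q * x))))%C by ring.
      rewrite Cmod_mult. apply Rmult_le_compat; auto; try apply Cmod_ge_0.
      eapply Rle_trans. apply Cmod_expi_minus.
      replace (- (th * INR j) - - (th * INR Q * x)) with (th * (INR Q * x - INR j)) by ring.
      rewrite Rabs_mult. rewrite <- (Rmult_1_r (Rabs th)) at 2. apply Rmult_le_compat_l. apply Rabs_pos.
      destruct Hx as [H1 H2]. apply Rmult_le_compat_l with (r := INR Q) in H1; [|lra]. apply Rmult_le_compat_l with (r := INR Q) in H2; [|lra].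
      replace (INR Q * (INR j / INR Q)) with (INR j) in H1 by (field; lra).
      replace (INR Q * ((INR j + 1) / INR Q)) with (INR j + 1) in H2 by (field; lra).
      apply Rabs_le; lra.
  - unfold wsum, b, cell_mean.
    match goal with |- _ = (?X - ?Y)%C => replace (X - Y)%C with (X + RtoC (-1) * Y)%C by ring end.
    rewrite <- csum_mult, <- csum_plus. apply csum_ext. intros j _. rewrite Nat.add_0_l.
    rewrite Cint_plus, !Cint_mult; auto; try apply Hf. ring.
    apply (Ccont_mult (fun _ => _)). apply Ccont_const. apply Hf.
    apply (Ccont_mult (fun _ => _)). apply Ccont_const. auto.
Qed.

Lemma wsum_windows M X th : (forall c, Cmod (wsum c M th) <= X) -> forall t c, Cmod (wsum c (t * M) th) <= INR t * X.
Proof.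
  intros H t. induction t; intros c.
  - simpl. unfold wsum; simpl. rewrite Cmod_0. lra.
  - replace (S t * M)%nat with (M + t * M)%nat by lia. rewrite wsum_split.
    eapply Rle_trans. apply Cmod_triangle. rewrite Cmod_mult, Cmod_expi, Rmult_1_l.
    rewrite S_INR. specialize (H c). specialize (IHt (c + M)%nat). lra.
Qed.

Lemma wsum_long M X th N : (0 < M)%nat -> 0 <= X -> (forall c, Cmod (wsum c M th) <= INR M * X) ->
  Cmod (wsum 0 N th) <= INR N * X + INR M * B.
Proof.
  intros HM HX H. pose proof (Nat.div_mod N M ltac:(lia)) as E. set (t := (N / M)%nat) in *. set (r := (N mod M)%nat) in *.
  assert (r < M)%nat by (apply Nat.mod_upper_bound; lia).
  replace N with (t * M + r)%nat at 1 by lia. rewrite wsum_split.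
  eapply Rle_trans. apply Cmod_triangle. rewrite Cmod_mult, Cmod_expi, Rmult_1_l.
  pose proof (wsum_windows M _ th H t 0%nat). pose proof (wsum_bound (0 + t * M) r th).
  assert (INR t * INR M <= INR N). { rewrite <- mult_INR. apply le_INR. lia. }
  assert (INR r <= INR M) by (apply le_INR; lia).
  pose proof (Rle_trans _ _ _ (Cmod_ge_0 (f 0)) (HfB 0)). nra.
Qed.

End Sampling.

Lemma nat_above (x : R) : exists n : nat, (0 < n)%nat /\ x <= INR n.
Proof.
  destruct (nfloor_ex (Rmax x 0)) as [n Hn]. apply Rmax_r. exists (S n). split. lia.
  rewrite S_INR. pose proof (Rmax_l x 0). lra.
Qed.

(** An almost period is rounded to the mesh of width [1 / (q * n)], and uniform continuity extends
    it to [n] consecutive mesh points, a stretch of length [1 / q]. Since [L] and [q] do not depend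
    on [n], the density of these points is at least [1 / (L * q + 1)] on every such mesh. *)
Lemma period_runs (f : R -> C) : AP f -> forall e, 0 < e -> exists L q : nat, (0 < q)%nat /\
  (forall x y, Rabs (x - y) <= / INR q -> Cmod (f x - f y) <= e) /\
  forall n, (0 < n)%nat -> forall c : nat, exists s, (c <= s <= c + L * (q * n))%nat /\
    forall r, (r < n)%nat -> period f e (INR (s + r) / INR (q * n)).
Proof.
  intros Hf e He. destruct (AP_unifcont f Hf (e / 3) ltac:(lra)) as [d [Hd Hu]].
  destruct Hf as [Hc H]. destruct (H (e / 3) ltac:(lra)) as [L0 [HL0 HH]].
  destruct (nat_above (L0 + 1)) as [L [HL HL']]. destruct (nat_above (/ d + 1)) as [q [Hq Hq']].
  assert (Hdp : 0 < / d) by (apply Rinv_0_lt_compat; auto).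
  assert (Hqd : / INR q < d). { rewrite <- (Rinv_inv d). apply Rinv_lt_contravar; [|lra]. apply Rmult_lt_0_compat; lra. }
  exists L, q. split; auto. split.
  { intros x y Hxy. specialize (Hu x y ltac:(lra)). lra. }
  intros n Hn c. set (Q := (q * n)%nat).
  assert (HqR : 0 < INR q) by (apply lt_0_INR; auto).
  assert (HnR : 1 <= INR n) by (replace 1 with (INR 1) by auto; apply le_INR; lia).
  assert (HQ1 : INR Q = INR q * INR n) by (unfold Q; apply mult_INR).
  assert (HQR : 0 < INR Q) by (rewrite HQ1; nra).
  destruct (HH (INR c / INR Q)) as [tau [Ht Hp]].
  assert (H0 : 0 <= INR c / INR Q). { apply Rdiv_le_0_compat; auto. apply pos_INR. }
  destruct (nfloor_ex (tau * INR Q)) as [k Hk]. { apply Rmult_le_pos; lra. }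
  assert (Hc1 : INR c <= tau * INR Q).
  { replace (INR c) with (INR c / INR Q * INR Q) by (field; lra). apply Rmult_le_compat_r; lra. }
  assert (Hc2 : tau * INR Q <= INR c + L0 * INR Q).
  { replace (INR c) with (INR c / INR Q * INR Q) by (field; lra). rewrite <- Rmult_plus_distr_r. apply Rmult_le_compat_r; lra. }
  assert (HQge : 1 <= INR Q). { replace 1 with (INR 1) by auto. apply le_INR. unfold Q. nia. }
  (* Rounding up keeps the index at or above [c]; the extra 1 in [nat_above (L0 + 1)] pays for
     it. *)
  exists (S k). split.
  - split. apply Nat.lt_le_incl. apply INR_lt. rewrite S_INR. lra.
    apply INR_le. rewrite S_INR, plus_INR, mult_INR. fold Q. nra.
  - intros r Hr x. set (y := x + INR (S k) / INR Q).
    assert (Hk2 : Rabs (INR (S k) / INR Q - tau) < d).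
    { apply Rle_lt_trans with (/ INR Q).
      - rewrite S_INR. replace ((INR k + 1) / INR Q - tau) with ((INR k + 1 - tau * INR Q) * / INR Q) by (field; lra).
        rewrite Rabs_mult, (Rabs_pos_eq (/ INR Q)) by (left; apply Rinv_0_lt_compat; auto).
        rewrite <- (Rmult_1_l (/ INR Q)) at 2. apply Rmult_le_compat_r. left; apply Rinv_0_lt_compat; auto. apply Rabs_le; lra.
      - apply Rle_lt_trans with (/ INR q); auto. apply Rinv_le_contravar; auto. rewrite HQ1. nra. }
    assert (Hr2 : Rabs (INR r / INR Q) < d).
    { assert (INR r <= INR n) by (apply le_INR; lia). pose proof (pos_INR r).
      rewrite Rabs_pos_eq by (apply Rdiv_le_0_compat; auto).
      apply Rle_lt_trans with (/ INR q); auto.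
      apply Rle_trans with (INR n / INR Q). apply Rmult_le_compat_r; auto. left; apply Rinv_0_lt_compat; auto.
      rewrite HQ1. right. field. lra. }
    rewrite plus_INR.
    replace (x + (INR (S k) + INR r) / INR Q) with (y + INR r / INR Q) by (unfold y; field; lra).
    pose proof (Hu (y + INR r / INR Q) y) as A1. replace (y + INR r / INR Q - y) with (INR r / INR Q) in A1 by ring. specialize (A1 Hr2).
    pose proof (Hu y (x + tau)) as A2. replace (y - (x + tau)) with (INR (S k) / INR Q - tau) in A2 by (unfold y; ring). specialize (A2 Hk2).
    specialize (Hp x).
    pose proof (Cmod_triangle3 (f (y + INR r / INR Q)) (f y) (f x)). pose proof (Cmod_triangle3 (f y) (f (x + tau)) (f x)). lra.
Qed.

(** Vanishing of the mean gives each frequency its own good length. That length still serves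
    neighbouring frequencies, so compactness bounds the lengths needed on [[- A, A]], although no
    single length is claimed to work for all of them. *)
Lemma low_freq_compact (f : R -> C) B : AP f -> 0 < B -> (forall x, Cmod (f x) <= B) ->
  (forall al, is_mean (fun x => f x * expi (- (al * x)))%C (RtoC 0)) ->
  forall A e R1, 0 < e -> exists Rmax, forall al, - A <= al <= A ->
   exists r : nat, (0 < r)%nat /\ R1 <= INR r <= Rmax /\ Cmod (Cint (fun x => f x * expi (- (al * x)))%C 0 (INR r)) <= 2 * (INR r * e).
Proof.
  intros Hf HB HfB H0 A e R1 He.
  assert (Hcc : forall al, Ccont (fun x => f x * expi (- (al * x)))%C).
  { intros al. apply Ccont_mult. apply Hf. apply Ccont_expi_opp. }
  assert (P : forall al, {r : nat | (0 < r)%nat /\ R1 <= INR r /\ Cmod (Cint (fun x => f x * expi (- (al * x)))%C 0 (INR r)) <= INR r * e}).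
  { intros al. apply constructive_indefinite_description. destruct (H0 al e He) as [S0 [HS0 HH]].
    destruct (nat_above (Rmax S0 R1)) as [r [Hr Hr']]. exists r. split; auto.
    pose proof (Rmax_l S0 R1). pose proof (Rmax_r S0 R1). split. lra.
    specialize (HH (INR r) ltac:(lra) 0). unfold window_mean in HH.
    assert (Hr2 : 0 < INR r) by (apply lt_0_INR; auto).
    rewrite Rplus_0_l in HH. unfold Cminus in HH. rewrite Copp_0, Cplus_0_r in HH.
    rewrite Cmod_mult, Cmod_R, Rabs_pos_eq in HH by (left; apply Rinv_0_lt_compat; lra).
    apply Rmult_le_compat_l with (r := INR r) in HH; [|lra].
    rewrite <- Rmult_assoc, Rinv_r, Rmult_1_l in HH by lra. auto. }
  assert (Hdel : forall al, 0 < e / (B * INR (proj1_sig (P al)))).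
  { intros al. destruct (P al) as [r [Hr Hr0]]; simpl. apply Rdiv_lt_0_compat; auto. apply Rmult_lt_0_compat; auto. apply lt_0_INR; auto. }
  destruct (compactness_value_1d (- A) A (fun al => mkposreal _ (Hdel al))) as [d Hd].
  (* The neighbourhood attached to the length [r] has radius [e / (B * r)]; the common lower bound
     [d] for the radii in use turns into an upper bound for [r]. *)
  exists (e / (B * d)). intros al Hal. specialize (Hd al Hal). apply NNPP in Hd.
  destruct Hd as [t [Ht [H1 H2]]]. simpl in *. destruct (P t) as [r [Hr [Hr1 Hr2]]]; simpl in *.
  pose proof (cond_pos d) as Hdp. assert (HrR : 0 < INR r) by (apply lt_0_INR; auto).
  assert (HBr : 0 < B * INR r) by (apply Rmult_lt_0_compat; auto).
  exists r. split; auto. split. split; auto.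
  - apply Rmult_le_reg_r with (B * d). apply Rmult_lt_0_compat; auto.
    replace (e / (B * d) * (B * d)) with e by (field; split; lra).
    apply Rmult_le_compat_r with (r := B * INR r) in H2; [|lra].
    replace (e / (B * INR r) * (B * INR r)) with e in H2 by (field; split; lra). lra.
  - pose proof (Cmod_le_add (Cint (fun x => f x * expi (- (al * x)))%C 0 (INR r)) (Cint (fun x => f x * expi (- (t * x)))%C 0 (INR r))) as Q1.
    assert (Q2 : Cmod (Cint (fun x => f x * expi (- (al * x)))%C 0 (INR r) - Cint (fun x => f x * expi (- (t * x)))%C 0 (INR r)) <= (INR r - 0) * e).
    { match goal with |- Cmod (?X - ?Y) <= _ => replace (X - Y)%C with (X + RtoC (-1) * Y)%C by ring end.
      rewrite <- Cint_mult, <- Cint_plus; auto.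
      2:{ apply (Ccont_mult (fun _ => _)); auto. apply Ccont_const. }
      apply Cint_bound. apply Ccont_plus; auto. apply (Ccont_mult (fun _ => _)); auto. apply Ccont_const. lra.
      intros x Hx. replace (f x * expi (- (al * x)) + RtoC (-1) * (f x * expi (- (t * x))))%C with (f x * (expi (- (al * x)) - expi (- (t * x))))%C by ring.
      rewrite Cmod_mult. apply Rle_trans with (B * (Rabs (al - t) * INR r)).
      - apply Rmult_le_compat; auto; try apply Cmod_ge_0. eapply Rle_trans. apply Cmod_expi_minus.
        replace (- (al * x) - - (t * x)) with ((al - t) * - x) by ring. rewrite Rabs_mult, Rabs_Ropp, (Rabs_pos_eq x) by lra.
        apply Rmult_le_compat_l. apply Rabs_pos. lra.
      - left. apply Rmult_lt_compat_r with (r := B * INR r) in H1; auto.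
        replace (e / (B * INR r) * (B * INR r)) with e in H1 by (field; split; lra). lra. }
    lra.
Qed.

(** A frequency bounded away from 0 is killed by uniform continuity (shift by about [PI / |th|]), a low one by
    compactness and the vanishing of the means; almost periods carry the estimate from the window at 0 to all windows. *)
Lemma uniform_decay (f : R -> C) B : AP f -> 0 < B -> (forall x, Cmod (f x) <= B) ->
  (forall al, is_mean (fun x => f x * expi (- (al * x)))%C (RtoC 0)) ->
  forall dl, 0 < dl -> exists q : nat, (0 < q)%nat /\ forall n, (0 < n)%nat -> exists N0 : nat,
    forall N, (N0 <= N)%nat -> forall th, Rabs th <= PI -> Cmod (wsum f (q * n) 0 N th) <= INR N * dl.
Proof.
  intros Hf HB HfB H0 dl Hdl. set (e := dl / 6). assert (He : 0 < e) by (unfold e; lra).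
  destruct (period_runs f Hf e He) as [L [q0 [Hq0 [Hmod Hrun]]]].
  assert (Hq0R : 1 <= INR q0) by (replace 1 with (INR 1) by auto; apply le_INR; lia).
  (* From [Rabs th >= A / INR Q] and [INR m * Rabs th <= PI <= 4] follows
     [INR m / INR Q <= / INR q0], so a shift by [m] cells is within the modulus of continuity
     [Hmod]. *)
  set (A := 4 * INR q0).
  (* A window at least this long loses at most the fraction [e] when its start is moved by up to [L]
     units of length. *)
  set (R1 := 2 * INR L * B / e).
  destruct (low_freq_compact f B Hf HB HfB H0 A e R1 He) as [Rmax HR].
  (* The mesh must be so fine that for [Rabs th < A / INR Q] the phase error [B * Rabs th] of
     [wsum_low] stays below [e]. *)
  destruct (nat_above (B * A / e)) as [k [Hk Hk']].
  exists (q0 * k)%nat. split. nia. intros n Hn.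
  set (Q := (q0 * k * n)%nat). assert (HQ : (0 < Q)%nat) by (unfold Q; nia).
  assert (HQR : 0 < INR Q) by (apply lt_0_INR; auto).
  assert (HknQ : (q0 * (k * n) = Q)%nat) by (unfold Q; lia).
  assert (Hkn : (0 < k * n)%nat) by nia.
  assert (HBA : B * A / INR Q <= e).
  { apply Rmult_le_reg_r with (INR Q); auto. replace (B * A / INR Q * INR Q) with (B * A) by (field; lra).
    apply Rle_trans with (e * INR k).
    - replace (B * A) with (e * (B * A / e)) by (field; lra). apply Rmult_le_compat_l; lra.
    - apply Rmult_le_compat_l. lra. apply le_INR. unfold Q. nia. }
  destruct (nat_above (Rmax * INR Q * B / e)) as [N1 [_ HN1]].
  destruct (nat_above (2 * INR Q * B / e)) as [N2 [_ HN2]].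
  exists (N1 + N2 + Q)%nat. intros N HN th Hth.
  assert (HNR : 0 <= INR N) by apply pos_INR.
  assert (HNN1 : Rmax * INR Q * B <= INR N * e).
  { replace (Rmax * INR Q * B) with (Rmax * INR Q * B / e * e) by (field; lra). apply Rmult_le_compat_r. lra.
    apply Rle_trans with (INR N1); auto. apply le_INR. lia. }
  assert (HNN2 : 2 * INR Q * B <= INR N * e).
  { replace (2 * INR Q * B) with (2 * INR Q * B / e * e) by (field; lra). apply Rmult_le_compat_r. lra.
    apply Rle_trans with (INR N2); auto. apply le_INR. lia. }
  destruct (Rle_lt_dec (A / INR Q) (Rabs th)) as [Hhi|Hlo].
  - assert (HA : 0 < A) by (unfold A; lra).
    assert (Hth0 : 0 < Rabs th). { apply Rlt_le_trans with (A / INR Q); auto. apply Rdiv_lt_0_compat; auto. }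
    pose proof PI_RGT_0. pose proof PI_4.
    (* The largest [m] with [INR m * Rabs th <= PI]. It is at least 1 because [Rabs th <= PI], and
       its product with [Rabs th] is at least [PI / 2], as [wsum_high] demands. *)
    destruct (nfloor_ex (PI / Rabs th)) as [m Hm]. apply Rdiv_le_0_compat; lra.
    assert (Hm1 : INR m * Rabs th <= PI).
    { apply Rle_trans with (PI / Rabs th * Rabs th). apply Rmult_le_compat_r; lra. right; field; lra. }
    assert (Hm2 : PI < INR m * Rabs th + Rabs th).
    { replace PI with (PI / Rabs th * Rabs th) by (field; lra). replace (INR m * Rabs th + Rabs th) with ((INR m + 1) * Rabs th) by ring.
      apply Rmult_lt_compat_r; lra. }
    assert (Hmge : (1 <= m)%nat).
    { destruct m; [|lia]. simpl in Hm2. lra. }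
    assert (HmR : 1 <= INR m) by (replace 1 with (INR 1) by auto; apply le_INR; auto).
    assert (HmQ : INR m * INR q0 <= INR Q).
    { assert (HmA : INR m * (A / INR Q) <= 4). { apply Rle_trans with (INR m * Rabs th); [|lra]. apply Rmult_le_compat_l; lra. }
      apply Rmult_le_compat_r with (r := INR Q) in HmA; [|lra].
      replace (INR m * (A / INR Q) * INR Q) with (4 * (INR m * INR q0)) in HmA by (unfold A; field; lra). lra. }
    assert (HmQ' : INR m <= INR Q) by nra.
    eapply Rle_trans. apply (wsum_high f B Q Hf HfB HQ m N th e).
    + apply INR_le in HmQ'. lia.
    + intros x. apply Hmod. replace (x + INR m / INR Q - x) with (INR m / INR Q) by ring.
      rewrite Rabs_pos_eq. 2: apply Rdiv_le_0_compat; lra.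
      apply Rmult_le_reg_r with (INR Q * INR q0). nra.
      replace (INR m / INR Q * (INR Q * INR q0)) with (INR m * INR q0) by (field; lra).
      replace (/ INR q0 * (INR Q * INR q0)) with (INR Q) by (field; lra). auto.
    + rewrite Rabs_mult, (Rabs_pos_eq (INR m)) by lra. split; [|lra].
      destruct (Rle_lt_dec (Rabs th) (PI / 2)). lra. nra.
    + lra.
    + assert (2 * INR m * B <= 2 * INR Q * B) by (apply Rmult_le_compat_r; lra). unfold e in *. nra.
  - set (al := th * INR Q).
    assert (Hal : - A <= al <= A).
    { apply Rabs_le_between. unfold al. rewrite Rabs_mult, (Rabs_pos_eq (INR Q)) by lra.
      apply Rmult_le_reg_r with (/ INR Q). apply Rinv_0_lt_compat; auto.
      replace (Rabs th * INR Q * / INR Q) with (Rabs th) by (field; lra). left. exact Hlo. }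
    destruct (HR al Hal) as [r [Hr [[Hr1 Hr2] Hr3]]].
    assert (HrR : 0 < INR r) by (apply lt_0_INR; auto).
    set (M := (r * Q)%nat). assert (HM : INR M = INR r * INR Q) by (unfold M; apply mult_INR).
    assert (HW0 : Cmod (wsum f Q 0 M th) <= INR M * (3 * e)).
    { pose proof (wsum_low f B Q Hf HfB HQ M th) as Hl.
      replace (INR M / INR Q) with (INR r) in Hl by (rewrite HM; field; lra).
      fold al in Hl.
      pose proof (Cmod_le_add (wsum f Q 0 M th) (INR Q * Cint (fun x => f x * expi (- (al * x))) 0 (INR r))%C) as P1.
      rewrite Cmod_mult, Cmod_R, Rabs_pos_eq in P1 by lra.
      assert (INR Q * Cmod (Cint (fun x : R => (f x * expi (- (al * x)))%C) 0 (INR r)) <= INR Q * (2 * (INR r * e))) by (apply Rmult_le_compat_l; lra).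
      assert (INR M * (B * Rabs th) <= INR M * e).
      { apply Rmult_le_compat_l. apply pos_INR. apply Rle_trans with (B * (A / INR Q)). apply Rmult_le_compat_l; lra.
        replace (B * (A / INR Q)) with (B * A / INR Q) by (unfold Rdiv; ring). auto. }
      rewrite HM in *. lra. }
    assert (HLB : 2 * INR L * B <= INR r * e).
    { replace (2 * INR L * B) with (R1 * e) by (unfold R1; field; lra). apply Rmult_le_compat_r; lra. }
    assert (HWc : forall c, Cmod (wsum f Q c M th) <= INR M * (5 * e)).
    { intros c. destruct (Hrun (k * n)%nat Hkn c) as [s [Hs Hs']]. specialize (Hs' 0%nat Hkn). rewrite HknQ, Nat.add_0_r in Hs'.
      rewrite HknQ in Hs.
      pose proof (wsum_compare f B Q Hf HfB HQ c s M th e ltac:(lia) Hs') as P1.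
      assert (INR (s - c) <= INR L * INR Q). { rewrite <- mult_INR. apply le_INR. lia. }
      assert (2 * INR (s - c) * B <= INR M * e).
      { rewrite HM. apply Rle_trans with (2 * (INR L * INR Q) * B). apply Rmult_le_compat_r; lra. nra. }
      lra. }
    eapply Rle_trans. apply (wsum_long f B Q Hf HfB HQ M (5 * e) th N); auto. unfold M; nia. lra.
    assert (INR M * B <= Rmax * INR Q * B). { rewrite HM. apply Rmult_le_compat_r. lra. apply Rmult_le_compat_r; lra. }
    unfold e in *. nra.
Qed.

Lemma rsum_ge0 n g : (forall i, 0 <= g i) -> 0 <= rsum n g.
Proof. intros H. induction n; simpl. lra. specialize (H n). lra. Qed.

(** Every block of [D + n] indices contains a complete run of [n] indices where [g] is 1. *)
Lemma run_count (g : nat -> R) (D n : nat) : (forall i, 0 <= g i) ->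
  (forall c, exists s, (c <= s <= c + D)%nat /\ forall r, (r < n)%nat -> g (s + r)%nat = 1) ->
  forall t, INR t * INR n <= rsum (t * (D + n)) g.
Proof.
  intros Hg H t. rewrite rsum_block. rewrite <- rsum_const. apply rsum_le. intros i _.
  destruct (H (i * (D + n))%nat) as [s [Hs Hr]]. set (s0 := (s - i * (D + n))%nat).
  replace (D + n)%nat with (s0 + (n + (D - s0)))%nat at 1 by lia.
  rewrite !rsum_add.
  rewrite (rsum_ext n _ (fun _ => 1)).
  - rewrite rsum_const.
    pose proof (rsum_ge0 s0 (fun j => g (i * (D + n) + j)%nat) ltac:(intros; apply Hg)).
    pose proof (rsum_ge0 (D - s0) (fun j => g (i * (D + n) + (s0 + (n + j)))%nat) ltac:(intros; apply Hg)). lra.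
  - intros r Hrn. replace (i * (D + n) + (s0 + r))%nat with (s + r)%nat by (unfold s0; lia). auto.
Qed.

Definition indicator (P : nat -> Prop) (i : nat) : R := if excluded_middle_informative (P i) then 1 else 0.

Lemma indicator_01 P i : 0 <= indicator P i <= 1.
Proof. unfold indicator. destruct excluded_middle_informative; lra. Qed.

Lemma tail_count N s : (rsum N (fun l => if Nat.ltb (s + l) N then 0 else 1) <= INR s).
Proof.
  destruct (Nat.le_gt_cases N s) as [h|h].
  - apply Rle_trans with (rsum N (fun _ => 1)). apply rsum_le. intros i _. destruct Nat.ltb; lra.
    rewrite rsum_const. apply le_INR in h. lra.
  - replace N with ((N - s) + s)%nat at 1 by lia. rewrite rsum_add.
    rewrite (rsum_ext (N - s) _ (fun _ => 0)).
    + rewrite rsum_const. assert (rsum s (fun i => if Nat.ltb (s + (N - s + i)) N then 0 else 1) <= rsum s (fun _ => 1)).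
      apply rsum_le. intros. destruct Nat.ltb; lra. rewrite rsum_const in H. lra.
    + intros i Hi. destruct (Nat.ltb_spec (s + i) N); auto. lia.
Qed.

(** At an almost period each product [Cconj (b l) * b (l + s)] differs from [Cmod (b l) ^ 2] by at
    most [B * e]; the at most [s] indices whose partner lies beyond [N] cost [B * B] each. *)
Lemma correlation_lower (b : nat -> C) B e N s : (forall j, Cmod (b j) <= B) -> 0 <= B ->
  (forall j, Cmod (b (j + s)%nat - b j) <= e) ->
  rsum N (fun l => Cmod (b l) ^ 2) - INR N * (B * e) - INR s * (B * B) <=
  Re (csum N (fun l => Cconj (b l) * (if Nat.ltb (s + l) N then b (s + l)%nat else RtoC 0)))%C.
Proof.
  intros HB HB0 He. rewrite Re_csum.
  apply Rle_trans with (rsum N (fun l => Cmod (b l) ^ 2 + (-1) * (B * e) + (-(B * B)) * (if Nat.ltb (s + l) N then 0 else 1))).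
  - rewrite rsum_plus, rsum_mult, rsum_plus, (rsum_const N (-1 * (B * e))). pose proof (tail_count N s). nra.
  - assert (He0 : 0 <= e) by (eapply Rle_trans; [apply Cmod_ge_0 | apply (He 0%nat)]).
    apply rsum_le. intros l _. pose proof (HB l) as Hl. pose proof (Cmod_ge_0 (b l)).
    destruct (Nat.ltb_spec (s + l) N).
    + replace (s + l)%nat with (l + s)%nat by lia. specialize (He l).
      replace (Cconj (b l) * b (l + s)%nat)%C with (b l * Cconj (b l) + Cconj (b l) * (b (l + s)%nat - b l))%C by ring.
      change (Re (b l * Cconj (b l) + Cconj (b l) * (b (l + s)%nat - b l))) with
        (Re (b l * Cconj (b l)) + Re (Cconj (b l) * (b (l + s)%nat - b l))).
      rewrite <- Cmod2_Re.
      pose proof (re_le_Cmod (Cconj (b l) * (b (l + s)%nat - b l))) as P.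
      rewrite Cmod_mult, Cmod_conj in P. apply Rabs_le_between in P.
      assert (Cmod (b l) * Cmod (b (l + s)%nat - b l) <= B * e) by (apply Rmult_le_compat; auto; apply Cmod_ge_0).
      lra.
    + rewrite Cmult_0_r. change (Re 0) with 0.
      assert (Cmod (b l) ^ 2 <= B * B). { simpl. rewrite Rmult_1_r. apply Rmult_le_compat; auto. }
      assert (0 <= B * e) by (apply Rmult_le_pos; lra). lra.
Qed.

(** By orthogonality the weighted sum of correlations is the grid mean of [E] times the squared
    modulus of [P], where [E] is the exponential sum of the weights. One factor [P] is bounded
    uniformly by [INR N * dl]; the remaining product of [E] and [P] is bounded in mean square, which
    gains the factor [dl] over the trivial bound. *)
Lemma energy_bound (b : nat -> C) (w : nat -> R) B dl N S : (0 < N)%nat -> (S <= N)%nat ->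
  (forall j, Cmod (b j) <= B) -> 0 < B -> (forall j, 0 <= w j <= 1) ->
  (forall th, Rabs th <= PI -> Cmod (csum N (fun j => b j * expi (- (th * INR j)))%C) <= INR N * dl) -> 0 <= dl ->
  rsum S (fun s => w s * Re (csum N (fun l => Cconj (b l) * (if Nat.ltb (s + l) N then b (s + l)%nat else RtoC 0)))%C) <= INR N * dl * (INR N * B).
Proof.
  intros HN HSN HB HB0 Hw HP Hdl.
  set (P := fun th => csum N (fun j => b j * expi (- (th * INR j)))%C) in *.
  set (E := fun th => csum S (fun s => RtoC (w s) * expi (th * INR s))%C).
  set (E' := fun th => csum S (fun s => RtoC (w s) * expi (- (th * INR s)))%C).
  assert (HE : forall th, Cmod (E th) = Cmod (E' th)).
  { intros th. unfold E'. rewrite <- (Cmod_conj (csum _ _)), csum_ext_conj_expi. unfold E. f_equal. apply csum_ext.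
    intros i _. f_equal. unfold Cconj, RtoC; simpl. f_equal; ring. }
  assert (Heq : rsum S (fun s => w s * Re (csum N (fun l => Cconj (b l) * (if Nat.ltb (s + l) N then b (s + l)%nat else RtoC 0)))%C)
    = grid_meanR N (fun th => Re (E th * (Cconj (P th) * P th)))).
  { rewrite <- Re_grid_mean.
    rewrite (grid_mean_ext _ _ (fun th => csum S (fun s => RtoC (w s) * ((csum N (fun l => Cconj (b l) * expi (th * INR (s + l)))) * P th)))%C).
    - rewrite grid_mean_csum, Re_csum. apply rsum_ext. intros s Hs. rewrite grid_mean_mult, re_scal_l. f_equal. f_equal.
      unfold P. symmetry. apply (Plancherel_bilinear N N N (fun l => Cconj (b l)) b (fun l => (s + l)%nat)); intros; lia.
    - intros th. unfold E. rewrite Cmult_comm, <- csum_mult. apply csum_ext. intros s _.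
      unfold P at 1. rewrite csum_ext_conj_expi.
      replace (csum N (fun l => Cconj (b l) * expi (th * INR (s + l))))%C with (expi (th * INR s) * csum N (fun i => Cconj (b i) * expi (th * INR i)))%C. ring.
      rewrite <- csum_mult. apply csum_ext. intros i _. rewrite plus_INR, Rmult_plus_distr_l, expi_plus. ring. }
  rewrite Heq.
  (* Young's inequality with weights [/ (2 * B)] and [B / 2]: they balance the mean squares, at most
     [N * B ^ 2] for [P] and at most [N] for [E'], and the total is [N * B]. *)
  apply Rle_trans with (grid_meanR N (fun th => (INR N * dl * / (2 * B)) * Cmod (P th) ^ 2 + (INR N * dl * B / 2) * Cmod (E' th) ^ 2)).
  - apply grid_meanR_le; auto. intros th Hth. eapply Rle_trans. apply Re_le_Cmod.
    rewrite !Cmod_mult, Cmod_conj, HE. specialize (HP th Hth). fold (P th) in HP.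
    set (p := Cmod (P th)) in *. set (e := Cmod (E' th)).
    assert (0 <= p) by apply Cmod_ge_0. assert (0 <= e) by apply Cmod_ge_0.
    assert (H1 : e * p <= / (2 * B) * p ^ 2 + B / 2 * e ^ 2).
    { apply Rmult_le_reg_l with (2 * B). lra.
      replace (2 * B * (/ (2 * B) * p ^ 2 + B / 2 * e ^ 2)) with (p ^ 2 + (B * e) ^ 2) by (field; lra).
      pose proof (pow2_ge_0 (p - B * e)). nra. }
    apply Rle_trans with (INR N * dl * (e * p)).
    + replace (e * (p * p)) with (p * (e * p)) by ring. apply Rmult_le_compat_r; auto. apply Rmult_le_pos; auto.
    + apply Rle_trans with (INR N * dl * (/ (2 * B) * p ^ 2 + B / 2 * e ^ 2)).
      apply Rmult_le_compat_l; auto. apply Rmult_le_pos; auto. apply pos_INR. right. field. lra.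
  - rewrite grid_meanR_comb. unfold P, E'. rewrite !Plancherel_norm by lia.
    assert (H1 : rsum N (fun i => Cmod (b i) ^ 2) <= INR N * (B ^ 2)).
    { rewrite <- rsum_const. apply rsum_le. intros i _. apply pow_incr. split. apply Cmod_ge_0. auto. }
    assert (H2 : rsum S (fun i => Cmod (w i) ^ 2) <= INR N * 1).
    { apply Rle_trans with (INR S * 1). rewrite <- rsum_const. apply rsum_le. intros i _. rewrite Cmod_R.
      specialize (Hw i). rewrite Rabs_pos_eq by lra. simpl. nra.
      rewrite !Rmult_1_r. apply le_INR. auto. }
    pose proof (pos_INR N). assert (0 <= INR N * dl) by (apply Rmult_le_pos; auto).
    assert (0 < / (2 * B)) by (apply Rinv_0_lt_compat; lra).
    apply Rle_trans with (INR N * dl * / (2 * B) * (INR N * B ^ 2) + INR N * dl * B / 2 * (INR N * 1)).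
    + apply Rplus_le_compat; apply Rmult_le_compat_l; auto.
      apply Rmult_le_pos; lra. unfold Rdiv. apply Rmult_le_pos; [|lra]. apply Rmult_le_pos; lra.
    + right. field. lra.
Qed.

(** The sum over good almost periods [s] of the correlations of the samples with shift [s] is bounded below by their
    density and above through [energy_bound]. *)
Lemma AP_vanish_at_0 (f : R -> C) : AP f ->
  (forall al, is_mean (fun x => f x * expi (- (al * x)))%C (RtoC 0)) -> f 0 = RtoC 0.
Proof.
  intros Hf H0. apply NNPP. intros Hn. apply Cmod_gt_0 in Hn.
  destruct (AP_bounded f Hf) as [B [HB HfB]].
  (* A quarter, because one [mu] is lost in passing from [f 0] to the mean over the first cell and
     another at each almost period, and at least [mu] must remain. *)
  set (mu := Cmod (f 0) / 4). assert (Hmu : 0 < mu) by (unfold mu; lra).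
  destruct (period_runs f Hf mu Hmu) as [L1 [q1 [Hq1 [Hmod1 Hrun1]]]].
  set (h1 := (L1 * q1 + 1)%nat). assert (Hh1 : 0 < INR h1) by (apply lt_0_INR; unfold h1; lia).
  (* A lower bound for the mean energy of the samples: they have modulus at least [mu] on a set of
     indices of density at least [1 / h1]. *)
  set (c0 := mu * mu / INR h1). assert (Hc0 : 0 < c0) by (unfold c0; apply Rdiv_lt_0_compat; nra).
  (* Chosen so that the error [B * e2] of [correlation_lower] is a quarter of [c0]. *)
  set (e2 := c0 / (4 * B)). assert (He2 : 0 < e2) by (unfold e2; apply Rdiv_lt_0_compat; lra).
  destruct (period_runs f Hf e2 He2) as [L2 [q2 [Hq2 [_ Hrun2]]]].
  set (h2 := (L2 * q2 + 1)%nat). assert (Hh2 : 0 < INR h2) by (apply lt_0_INR; unfold h2; lia).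
  (* The factor [k0 = N / Sn]: shifts stay below [Sn], so the pairs cut off at the end of the sample
     cost at most another quarter of [INR N * c0]. *)
  destruct (nat_above (4 * (B * B) / c0)) as [k0 [Hk0 Hk0']].
  assert (Hk0R : 0 < INR k0) by (apply lt_0_INR; auto).
  (* With this value the upper bound of [energy_bound] is density times [INR N * c0 / 4], half of
     the lower bound obtained from the almost periods. The mesh is fixed only afterwards. *)
  set (dl := c0 / (4 * B * INR h2 * INR k0)).
  assert (Hden : 0 < 4 * B * INR h2 * INR k0) by (repeat apply Rmult_lt_0_compat; lra).
  assert (Hdl : 0 < dl) by (unfold dl; apply Rdiv_lt_0_compat; auto).
  destruct (uniform_decay f B Hf HB HfB H0 dl Hdl) as [q3 [Hq3 Hdec]].
  destruct (Hdec (q1 * q2)%nat ltac:(nia)) as [N0 HN0].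
  set (Q := (q3 * (q1 * q2))%nat) in *. assert (HQ : (0 < Q)%nat) by (unfold Q; nia).
  set (n1 := (q2 * q3)%nat). set (n2 := (q1 * q3)%nat).
  assert (HQ1 : Q = (q1 * n1)%nat) by (unfold Q, n1; lia).
  assert (HQ2 : Q = (q2 * n2)%nat) by (unfold Q, n2; lia).
  assert (Hn1 : (0 < n1)%nat) by (unfold n1; nia). assert (Hn2 : (0 < n2)%nat) by (unfold n2; nia).
  specialize (Hrun1 n1 Hn1). specialize (Hrun2 n2 Hn2). rewrite <- HQ1 in Hrun1. rewrite <- HQ2 in Hrun2.
  set (I := S N0).
  (* A common multiple of the block lengths [n1 * h1 = L1 * Q + n1] and [n2 * h2 = L2 * Q + n2], so
     that [run_count] applies without remainder; the factor [I] makes the sample longer than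
     [N0]. *)
  set (Sn := (I * ((n1 * h1) * (n2 * h2)))%nat). set (N := (Sn * k0)%nat).
  assert (HSn : (I <= Sn)%nat). { unfold Sn. assert (0 < (n1 * h1) * (n2 * h2))%nat by (unfold h1, h2; nia). nia. }
  assert (HSN : (Sn <= N)%nat) by (unfold N; nia).
  assert (HNpos : (0 < N)%nat) by (unfold I in *; lia).
  set (b := cell_mean f Q).
  set (g1 := indicator (fun s => period f mu (INR s / INR Q))).
  set (g2 := indicator (fun s => period f e2 (INR s / INR Q))).
  assert (Hb : forall j, Cmod (b j) <= B) by (intros j; apply bmean_bound; auto).
  assert (HQR : 0 < INR Q) by (apply lt_0_INR; auto).
  assert (Hb0 : 3 * mu <= Cmod (b 0%nat)).
  { assert (P : Cmod (b 0%nat - f 0) <= mu).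
    { apply bmean_0_near; auto. intros x y Hxy. apply Hmod1. eapply Rle_trans. apply Hxy.
      apply Rinv_le_contravar. apply lt_0_INR; auto. apply le_INR. rewrite HQ1. nia. }
    pose proof (Cmod_le_add (f 0) (b 0%nat)). rewrite Cmod_minus_sym in P. unfold mu in *. lra. }
  assert (Hcount1 : INR Sn * INR k0 / INR h1 <= rsum N g1).
  { pose proof (run_count g1 (L1 * Q) n1 ltac:(intros; apply indicator_01)) as RC.
    assert (EN : N = (I * (n2 * h2) * k0 * (L1 * Q + n1))%nat).
    { unfold N, Sn, h1. rewrite HQ1. ring. }
    rewrite EN. eapply Rle_trans; [|apply RC].
    - right. unfold Sn. rewrite !mult_INR. field. lra.
    - intros c. destruct (Hrun1 c) as [s [Hs Hr]]. exists s. split; auto. intros r Hrn. unfold g1, indicator.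
      destruct excluded_middle_informative; auto. exfalso. apply n. auto. }
  assert (Hcount2 : INR Sn / INR h2 <= rsum Sn g2).
  { pose proof (run_count g2 (L2 * Q) n2 ltac:(intros; apply indicator_01)) as RC.
    assert (EN : Sn = (I * (n1 * h1) * (L2 * Q + n2))%nat).
    { unfold Sn, h2. rewrite HQ2. ring. }
    rewrite EN at 2. eapply Rle_trans; [|apply RC].
    - right. unfold Sn. rewrite !mult_INR. field. lra.
    - intros c. destruct (Hrun2 c) as [s [Hs Hr]]. exists s. split; auto. intros r Hrn. unfold g2, indicator.
      destruct excluded_middle_informative; auto. exfalso. apply n. auto. }
  assert (HNR : INR N = INR Sn * INR k0) by (unfold N; apply mult_INR).
  assert (HSnR : 0 < INR Sn) by (apply lt_0_INR; unfold I in *; lia).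
  assert (HNRp : 0 < INR N) by (apply lt_0_INR; auto).
  assert (Henergy : INR N * c0 <= rsum N (fun l => Cmod (b l) ^ 2)).
  { apply Rle_trans with (mu * mu * rsum N g1).
    - unfold c0. rewrite HNR. replace (INR Sn * INR k0 * (mu * mu / INR h1)) with (mu * mu * (INR Sn * INR k0 / INR h1)) by (field; lra).
      apply Rmult_le_compat_l; auto. nra.
    - rewrite <- rsum_mult. apply rsum_le. intros l _. unfold g1, indicator. destruct excluded_middle_informative as [h|h].
      + pose proof (bmean_shift f Q Hf HQ 0 l mu h) as P. rewrite Nat.add_0_l in P. fold b in P.
        pose proof (Cmod_le_add (b 0%nat) (b l)). rewrite Cmod_minus_sym in P.
        assert (mu <= Cmod (b l)) by lra. simpl. nra.
      + rewrite Rmult_0_r. apply pow2_ge_0. }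
  pose proof (energy_bound b g2 B dl N Sn HNpos HSN Hb HB ltac:(intros; apply indicator_01)) as Hup.
  assert (Hlow : rsum Sn g2 * (INR N * c0 / 2) <= INR N * dl * (INR N * B)).
  { eapply Rle_trans; [|apply Hup].
    - rewrite Rmult_comm, <- rsum_mult. apply rsum_le. intros s Hs. unfold g2, indicator. destruct excluded_middle_informative as [h|h].
      + rewrite Rmult_1_l, Rmult_1_r. eapply Rle_trans; [|apply (correlation_lower b B e2 N s)]; auto; try lra.
        2:{ intros j. apply bmean_shift; auto. }
        assert (INR s <= INR Sn) by (apply le_INR; lia).
        assert (P1 : INR N * (B * e2) = INR N * c0 / 4) by (unfold e2; field; lra).
        assert (P2 : INR s * (B * B) <= INR N * c0 / 4).
        { apply Rle_trans with (INR Sn * (B * B)). apply Rmult_le_compat_r; nra.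
          rewrite HNR. assert (4 * (B * B) <= INR k0 * c0).
          { replace (4 * (B * B)) with (4 * (B * B) / c0 * c0) by (field; lra). apply Rmult_le_compat_r; lra. }
          nra. }
        lra.
      + lra.
    - intros th Hth. pose proof (HN0 N ltac:(unfold I in *; lia) th Hth) as P. exact P.
    - lra. }
  assert (Hfin : INR N * dl * (INR N * B) = INR Sn / INR h2 * (INR N * c0 / 4)).
  { unfold dl. rewrite HNR. field. repeat split; lra. }
  rewrite Hfin in Hlow.
  assert (0 < INR Sn / INR h2 * (INR N * c0)).
  { apply Rmult_lt_0_compat. apply Rdiv_lt_0_compat; auto. apply Rmult_lt_0_compat; auto. }
  assert (INR Sn / INR h2 * (INR N * c0 / 2) <= rsum Sn g2 * (INR N * c0 / 2)).
  { apply Rmult_le_compat_r; auto. apply Rmult_le_pos; [|lra]. apply Rmult_le_pos; lra. }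
  lra.
Qed.

(** A translation multiplies each Fourier coefficient by a phase, so the vanishing hypothesis is
    inherited and the value at 0 decides. *)
Theorem AP_uniqueness (f : R -> C) : AP f ->
  (forall al, is_mean (fun x => f x * expi (- (al * x)))%C (RtoC 0)) -> forall x, f x = RtoC 0.
Proof.
  intros Hf H0 x0.
  replace (f x0) with (f (0 + x0)) by (f_equal; ring).
  apply (AP_vanish_at_0 (fun x => f (x + x0))). apply AP_shift; auto.
  intros al. pose proof (is_mean_shift _ _ x0 (proj1 (AP_twist f al Hf)) (H0 al)) as H.
  pose proof (is_mean_mult (expi (al * x0)) _ _ (Ccont_shift _ x0 (proj1 (AP_twist f al Hf))) H) as H'.
  rewrite Cmult_0_r in H'. revert H'. apply is_mean_ext. intros x.
  replace (- (al * (x + x0))) with (- (al * x) + - (al * x0)) by ring. rewrite expi_plus.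
  replace (expi (al * x0) * (f (x + x0)%R * (expi (- (al * x)) * expi (- (al * x0)))))%C with
    (f (x + x0)%R * expi (- (al * x)) * (expi (al * x0) * expi (- (al * x0))))%C by ring.
  rewrite expi_opp_r. ring.
Qed.

(** * Fourier coefficients *)

Lemma fourier_is_mean f al : AP f -> is_mean (fun x => f x * expi (- (al * x)))%C (fourier f al).
Proof. intros Hf. apply AP_mean. apply AP_twist; auto. Qed.

Lemma fourier_unique f al m : is_mean (fun x => f x * expi (- (al * x)))%C m -> fourier f al = m.
Proof. apply mean_of_is_mean. Qed.

Lemma fourier_plus f g al : AP f -> AP g -> fourier (fun x => f x + g x)%C al = (fourier f al + fourier g al)%C.
Proof.
  intros Hf Hg. apply fourier_unique.
  apply is_mean_ext with (fun x => f x * expi (- (al * x)) + g x * expi (- (al * x)))%C. intros; ring.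
  apply is_mean_plus; try apply AP_twist; auto; apply fourier_is_mean; auto.
Qed.

Lemma fourier_scal c f al : AP f -> fourier (fun x => c * f x)%C al = (c * fourier f al)%C.
Proof.
  intros Hf. apply fourier_unique.
  apply is_mean_ext with (fun x => c * (f x * expi (- (al * x))))%C. intros; ring.
  apply is_mean_mult; try apply AP_twist; auto; apply fourier_is_mean; auto.
Qed.

Lemma fourier_minus f g al : AP f -> AP g -> fourier (fun x => f x - g x)%C al = (fourier f al - fourier g al)%C.
Proof.
  intros Hf Hg. replace (fun x => f x - g x)%C with (fun x => f x + RtoC (-1) * g x)%C.
  rewrite fourier_plus, fourier_scal; auto. ring. apply AP_scal; auto.
  apply functional_extensionality. intros; ring.
Qed.

Lemma fourier_conj f al : AP f -> fourier (fun x => Cconj (f x)) al = Cconj (fourier f (- al)).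
Proof.
  intros Hf. apply fourier_unique.
  apply is_mean_ext with (fun x => Cconj (f x * expi (- (- al * x))))%C.
  - intros x. replace (- (- al * x)) with (al * x) by ring. rewrite expi_opp.
    destruct (f x), (expi (al * x)). unfold Cconj, Cmult; simpl. f_equal; ring.
  - apply is_mean_conj. apply AP_twist; auto. apply fourier_is_mean; auto.
Qed.

Lemma fourier_bound f al B : AP f -> (forall x, Cmod (f x) <= B) -> Cmod (fourier f al) <= B.
Proof.
  intros Hf H. eapply is_mean_bound. apply (AP_twist f al Hf). apply fourier_is_mean; auto.
  intros x. simpl. rewrite Cmod_mult, Cmod_expi, Rmult_1_r. auto.
Qed.

Lemma fourier_close f g al e : AP f -> AP g -> (forall x, Cmod (f x - g x) <= e) ->
  Cmod (fourier f al - fourier g al) <= e.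
Proof. intros Hf Hg H. rewrite <- fourier_minus by auto. apply fourier_bound; auto. apply AP_minus; auto. Qed.

Lemma fourier_expi be al : fourier (fun x => expi (be * x)) al = if Req_EM_T al be then RtoC 1 else RtoC 0.
Proof.
  apply fourier_unique.
  apply is_mean_ext with (fun x => expi ((be - al) * x)).
  { intros x. rewrite <- expi_plus. f_equal. ring. }
  destruct (Req_EM_T al be) as [->|h].
  - apply is_mean_ext with (fun _ => RtoC 1). intros x. replace ((be - be) * x) with 0 by ring. symmetry; apply expi_0.
    apply is_mean_const.
  - apply is_mean_expi. lra.
Qed.

Lemma AP_eq_of_fourier f g : AP f -> AP g -> (forall al, fourier f al = fourier g al) -> f = g.
Proof.
  intros Hf Hg H. apply functional_extensionality. intros x. apply Ceq_minus.
  apply (AP_uniqueness (fun x => f x - g x)%C). apply AP_minus; auto.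
  intros al. replace (RtoC 0) with (fourier (fun x => f x - g x)%C al).
  apply fourier_is_mean, AP_minus; auto. rewrite fourier_minus, H by auto. ring.
Qed.

Lemma fourier_0 f : fourier f 0 = mean f.
Proof.
  unfold fourier. f_equal. apply functional_extensionality. intros x.
  replace (- (0 * x)) with 0 by ring. rewrite expi_0. ring.
Qed.

(** * Unordered sums *)

Lemma list_sum_R_perm a l l' : Permutation l l' -> list_sum_R a l = list_sum_R a l'.
Proof. induction 1; simpl; lra. Qed.

Lemma list_sum_C_perm a l l' : Permutation l l' -> list_sum_C a l = list_sum_C a l'.
Proof. induction 1; simpl; try congruence. ring. Qed.

Lemma list_sum_R_app a l l' : list_sum_R a (l ++ l') = list_sum_R a l + list_sum_R a l'.
Proof. induction l; simpl; [ring | rewrite IHl; ring]. Qed.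

Lemma list_sum_C_app a l l' : list_sum_C a (l ++ l') = (list_sum_C a l + list_sum_C a l')%C.
Proof. induction l; simpl; [ring | rewrite IHl; ring]. Qed.

Lemma list_sum_R_le a b l : (forall x, In x l -> a x <= b x) -> list_sum_R a l <= list_sum_R b l.
Proof.
  induction l; simpl; intros H. lra.
  apply Rplus_le_compat. apply H; auto. apply IHl. auto.
Qed.

Lemma list_sum_R_ext a b l : (forall x, a x = b x) -> list_sum_R a l = list_sum_R b l.
Proof. intros H. induction l; simpl; auto. rewrite IHl, H. auto. Qed.

Lemma list_sum_R_map a g l : list_sum_R a (map g l) = list_sum_R (fun x => a (g x)) l.
Proof. induction l; simpl; auto. rewrite IHl. auto. Qed.

Lemma list_sum_R_ge0 a l : (forall x, 0 <= a x) -> 0 <= list_sum_R a l.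
Proof. intros H. induction l; simpl. lra. specialize (H a0). lra. Qed.

Lemma Cmod_list_sum_C a l : Cmod (list_sum_C a l) <= list_sum_R (fun x => Cmod (a x)) l.
Proof. induction l; simpl. rewrite Cmod_0; lra. eapply Rle_trans. apply Cmod_triangle. lra. Qed.

Lemma list_sum_R_plus a b l : list_sum_R (fun x => a x + b x) l = list_sum_R a l + list_sum_R b l.
Proof. induction l; simpl; [ring | rewrite IHl; ring]. Qed.

Lemma list_sum_R_mult c a l : list_sum_R (fun x => c * a x) l = c * list_sum_R a l.
Proof. induction l; simpl; [ring | rewrite IHl; ring]. Qed.

Lemma list_sum_R_const c l : list_sum_R (fun _ => c) l = INR (length l) * c.
Proof. induction l. simpl; ring. simpl list_sum_R. simpl length. rewrite S_INR, IHl. ring. Qed.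

Definition notin (l0 l : list R) : list R := filter (fun x => if in_dec Req_EM_T x l0 then false else true) l.

Lemma notin_spec l0 l x : In x (notin l0 l) <-> In x l /\ ~ In x l0.
Proof.
  unfold notin. rewrite filter_In. destruct (in_dec Req_EM_T x l0); intuition discriminate.
Qed.

Lemma notin_NoDup l0 l : NoDup l -> NoDup (notin l0 l).
Proof. apply NoDup_filter. Qed.

Lemma split_perm l0 l : NoDup l0 -> NoDup l -> incl l0 l -> Permutation l (l0 ++ notin l0 l).
Proof.
  intros H0 H Hi. apply NoDup_Permutation; auto.
  - apply NoDup_app; auto. apply notin_NoDup; auto. intros x Hx Hx'. apply notin_spec in Hx'. tauto.
  - intros x. rewrite in_app_iff, notin_spec. specialize (Hi x). destruct (in_dec Req_EM_T x l0); tauto.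
Qed.

Section Sums.
Variable A : R -> Prop.

Lemma finite_subset_app_notin l0 l : finite_subset A l0 -> finite_subset A l -> finite_subset A (l0 ++ notin l0 l).
Proof.
  intros [H1 H2] [H3 H4]. split.
  - apply NoDup_app; auto. apply notin_NoDup; auto. intros x Hx Hx'. apply notin_spec in Hx'. tauto.
  - intros x. rewrite in_app_iff, notin_spec. intros [h|h]; auto. apply H4; tauto.
Qed.

Lemma finite_subset_nil : finite_subset A nil.
Proof. split. constructor. intros x []. Qed.

Lemma finite_subset_notin l0 l : finite_subset A l -> finite_subset A (notin l0 l).
Proof. intros [H1 H2]. split. apply notin_NoDup; auto. intros x Hx. apply notin_spec in Hx. apply H2; tauto. Qed.

Global Instance finite_subsets_proper : ProperFilter (finite_subsets A).
Proof.
  split.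
  - intros P [l0 [H0 H]]. exists l0. apply H; auto. apply incl_refl.
  - split.
    + exists nil. split. apply finite_subset_nil. auto.
    + intros P Q [l0 [H0 H]] [l1 [H1 H']]. exists (l0 ++ notin l0 l1). split.
      apply finite_subset_app_notin; auto. intros l Hl Hi. split.
      apply H; auto. intros x Hx. apply Hi. apply in_app_iff; auto.
      apply H'; auto. intros x Hx. apply Hi. apply in_app_iff. rewrite notin_spec.
      destruct (in_dec Req_EM_T x l0); auto.
    + intros P Q HPQ [l0 [H0 H]]. exists l0. split; auto.
Qed.

Definition sum_bounded (a : R -> R) (C : R) : Prop := forall l, finite_subset A l -> list_sum_R a l <= C.

Lemma nonneg_sum_le a C : Rbar_le (nonneg_sum_over A a) (Finite C) <-> sum_bounded a C.
Proof.
  unfold nonneg_sum_over. split.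
  - intros H l Hl.
    pose proof (proj1 (Lub_Rbar_correct (fun s => exists l, finite_subset A l /\ s = list_sum_R a l)) (list_sum_R a l) (ex_intro _ l (conj Hl eq_refl))) as P.
    pose proof (Rbar_le_trans _ _ _ P H) as Q. exact Q.
  - intros H. apply (proj2 (Lub_Rbar_correct (fun s => exists l, finite_subset A l /\ s = list_sum_R a l))).
    intros y [l [Hl ->]]. simpl. auto.
Qed.

Lemma nonneg_sum_ge0 a : Rbar_le (Finite 0) (nonneg_sum_over A a).
Proof.
  unfold nonneg_sum_over.
  apply (proj1 (Lub_Rbar_correct (fun s => exists l, finite_subset A l /\ s = list_sum_R a l)) 0).
  exists nil. split. apply finite_subset_nil. reflexivity.
Qed.

Lemma nonneg_sum_finite a C : sum_bounded a C ->
  exists S, nonneg_sum_over A a = Finite S /\ 0 <= S <= C /\ sum_bounded a S.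
Proof.
  intros H. pose proof (proj2 (nonneg_sum_le a C) H) as H1. pose proof (nonneg_sum_ge0 a) as H2.
  destruct (nonneg_sum_over A a) as [S| |] eqn:E; simpl in *; try contradiction.
  exists S. split; auto. split. lra. apply nonneg_sum_le. rewrite E. simpl. lra.
Qed.

(** If the sum over [l0] is within [eps] of the supremum, a disjoint finite set can add no more than
    [eps]. *)
Lemma tail_small a C : (forall x, 0 <= a x) -> sum_bounded a C -> forall eps, 0 < eps ->
  exists l0, finite_subset A l0 /\ forall l, finite_subset A l -> list_sum_R a (notin l0 l) <= eps.
Proof.
  intros Ha H eps He. destruct (nonneg_sum_finite a C H) as [S [E [HS1 HS2]]].
  destruct (classic (exists l0, finite_subset A l0 /\ S - eps < list_sum_R a l0)) as [[l0 [H0 H1]]|Hn].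
  - exists l0. split; auto. intros l Hl.
    pose proof (HS2 _ (finite_subset_app_notin l0 l H0 Hl)) as P. rewrite list_sum_R_app in P. lra.
  - exfalso. assert (Hb : sum_bounded a (S - eps)).
    { intros l Hl. apply Rnot_lt_le. intros h. apply Hn. exists l; auto. }
    apply nonneg_sum_le in Hb. rewrite E in Hb. simpl in Hb. lra.
Qed.

(** Absolute summability makes the partial sums Cauchy along [finite_subsets A]; completeness gives
    a limit, and [iota] returns it. *)
Lemma sum_over_spec (a : R -> C) M : sum_bounded (fun x => Cmod (a x)) M ->
  filterlim (list_sum_C a) (finite_subsets A) (locally (T := CV) (sum_over A a)).
Proof.
  intros H.
  assert (HC : exists m : CV, filterlim (list_sum_C a) (finite_subsets A) (locally m)).
  { apply (filterlim_locally_cauchy (U := CV)). intros eps. pose proof (cond_pos eps) as He.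
    destruct (tail_small _ M (fun x => Cmod_ge_0 (a x)) H (eps / 4) ltac:(lra)) as [l0 [H0 H1]].
    exists (fun l => Cmod (list_sum_C a l - list_sum_C a l0) <= eps / 4). split.
    - exists l0. split; auto. intros l Hl Hi.
      rewrite (list_sum_C_perm a _ _ (split_perm l0 l (proj1 H0) (proj1 Hl) Hi)), list_sum_C_app.
      match goal with |- Cmod ?X <= _ => replace X with (list_sum_C a (notin l0 l)) by ring end.
      eapply Rle_trans. apply Cmod_list_sum_C. auto.
    - intros u v Hu Hv. apply (norm_compat1 (V := CV)). rewrite norm_C_R.
      change (Cmod (list_sum_C a v - list_sum_C a u) < eps).
      rewrite Cmod_minus_sym in Hu.
      pose proof (Cmod_triangle3 (list_sum_C a v) (list_sum_C a l0) (list_sum_C a u)). lra. }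
  destruct HC as [m Hm].
  assert (E : sum_over A a = m) by (apply (iota_filterlim_locally (V := CV)); exact Hm).
  rewrite E. auto.
Qed.

Lemma sum_over_approx (a : R -> C) M l0 eps : sum_bounded (fun x => Cmod (a x)) M ->
  finite_subset A l0 -> (forall l, finite_subset A l -> list_sum_R (fun x => Cmod (a x)) (notin l0 l) <= eps) ->
  Cmod (sum_over A a - list_sum_C a l0) <= eps.
Proof.
  intros H H0 H1. apply Rnot_lt_le. intros Hn.
  pose proof (proj1 (filterlim_CV _ _ _) (sum_over_spec a M H) ((Cmod (sum_over A a - list_sum_C a l0) - eps)) ltac:(lra)) as [l1 [Hl1 H2]].
  set (l := l0 ++ notin l0 l1).
  assert (Hl : finite_subset A l) by (apply finite_subset_app_notin; auto).
  assert (Hi : incl l0 l) by (intros x Hx; apply in_app_iff; auto).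
  assert (Hi1 : incl l1 l). { intros x Hx. apply in_app_iff. rewrite notin_spec. destruct (in_dec Req_EM_T x l0); auto. }
  specialize (H2 l Hl Hi1).
  assert (P : Cmod (list_sum_C a l - list_sum_C a l0) <= eps).
  { rewrite (list_sum_C_perm a _ _ (split_perm l0 l (proj1 H0) (proj1 Hl) Hi)), list_sum_C_app.
    match goal with |- Cmod ?X <= _ => replace X with (list_sum_C a (notin l0 l)) by ring end.
    eapply Rle_trans. apply Cmod_list_sum_C. auto. }
  pose proof (Cmod_triangle3 (sum_over A a) (list_sum_C a l) (list_sum_C a l0)).
  rewrite Cmod_minus_sym in H2. lra.
Qed.

Lemma sum_over_bound (a : R -> C) M : sum_bounded (fun x => Cmod (a x)) M -> Cmod (sum_over A a) <= M.
Proof.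
  intros H. pose proof (sum_over_approx a M nil M H finite_subset_nil) as P. simpl in P.
  replace (sum_over A a - 0)%C with (sum_over A a) in P by ring. apply P.
  intros l Hl. apply (H (notin nil l)). apply finite_subset_notin; auto.
Qed.

End Sums.

(** * Balls of the algebra over an abstract frequency group *)

Section SpaceA.
Variable A : R -> Prop.
Hypothesis A0 : A 0.
Hypothesis Aplus : forall a b, A a -> A b -> A (a + b).
Hypothesis Aopp : forall a, A a -> A (- a).

(** The closed ball of radius [M] of the algebra with frequency group [A]. *)
Definition ball_A (M : R) (f : R -> C) : Prop :=
  AP f /\ (forall al, fourier f al <> RtoC 0 -> A al) /\ sum_bounded A (fun al => Cmod (fourier f al)) M.

Lemma ball_A_ge0 M f : ball_A M f -> 0 <= M.
Proof. intros [_ [_ H]]. apply (H nil (finite_subset_nil A)). Qed.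

Lemma ball_A_weaken M M' f : ball_A M f -> M <= M' -> ball_A M' f.
Proof. intros [H1 [H2 H3]] h. repeat split; auto; try apply H1. intros l Hl. specialize (H3 l Hl). lra. Qed.

Lemma fourier_off M f al : ball_A M f -> ~ A al -> fourier f al = RtoC 0.
Proof. intros [_ [H _]] h. apply NNPP. intros h'. apply h; auto. Qed.

Lemma ball_A_plus M N f g : ball_A M f -> ball_A N g -> ball_A (M + N) (fun x => f x + g x)%C.
Proof.
  intros Hf Hg. pose proof Hf as [F1 [F2 F3]]. pose proof Hg as [G1 [G2 G3]]. split; [|split].
  - apply AP_plus; auto.
  - intros al. rewrite fourier_plus by auto. intros h. apply NNPP. intros h'. apply h.
    rewrite (fourier_off M f), (fourier_off N g); auto. ring.
  - intros l Hl. eapply Rle_trans.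
    apply list_sum_R_le with (b := fun al => Cmod (fourier f al) + Cmod (fourier g al)).
    intros x _. rewrite fourier_plus by auto. apply Cmod_triangle.
    rewrite list_sum_R_plus. specialize (F3 l Hl). specialize (G3 l Hl). lra.
Qed.

Lemma ball_A_scal M c f : ball_A M f -> ball_A (Cmod c * M) (fun x => c * f x)%C.
Proof.
  intros Hf. pose proof Hf as [F1 [F2 F3]]. split; [|split].
  - apply AP_scal; auto.
  - intros al. rewrite fourier_scal by auto. intros h. apply NNPP. intros h'. apply h.
    rewrite (fourier_off M f); auto. ring.
  - intros l Hl. eapply Rle_trans.
    apply list_sum_R_le with (b := fun al => Cmod c * Cmod (fourier f al)).
    intros x _. rewrite fourier_scal, Cmod_mult by auto. lra.
    rewrite list_sum_R_mult. apply Rmult_le_compat_l. apply Cmod_ge_0. auto.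
Qed.

Lemma list_sum_single c al l : 0 <= c -> NoDup l -> list_sum_R (fun x => if Req_EM_T x al then c else 0) l <= c.
Proof.
  intros Hc. induction 1 as [|x l Hx Hl IH]; simpl; auto.
  destruct (Req_EM_T x al) as [->|h]; [|lra].
  assert (E : list_sum_R (fun x => if Req_EM_T x al then c else 0) l <= list_sum_R (fun _ => 0) l).
  { apply list_sum_R_le. intros y Hy. destruct (Req_EM_T y al); [subst; contradiction | lra]. }
  rewrite list_sum_R_const in E. lra.
Qed.

Lemma ball_A_expi al : A al -> ball_A 1 (fun x => expi (al * x)).
Proof.
  intros Hal. split; [|split].
  - apply AP_expi.
  - intros be. rewrite fourier_expi. destruct (Req_EM_T be al); [subst; auto | congruence].
  - intros l Hl. eapply Rle_trans. 2: apply (list_sum_single 1 al l); [lra | apply Hl].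
    apply list_sum_R_le. intros x _. rewrite fourier_expi. destruct (Req_EM_T x al); [rewrite Cmod_1 | rewrite Cmod_0]; lra.
Qed.

Lemma ball_A_zero : ball_A 0 (fun _ => RtoC 0).
Proof.
  pose proof (ball_A_scal 1 (RtoC 0) _ (ball_A_expi 0 A0)) as H. rewrite Cmod_0, Rmult_0_l in H.
  replace (fun _ : R => RtoC 0) with (fun x => RtoC 0 * expi (0 * x))%C; auto.
  apply functional_extensionality. intros; ring.
Qed.

(** A Fatou property: a finite sum of moduli of coefficients passes to uniform limits, so the norm
    bound survives although the convergence need not hold in the norm. Series, products and
    completeness are all reduced to this. *)
Lemma ball_A_limit M f : (forall eps, 0 < eps -> exists g, ball_A M g /\ forall x, Cmod (f x - g x) <= eps) -> ball_A M f.
Proof.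
  intros H. assert (Hf : AP f).
  { apply AP_limit. intros eps He. destruct (H eps He) as [g [[Hg _] Hfg]]. exists g; auto. }
  split; auto. split.
  - intros al Hal. apply NNPP. intros h. apply Hal. apply Cmod_eq_zero_of_small. intros eps He.
    destruct (H eps He) as [g [Hg Hfg]].
    pose proof (fourier_close f g al eps Hf (proj1 Hg) Hfg) as P. rewrite (fourier_off M g al Hg h) in P.
    replace (fourier f al - 0)%C with (fourier f al) in P by ring. auto.
  - intros l Hl. apply Rnot_lt_le. intros Hn.
    set (s := list_sum_R (fun al => Cmod (fourier f al)) l) in *.
    assert (HL : 0 < INR (length l) + 1) by (pose proof (pos_INR (length l)); lra).
    (* An error of this size in each of the [length l] coefficients cannot bridge the gap
       [s - M]. *)
    set (eps := (s - M) / (INR (length l) + 1)).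
    assert (He : 0 < eps) by (apply Rdiv_lt_0_compat; lra).
    destruct (H eps He) as [g [Hg Hfg]]. pose proof (proj2 (proj2 Hg) l Hl) as P.
    assert (Q : s <= list_sum_R (fun al => Cmod (fourier g al) + eps) l).
    { apply list_sum_R_le. intros al _. pose proof (fourier_close f g al eps Hf (proj1 Hg) Hfg).
      pose proof (Cmod_le_add (fourier f al) (fourier g al)). lra. }
    rewrite list_sum_R_plus, list_sum_R_const in Q.
    assert ((INR (length l) + 1) * eps = s - M) by (unfold eps; field; lra). lra.
Qed.

Definition trig_series (a : R -> C) (x : R) : C := sum_over A (fun al => a al * expi (al * x))%C.

Definition trig_sum (a : R -> C) (l : list R) (x : R) : C := list_sum_C (fun al => a al * expi (al * x))%C l.

Lemma ball_A_trig_sum a l : (forall al, In al l -> A al) -> ball_A (list_sum_R (fun al => Cmod (a al)) l) (trig_sum a l).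
Proof.
  induction l as [|al l IH]; intros H.
  - apply ball_A_zero.
  - unfold trig_sum. simpl. apply ball_A_plus. rewrite <- (Rmult_1_r (Cmod (a al))). apply ball_A_scal. apply ball_A_expi. apply H; simpl; auto.
    apply IH. intros; apply H; simpl; auto.
Qed.

Lemma trig_sum_AP a l : AP (trig_sum a l).
Proof.
  induction l as [|al l IH]; unfold trig_sum; simpl. apply AP_const. apply AP_plus; auto. apply AP_scal, AP_expi.
Qed.

Lemma fourier_trig_sum a l al : NoDup l -> fourier (trig_sum a l) al = if in_dec Req_EM_T al l then a al else RtoC 0.
Proof.
  induction 1 as [|be l Hbe Hl IH].
  - simpl. unfold trig_sum; simpl. apply fourier_unique. apply is_mean_ext with (fun _ => RtoC 0). intros; ring. apply is_mean_const.
  - unfold trig_sum. simpl list_sum_C. rewrite (fourier_plus (fun x => a be * expi (be * x))%C (trig_sum a l)).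
    rewrite fourier_scal, fourier_expi, IH.
    2: apply AP_expi. 2: apply AP_scal, AP_expi. 2: apply trig_sum_AP.
    destruct (in_dec Req_EM_T al (be :: l)) as [h|h]; destruct (Req_EM_T al be) as [->|h']; destruct (in_dec Req_EM_T _ l) as [h''|h''];
      simpl in h; try contradiction; try ring; try (exfalso; intuition congruence).
Qed.

Lemma trig_series_approx a M : sum_bounded A (fun al => Cmod (a al)) M -> forall eps, 0 < eps ->
  exists l0, finite_subset A l0 /\ (forall l, finite_subset A l -> list_sum_R (fun al => Cmod (a al)) (notin l0 l) <= eps) /\
   forall x, Cmod (trig_series a x - trig_sum a l0 x) <= eps.
Proof.
  intros H eps He. destruct (tail_small A _ M (fun x => Cmod_ge_0 (a x)) H eps He) as [l0 [H0 H1]].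
  exists l0. split; auto. split; auto. intros x.
  assert (E : (fun al => Cmod (a al * expi (al * x))) = (fun al => Cmod (a al))).
  { apply functional_extensionality. intros al. rewrite Cmod_mult, Cmod_expi. ring. }
  apply (sum_over_approx A _ M); auto; rewrite E; auto.
Qed.

Lemma ball_A_trig_series a M : sum_bounded A (fun al => Cmod (a al)) M -> ball_A M (trig_series a).
Proof.
  intros H. apply ball_A_limit. intros eps He. destruct (trig_series_approx a M H eps He) as [l0 [H0 [_ H1]]].
  exists (trig_sum a l0). split; auto. eapply ball_A_weaken. apply ball_A_trig_sum. apply H0. apply H; auto.
Qed.

Lemma fourier_trig_series a M al : sum_bounded A (fun al => Cmod (a al)) M -> A al -> fourier (trig_series a) al = a al.
Proof.
  intros H Hal. apply Ceq_minus. apply Cmod_eq_zero_of_small. intros eps He.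
  destruct (trig_series_approx a M H (eps / 2) ltac:(lra)) as [l0 [H0 [Ht H1]]].
  pose proof (fourier_close _ _ al (eps / 2) (proj1 (ball_A_trig_series a M H)) (trig_sum_AP a l0) H1) as P.
  rewrite fourier_trig_sum in P by apply H0.
  destruct (in_dec Req_EM_T al l0) as [h|h]. lra.
  assert (Q : Cmod (a al) <= eps / 2).
  { specialize (Ht (al :: nil)). unfold notin in Ht. simpl in Ht. destruct (in_dec Req_EM_T al l0); [contradiction|]. simpl in Ht.
    rewrite Rplus_0_r in Ht. apply Ht. split. repeat constructor. simpl; tauto. intros x [<-|[]]; auto. }
  pose proof (Cmod_triangle3 (fourier (trig_series a) al) 0 (a al)) as R1.
  replace (0 - a al)%C with (- a al)%C in R1 by ring. rewrite Cmod_opp in R1. lra.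
Qed.

(** Both sides are almost periodic with the same coefficients, so Bohr's uniqueness theorem applies.
    The bound of the supremum by the norm, [ball_A_sup], is a consequence. *)
Lemma trig_series_fourier M f : ball_A M f -> trig_series (fourier f) = f.
Proof.
  intros Hf. pose proof Hf as [F1 [F2 F3]]. pose proof (ball_A_trig_series _ M F3) as Hs.
  apply AP_eq_of_fourier; auto. apply Hs. intros al. destruct (classic (A al)) as [h|h].
  apply (fourier_trig_series _ M); auto. rewrite (fourier_off M f), (fourier_off M (trig_series (fourier f))); auto.
Qed.

Lemma ball_A_approx M f : ball_A M f -> forall eps, 0 < eps ->
  exists l0, finite_subset A l0 /\ (forall l, finite_subset A l -> list_sum_R (fun al => Cmod (fourier f al)) (notin l0 l) <= eps) /\
   forall x, Cmod (f x - trig_sum (fourier f) l0 x) <= eps.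
Proof.
  intros Hf eps He. destruct (trig_series_approx _ M (proj2 (proj2 Hf)) eps He) as [l0 [H0 [H1 H2]]].
  exists l0. rewrite (trig_series_fourier M f Hf) in H2. auto.
Qed.

Lemma ball_A_sup M f x : ball_A M f -> Cmod (f x) <= M.
Proof.
  intros Hf. rewrite <- (trig_series_fourier M f Hf). apply sum_over_bound.
  intros l Hl. apply Rle_trans with (list_sum_R (fun al => Cmod (fourier f al)) l).
  apply list_sum_R_le. intros al _. rewrite Cmod_mult, Cmod_expi. lra. apply Hf; auto.
Qed.

Lemma ball_A_fourier M f al : ball_A M f -> Cmod (fourier f al) <= M.
Proof. intros Hf. apply fourier_bound. apply Hf. intros x. apply ball_A_sup; auto. Qed.

(** Multiplication by a character translates the coefficients by [al], an injection that preserves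
    the group. *)
Lemma ball_A_expi_mult M al f : A al -> ball_A M f -> ball_A M (fun x => expi (al * x) * f x)%C.
Proof.
  intros Hal Hf.
  assert (HF : forall be, fourier (fun x => expi (al * x) * f x)%C be = fourier f (be - al)).
  { intros be. apply fourier_unique.
    apply is_mean_ext with (fun x => f x * expi (- ((be - al) * x)))%C.
    intros x. replace (- ((be - al) * x)) with (al * x + - (be * x)) by ring. rewrite expi_plus. ring.
    apply fourier_is_mean. apply Hf. }
  split; [|split].
  - apply (AP_mult (fun x => expi (al * x))). apply AP_expi. apply Hf.
  - intros be. rewrite HF. intros h. apply Hf in h. replace be with (be - al + al) by ring. auto.
  - intros l Hl.
    assert (E : list_sum_R (fun be => Cmod (fourier (fun x => expi (al * x) * f x)%C be)) l = list_sum_R (fun be => Cmod (fourier f be)) (map (fun be => be - al) l)).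
    { rewrite list_sum_R_map. apply list_sum_R_ext. intros x. rewrite HF. reflexivity. }
    rewrite E. apply Hf. split.
    + apply FinFun.Injective_map_NoDup. intros x y h. lra. apply Hl.
    + intros x Hx. apply in_map_iff in Hx. destruct Hx as [y [<- Hy]]. apply Hl in Hy. unfold Rminus. auto.
Qed.

Lemma ball_A_trig_sum_mult N a l g : (forall al, In al l -> A al) -> ball_A N g ->
  ball_A (list_sum_R (fun al => Cmod (a al)) l * N) (fun x => trig_sum a l x * g x)%C.
Proof.
  intros Hl Hg. induction l as [|al l IH].
  - assert (E : (fun x => trig_sum a nil x * g x)%C = (fun _ : R => RtoC 0)).
    { apply functional_extensionality. intros x. unfold trig_sum; simpl. ring. }
    rewrite E. change (list_sum_R (fun al => Cmod (a al)) nil) with 0. rewrite Rmult_0_l. apply ball_A_zero.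
  - assert (E : (fun x => trig_sum a (al :: l) x * g x)%C = (fun x => a al * (expi (al * x) * g x) + trig_sum a l x * g x)%C).
    { apply functional_extensionality. intros x. unfold trig_sum; simpl. ring. }
    rewrite E. change (list_sum_R (fun al => Cmod (a al)) (al :: l)) with (Cmod (a al) + list_sum_R (fun al => Cmod (a al)) l).
    rewrite Rmult_plus_distr_r. apply ball_A_plus.
    + apply ball_A_scal. apply ball_A_expi_mult; auto. apply Hl; simpl; auto.
    + apply IH. intros; apply Hl; simpl; auto.
Qed.

(** Only the first factor is expanded: its partial sums act on [g] through translations of the
    spectrum, and [ball_A_limit] removes the truncation. No double series has to be rearranged. *)
Lemma ball_A_mult M N f g : ball_A M f -> ball_A N g -> ball_A (M * N) (fun x => f x * g x)%C.
Proof.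
  intros Hf Hg. apply ball_A_limit. intros eps He. pose proof (ball_A_ge0 _ _ Hg) as HN.
  destruct (ball_A_approx M f Hf (eps / (N + 1))) as [l0 [H0 [_ H1]]]. apply Rdiv_lt_0_compat; lra.
  exists (fun x => trig_sum (fourier f) l0 x * g x)%C. split.
  - eapply ball_A_weaken. apply (ball_A_trig_sum_mult N); auto. apply H0. apply Rmult_le_compat_r; auto. apply Hf; auto.
  - intros x. replace (f x * g x - trig_sum (fourier f) l0 x * g x)%C with ((f x - trig_sum (fourier f) l0 x) * g x)%C by ring.
    rewrite Cmod_mult. apply Rle_trans with (eps / (N + 1) * (N + 1)).
    apply Rmult_le_compat; auto; try apply Cmod_ge_0. pose proof (ball_A_sup N g x Hg). lra. right; field; lra.
Qed.

Lemma ball_A_conj M f : ball_A M f -> ball_A M (fun x => Cconj (f x)).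
Proof.
  intros Hf. split; [|split].
  - apply AP_conj, Hf.
  - intros al. rewrite fourier_conj by apply Hf. intros h. replace al with (- - al) by ring. apply Aopp. apply Hf.
    intros h'. apply h. rewrite h'. unfold Cconj, RtoC; simpl. f_equal; ring.
  - intros l Hl.
    assert (E : list_sum_R (fun be => Cmod (fourier (fun x => Cconj (f x)) be)) l = list_sum_R (fun be => Cmod (fourier f be)) (map Ropp l)).
    { rewrite list_sum_R_map. apply list_sum_R_ext. intros x. rewrite fourier_conj, Cmod_conj by apply Hf. reflexivity. }
    rewrite E. apply Hf. split.
    + apply FinFun.Injective_map_NoDup. intros x y h. lra. apply Hl.
    + intros x Hx. apply in_map_iff in Hx. destruct Hx as [y [<- Hy]]. apply Hl in Hy. auto.
Qed.

(** For the group [Omega omega] this is convertible with [schrodinger], a fact on which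
    [Duhamel_pointwise] relies. *)
Definition free_flow (t : R) (f : R -> C) : R -> C := trig_series (fun al => fourier f al * expi (- (al ^ 2 * t)))%C.

Lemma free_flow_bounded M t f : ball_A M f -> sum_bounded A (fun al => Cmod (fourier f al * expi (- (al ^ 2 * t)))) M.
Proof.
  intros Hf l Hl. eapply Rle_trans. 2: apply Hf; eauto. apply list_sum_R_le. intros x _. rewrite Cmod_mult, Cmod_expi. lra.
Qed.

Lemma ball_A_free_flow M t f : ball_A M f -> ball_A M (free_flow t f).
Proof. intros Hf. apply ball_A_trig_series. apply free_flow_bounded; auto. Qed.

Lemma fourier_free_flow M t f al : ball_A M f -> fourier (free_flow t f) al = (fourier f al * expi (- (al ^ 2 * t)))%C.
Proof.
  intros Hf. destruct (classic (A al)) as [h|h].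
  - exact (fourier_trig_series (fun be => fourier f be * expi (- (be ^ 2 * t)))%C M al (free_flow_bounded M t f Hf) h).
  - rewrite (fourier_off M f al Hf h), (fourier_off M (free_flow t f) al (ball_A_free_flow M t f Hf) h). ring.
Qed.

(** The phases [al ^ 2 * t] are not equicontinuous in [al], so the continuity is only strong:
    outside a finite set [l0] the coefficients are small at all times, and on [l0] the phases move
    with bounded speed, collected in [K]. *)
Lemma free_flow_continuity M f t eps : ball_A M f -> 0 < eps -> exists d, 0 < d /\ forall s, Rabs (s - t) < d ->
  ball_A eps (fun x => free_flow s f x - free_flow t f x)%C.
Proof.
  intros Hf He. destruct (ball_A_approx M f Hf (eps / 4) ltac:(lra)) as [l0 [H0 [H1 _]]].
  set (K := list_sum_R (fun al => Cmod (fourier f al) * al ^ 2) l0).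
  assert (HK : 0 <= K). { apply list_sum_R_ge0. intros x. apply Rmult_le_pos. apply Cmod_ge_0. apply pow2_ge_0. }
  exists (eps / (2 * (K + 1))). split. apply Rdiv_lt_0_compat; lra. intros s Hs.
  pose proof (ball_A_free_flow M s f Hf) as Ps. pose proof (ball_A_free_flow M t f Hf) as Pt.
  assert (HF : forall al, fourier (fun x => free_flow s f x - free_flow t f x)%C al = (fourier f al * (expi (- (al ^ 2 * s)) - expi (- (al ^ 2 * t))))%C).
  { intros al. rewrite fourier_minus by (apply Ps || apply Pt). rewrite !(fourier_free_flow M) by auto. ring. }
  split; [|split].
  - apply AP_minus; [apply Ps | apply Pt].
  - intros al. rewrite HF. intros h. apply NNPP. intros h'. apply h. rewrite (fourier_off M f al Hf h'). ring.
  - intros l Hl.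
    set (a := fun al => Cmod (fourier (fun x => free_flow s f x - free_flow t f x)%C al)).
    assert (Ha : forall x, 0 <= a x) by (intros; apply Cmod_ge_0).
    apply Rle_trans with (list_sum_R a l0 + list_sum_R a (notin l0 l)).
    { pose proof (finite_subset_app_notin A l0 l H0 Hl) as Hf1.
      set (l' := l0 ++ notin l0 l) in *.
      assert (Hi : incl l l'). { intros x Hx. apply in_app_iff. rewrite notin_spec. destruct (in_dec Req_EM_T x l0); auto. }
      rewrite <- list_sum_R_app. fold l'.
      rewrite (list_sum_R_perm a _ _ (split_perm l l' (proj1 Hl) (proj1 Hf1) Hi)), list_sum_R_app.
      pose proof (list_sum_R_ge0 a (notin l l') Ha). lra. }
    assert (Q1 : list_sum_R a l0 <= Rabs (s - t) * K).
    { unfold K. rewrite <- list_sum_R_mult. apply list_sum_R_le. intros al _. unfold a. rewrite HF, Cmod_mult.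
      pose proof (Cmod_expi_minus (- (al ^ 2 * s)) (- (al ^ 2 * t))) as P.
      replace (- (al ^ 2 * s) - - (al ^ 2 * t)) with (- (s - t) * al ^ 2) in P by ring.
      rewrite Rabs_mult, Rabs_Ropp, (Rabs_pos_eq (al ^ 2)) in P by apply pow2_ge_0.
      replace (Rabs (s - t) * (Cmod (fourier f al) * al ^ 2)) with (Cmod (fourier f al) * (Rabs (s - t) * al ^ 2)) by ring.
      apply Rmult_le_compat_l; auto. apply Cmod_ge_0. }
    assert (Q2 : list_sum_R a (notin l0 l) <= 2 * (eps / 4)).
    { apply Rle_trans with (list_sum_R (fun al => 2 * Cmod (fourier f al)) (notin l0 l)).
      - apply list_sum_R_le. intros al _. unfold a. rewrite HF, Cmod_mult.
        pose proof (Cmod_triangle (expi (- (al ^ 2 * s))) (- expi (- (al ^ 2 * t)))) as P. rewrite Cmod_opp, !Cmod_expi in P.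
        unfold Cminus. pose proof (Cmod_ge_0 (fourier f al)). nra.
      - rewrite list_sum_R_mult. specialize (H1 l Hl). lra. }
    assert (Q3 : Rabs (s - t) * K <= eps / 2).
    { apply Rle_trans with (eps / (2 * (K + 1)) * (K + 1)). apply Rmult_le_compat; try lra. apply Rabs_pos. right; field; lra. }
    lra.
Qed.

End SpaceA.

(** * The frequency group [Omega] and the norm [normA] *)

Lemma sum_n_stable (F : nat -> R) N N' : (N <= N')%nat -> (forall j, (N < j)%nat -> F j = 0) -> sum_n F N' = sum_n F N.
Proof.
  intros H HF. induction H; auto. rewrite sum_Sn, IHle, HF by lia. unfold plus; simpl. ring.
Qed.

Lemma Omega_0 omega : Omega omega 0.
Proof.
  exists (fun _ => 0%Z), 0%nat. split; auto. rewrite sum_O. ring.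
Qed.

Lemma Omega_plus omega a b : Omega omega a -> Omega omega b -> Omega omega (a + b).
Proof.
  intros [n [N [H1 ->]]] [m [M [H2 ->]]]. exists (fun j => (n j + m j)%Z), (Nat.max N M). split.
  - intros j Hj. rewrite H1, H2 by lia. reflexivity.
  - rewrite <- (sum_n_stable (fun j => IZR (n j) * omega j) N (Nat.max N M)); [|lia|].
    rewrite <- (sum_n_stable (fun j => IZR (m j) * omega j) M (Nat.max N M)); [|lia|].
    change (plus (sum_n (fun j => IZR (n j) * omega j) (Nat.max N M)) (sum_n (fun j => IZR (m j) * omega j) (Nat.max N M)) = sum_n (fun j => IZR (n j + m j) * omega j) (Nat.max N M)).
    rewrite <- (sum_n_plus (G := R_AbelianMonoid)). apply sum_n_ext. intros j. rewrite plus_IZR. unfold plus; simpl. ring.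
    intros j Hj. rewrite H2; auto. ring. intros j Hj. rewrite H1; auto. ring.
Qed.

Lemma Omega_opp omega a : Omega omega a -> Omega omega (- a).
Proof.
  intros [n [N [H1 ->]]]. exists (fun j => (- n j)%Z), N. split.
  - intros j Hj. rewrite H1 by lia. reflexivity.
  - induction N in n, H1 |- *.
    + rewrite !sum_O, opp_IZR. ring.
    + assert (E : forall k, - sum_n (fun j => IZR (n j) * omega j) k = sum_n (fun j => IZR (- n j) * omega j) k).
      { induction k. rewrite !sum_O, opp_IZR. ring. rewrite !sum_Sn, <- IHk, opp_IZR. unfold plus; simpl. ring. }
      apply E.
Qed.

Lemma in_A_iff omega f : in_A omega f <-> exists M, ball_A (Omega omega) M f.
Proof.
  unfold in_A, ball_A. rewrite almost_periodic_iff. split.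
  - intros [H1 [H2 H3]]. destruct (normA omega f) as [S| |] eqn:E; simpl in H3; try contradiction.
    + exists S. repeat split; auto; try apply H1. apply nonneg_sum_le. unfold normA in E. rewrite E. simpl; lra.
    + pose proof (nonneg_sum_ge0 (Omega omega) (fun al => Cmod (fourier f al))) as P. unfold normA in E. rewrite E in P. destruct P.
  - intros [M [H1 [H2 H3]]]. split; auto. split; auto. unfold normA.
    destruct (nonneg_sum_finite _ _ _ H3) as [S [-> _]]. simpl. auto.
Qed.

Lemma normA_finite omega f : in_A omega f -> normA omega f = Finite (real (normA omega f)).
Proof.
  intros [_ [_ H]]. pose proof (nonneg_sum_ge0 (Omega omega) (fun al => Cmod (fourier f al))) as P. unfold normA in *.
  destruct (nonneg_sum_over _ _); simpl in *; tauto.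
Qed.

Lemma ball_A_normA omega f : in_A omega f -> ball_A (Omega omega) (real (normA omega f)) f.
Proof.
  intros H. pose proof (normA_finite omega f H) as E. apply in_A_iff in H. destruct H as [M [H1 [H2 H3]]].
  repeat split; auto; try apply H1. apply nonneg_sum_le. fold (normA omega f). rewrite E. simpl; lra.
Qed.

Lemma normA_le omega f M : ball_A (Omega omega) M f -> real (normA omega f) <= M.
Proof.
  intros H. pose proof (proj2 (in_A_iff omega f) (ex_intro _ M H)) as HA.
  pose proof (proj2 (nonneg_sum_le _ _ _) (proj2 (proj2 H))) as P. fold (normA omega f) in P.
  rewrite (normA_finite omega f HA) in P. exact P.
Qed.

(** * The Banach algebra *)

Section AWspace.
Variable omega : nat -> R.
Let A := Omega omega.

Definition AW : Type := {f : R -> C | in_A omega f}.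

Definition AWfun (u : AW) : R -> C := proj1_sig u.

Definition AWnorm (u : AW) : R := real (normA omega (AWfun u)).

Lemma AWfun_in_A (u : AW) : in_A omega (AWfun u).
Proof. exact (proj2_sig u). Qed.

Lemma AWfun_ball_A (u : AW) : ball_A A (AWnorm u) (AWfun u).
Proof. apply ball_A_normA, AWfun_in_A. Qed.

Lemma AWnorm_le (u : AW) M : ball_A A M (AWfun u) -> AWnorm u <= M.
Proof. apply normA_le. Qed.

Lemma AWfun_AP (u : AW) : AP (AWfun u).
Proof. apply (AWfun_ball_A u). Qed.

Lemma AWnorm_ge0 (u : AW) : 0 <= AWnorm u.
Proof. apply (ball_A_ge0 A _ (AWfun u)). apply AWfun_ball_A. Qed.

Lemma AWfun_sup (u : AW) x : Cmod (AWfun u x) <= AWnorm u.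
Proof. eapply ball_A_sup. exact (Omega_0 omega). apply AWfun_ball_A. Qed.

(** The algebraic structures below are built on Leibniz equality, hence functional extensionality
    for the functions and proof irrelevance for the membership proofs. *)
Lemma AW_eq (u v : AW) : (forall x, AWfun u x = AWfun v x) -> u = v.
Proof.
  intros H. destruct u as [u Hu], v as [v Hv]. simpl in H. assert (u = v) by (apply functional_extensionality; auto).
  subst v. f_equal. apply proof_irrelevance.
Qed.

Lemma AW_eq_fourier (u v : AW) : (forall al, fourier (AWfun u) al = fourier (AWfun v) al) -> u = v.
Proof. intros H. apply AW_eq. intros x. rewrite (AP_eq_of_fourier (AWfun u) (AWfun v)); auto; apply AWfun_AP. Qed.

Lemma in_A_of_ball_A M f : ball_A A M f -> in_A omega f.
Proof. intros H. apply in_A_iff. exists M; auto. Qed.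

Definition mkAW (M : R) (f : R -> C) (H : ball_A A M f) : AW := exist _ f (in_A_of_ball_A M f H).

Definition AWplus (u v : AW) : AW := mkAW _ _ (ball_A_plus A _ _ _ _ (AWfun_ball_A u) (AWfun_ball_A v)).
Definition AWcscal (c : C) (u : AW) : AW := mkAW _ _ (ball_A_scal A _ c _ (AWfun_ball_A u)).
Definition AWzero : AW := mkAW _ _ (ball_A_zero A (Omega_0 omega)).
Definition AWopp (u : AW) : AW := AWcscal (RtoC (-1)) u.
Definition AWscal (k : R) (u : AW) : AW := AWcscal (RtoC k) u.

Lemma AWplus_comm u v : AWplus u v = AWplus v u.
Proof. apply AW_eq; intros x; simpl; ring. Qed.
Lemma AWplus_assoc u v w : AWplus u (AWplus v w) = AWplus (AWplus u v) w.
Proof. apply AW_eq; intros x; simpl; ring. Qed.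
Lemma AWplus_zero_r u : AWplus u AWzero = u.
Proof. apply AW_eq; intros x; simpl; ring. Qed.
Lemma AWplus_opp_r u : AWplus u (AWopp u) = AWzero.
Proof. apply AW_eq; intros x; simpl; ring. Qed.

Definition AW_AbelianMonoid_mixin := AbelianMonoid.Mixin AW AWplus AWzero AWplus_comm AWplus_assoc AWplus_zero_r.
Canonical AW_AbelianMonoid := AbelianMonoid.Pack AW AW_AbelianMonoid_mixin AW.
Definition AW_AbelianGroup_mixin := AbelianGroup.Mixin AW_AbelianMonoid AWopp AWplus_opp_r.
Canonical AW_AbelianGroup := AbelianGroup.Pack AW (AbelianGroup.Class AW AW_AbelianMonoid_mixin AW_AbelianGroup_mixin) AW.

Lemma AWscal_assoc (x y : R) u : AWscal x (AWscal y u) = AWscal (x * y) u.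
Proof. apply AW_eq; intros z; simpl. rewrite RtoC_mult. ring. Qed.
Lemma AWscal_one u : AWscal 1 u = u.
Proof. apply AW_eq; intros z; simpl. ring. Qed.
Lemma AWscal_distr_l (x : R) u v : AWscal x (AWplus u v) = AWplus (AWscal x u) (AWscal x v).
Proof. apply AW_eq; intros z; simpl. ring. Qed.
Lemma AWscal_distr_r (x y : R) u : AWscal (x + y) u = AWplus (AWscal x u) (AWscal y u).
Proof. apply AW_eq; intros z; simpl. rewrite RtoC_plus. ring. Qed.

Definition AW_ModuleSpace_mixin := ModuleSpace.Mixin R_Ring AW_AbelianGroup AWscal AWscal_assoc AWscal_one AWscal_distr_l AWscal_distr_r.
Canonical AW_ModuleSpace := ModuleSpace.Pack R_Ring AW (ModuleSpace.Class R_Ring AW (AbelianGroup.class AW_AbelianGroup) AW_ModuleSpace_mixin) AW.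

Lemma AWnorm_plus u v : AWnorm (AWplus u v) <= AWnorm u + AWnorm v.
Proof. apply AWnorm_le. apply ball_A_plus; apply AWfun_ball_A. Qed.
Lemma AWnorm_cscal c u : AWnorm (AWcscal c u) <= Cmod c * AWnorm u.
Proof. apply AWnorm_le. apply ball_A_scal. apply AWfun_ball_A. Qed.
Lemma AWnorm_scal (k : R) u : AWnorm (AWscal k u) <= Rabs k * AWnorm u.
Proof. rewrite <- Cmod_R. apply AWnorm_cscal. Qed.
Lemma AWnorm_zero : AWnorm AWzero = 0.
Proof. apply Rle_antisym. apply AWnorm_le. apply ball_A_zero, Omega_0. apply AWnorm_ge0. Qed.
Lemma AWnorm_eq0 u : AWnorm u = 0 -> u = AWzero.
Proof.
  intros H. apply AW_eq. intros x. simpl. apply Cmod_eq_0. pose proof (AWfun_sup u x). pose proof (Cmod_ge_0 (AWfun u x)). lra.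
Qed.

Definition AWminus u v := AWplus u (AWopp v).

Lemma AWnorm_minus_sym u v : AWnorm (AWminus u v) = AWnorm (AWminus v u).
Proof.
  assert (P : forall a b, AWnorm (AWminus a b) <= AWnorm (AWminus b a)).
  { intros a b. replace (AWminus a b) with (AWscal (-1) (AWminus b a)).
    eapply Rle_trans. apply AWnorm_scal. rewrite Rabs_left by lra. lra.
    apply AW_eq. intros x; simpl. ring. }
  apply Rle_antisym; apply P.
Qed.

Lemma AWnorm_triangle u v w : AWnorm (AWminus u w) <= AWnorm (AWminus u v) + AWnorm (AWminus v w).
Proof.
  replace (AWminus u w) with (AWplus (AWminus u v) (AWminus v w)). apply AWnorm_plus.
  apply AW_eq. intros x; simpl. ring.
Qed.

Definition AWball (u : AW) (e : R) (v : AW) : Prop := AWnorm (AWminus v u) < e.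

Lemma AWball_center u (e : posreal) : AWball u e u.
Proof. unfold AWball, AWminus. rewrite AWplus_opp_r, AWnorm_zero. apply cond_pos. Qed.
Lemma AWball_sym u v (e : R) : AWball u e v -> AWball v e u.
Proof. unfold AWball. rewrite AWnorm_minus_sym. auto. Qed.
Lemma AWball_triangle u v w (e1 e2 : R) : AWball u e1 v -> AWball v e2 w -> AWball u (e1 + e2) w.
Proof. unfold AWball. intros. pose proof (AWnorm_triangle w v u). lra. Qed.

Definition AW_UniformSpace_mixin := UniformSpace.Mixin AW AWzero AWball AWball_center AWball_sym AWball_triangle.
Canonical AW_UniformSpace := UniformSpace.Pack AW AW_UniformSpace_mixin AW.

Canonical AW_NormedModuleAux := NormedModuleAux.Pack R_AbsRing AW
  (NormedModuleAux.Class R_AbsRing AW (ModuleSpace.class _ AW_ModuleSpace) (UniformSpace.class AW_UniformSpace)) AW.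

Lemma AW_norm_ax3 (x y : AW) (eps : R) : AWnorm (minus y x) < eps -> ball x eps y.
Proof. auto. Qed.
Lemma AW_norm_ax4 (x y : AW) (eps : posreal) : ball x eps y -> AWnorm (minus y x) < 1 * eps.
Proof. intros H. rewrite Rmult_1_l. exact H. Qed.

Definition AW_NormedModule_mixin := NormedModule.Mixin R_AbsRing AW_NormedModuleAux AWnorm 1
  AWnorm_plus AWnorm_scal AW_norm_ax3 AW_norm_ax4 AWnorm_eq0.
Canonical AW_NormedModule := NormedModule.Pack R_AbsRing AW
  (NormedModule.Class R_AbsRing AW (NormedModuleAux.class _ AW_NormedModuleAux) AW_NormedModule_mixin) AW.

(** Because the norm dominates the supremum, a pointwise limit [g] exists. Wherever the filter is
    eventually within [e] of [w], the difference [g - w] is a uniform limit of elements of the ball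
    of radius [e], so [ball_A_limit] yields membership and norm convergence at once. *)
Lemma AW_complete (F : (AW -> Prop) -> Prop) : ProperFilter F -> cauchy F ->
  exists u : AW, forall eps : posreal, F (ball u eps).
Proof.
  intros FF HF.
  assert (Hpt : forall x, exists y : CV, filterlim (fun w : AW => AWfun w x : CV) F (locally y)).
  { intros x. apply (filterlim_locally_cauchy (U := CV)). intros eps. pose proof (cond_pos eps).
    destruct (HF (mkposreal (eps / 2) ltac:(lra))) as [w Hw]. eexists. split. exact Hw.
    intros u v Hu Hv. apply (norm_compat1 (V := CV)). rewrite norm_C_R.
    change (Cmod (AWfun v x - AWfun u x) < eps).
    change (AWnorm (AWminus u w) < eps / 2) in Hu. change (AWnorm (AWminus v w) < eps / 2) in Hv.
    pose proof (AWnorm_triangle v w u). rewrite (AWnorm_minus_sym w u) in H0.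
    pose proof (AWfun_sup (AWminus v u) x). simpl in H1.
    replace (AWfun v x + RtoC (-1) * AWfun u x)%C with (AWfun v x - AWfun u x)%C in H1 by ring. lra. }
  set (g := fun x => proj1_sig (constructive_indefinite_description _ (Hpt x)) : C).
  assert (Hg : forall x, filterlim (fun w : AW => AWfun w x : CV) F (locally (g x : CV))).
  { intros x. unfold g. exact (proj2_sig (constructive_indefinite_description _ (Hpt x))). }
  assert (Hclose : forall (w : AW) e, F (ball w e) -> forall x, Cmod (g x - AWfun w x) <= e).
  { intros w e Hw x. apply Rnot_lt_le. intros Hn.
    pose proof (proj1 (filterlim_CV _ _ _) (Hg x) (Cmod (g x - AWfun w x) - e) ltac:(lra)) as Hx.
    destruct (filter_ex _ (filter_and _ _ Hw Hx)) as [v [Hv1 Hv2]].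
    change (AWnorm (AWminus v w) < e) in Hv1. pose proof (AWfun_sup (AWminus v w) x) as P. simpl in P.
    replace (AWfun v x + RtoC (-1) * AWfun w x)%C with (AWfun v x - AWfun w x)%C in P by ring.
    pose proof (Cmod_triangle3 (g x) (AWfun v x) (AWfun w x)). rewrite Cmod_minus_sym in Hv2. lra. }
  assert (HinB : forall (w : AW) e, 0 < e -> F (ball w e) -> ball_A A e (fun x => g x - AWfun w x)%C).
  { intros w e He Hw. apply ball_A_limit. intros e' He'.
    destruct (HF (mkposreal (e' / 2) ltac:(lra))) as [w' Hw'].
    destruct (filter_ex _ (filter_and _ _ Hw Hw')) as [v [Hv1 Hv2]].
    exists (AWfun (AWminus v w)). split.
    - eapply ball_A_weaken. apply AWfun_ball_A. left. exact Hv1.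
    - intros x. simpl. replace (g x - AWfun w x - (AWfun v x + RtoC (-1) * AWfun w x))%C with (g x - AWfun v x)%C by ring.
      pose proof (Hclose w' _ Hw' x) as P. simpl in P.
      change (AWnorm (AWminus v w') < e' / 2) in Hv2. pose proof (AWfun_sup (AWminus v w') x) as P2. simpl in P2.
      replace (AWfun v x + RtoC (-1) * AWfun w' x)%C with (AWfun v x - AWfun w' x)%C in P2 by ring.
      pose proof (Cmod_triangle3 (g x) (AWfun w' x) (AWfun v x)). rewrite Cmod_minus_sym in P2. lra. }
  destruct (HF (mkposreal 1 ltac:(lra))) as [w0 Hw0].
  pose proof (HinB w0 1 ltac:(lra) Hw0) as H0.
  assert (H1 : ball_A A (1 + AWnorm w0) g).
  { assert (E : (fun x => g x - AWfun w0 x + AWfun w0 x)%C = g) by (apply functional_extensionality; intros; ring).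
    rewrite <- E. exact (ball_A_plus A _ _ _ _ H0 (AWfun_ball_A w0)). }
  clearbody g.
  exists (mkAW _ _ H1). intros eps. pose proof (cond_pos eps) as He.
  destruct (HF (mkposreal (eps / 2) ltac:(lra))) as [w Hw].
  pose proof (HinB w (eps / 2) ltac:(lra) Hw) as H2.
  revert Hw. apply filter_imp. intros v Hv. change (AWnorm (AWminus v w) < eps / 2) in Hv.
  change (AWnorm (AWminus v (mkAW _ _ H1)) < eps).
  pose proof (AWnorm_triangle v w (mkAW _ _ H1)).
  assert (AWnorm (AWminus w (mkAW _ _ H1)) <= eps / 2).
  { rewrite AWnorm_minus_sym. apply AWnorm_le. simpl.
    replace (fun x => g x + RtoC (-1) * AWfun w x)%C with (fun x => g x - AWfun w x)%C; auto.
    apply functional_extensionality; intros; ring. }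
  lra.
Qed.

Definition AWlim (F : (AW -> Prop) -> Prop) : AW := epsilon (inhabits AWzero) (fun u => forall eps : posreal, F (ball u eps)).

Lemma AWlim_ax1 (F : (AW -> Prop) -> Prop) : ProperFilter F -> cauchy F -> forall eps : posreal, F (ball (AWlim F) eps).
Proof.
  intros FF HF. unfold AWlim. apply (epsilon_spec (inhabits AWzero) (fun u => forall eps : posreal, F (ball u eps))).
  apply AW_complete; auto.
Qed.

(** The two filters are equal by extensionality, so [epsilon] chooses the same limit. *)
Lemma AWlim_ax2 (F1 F2 : (AW -> Prop) -> Prop) : filter_le F1 F2 -> filter_le F2 F1 -> close (AWlim F1) (AWlim F2).
Proof.
  intros H1 H2. replace F2 with F1. intros eps. apply ball_center.
  apply functional_extensionality. intros P. apply propositional_extensionality. split; auto.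
Qed.

Definition AW_CompleteSpace_mixin := CompleteSpace.Mixin AW_UniformSpace AWlim AWlim_ax1 AWlim_ax2.
Canonical AW_CompleteSpace := CompleteSpace.Pack AW (CompleteSpace.Class AW (UniformSpace.class AW_UniformSpace) AW_CompleteSpace_mixin) AW.
Canonical AW_CompleteNormedModule := CompleteNormedModule.Pack R_AbsRing AW
  (CompleteNormedModule.Class R_AbsRing AW (NormedModule.class _ AW_NormedModule) AW_CompleteSpace_mixin) AW.

Lemma normA_AWfun (u : AW) : normA omega (AWfun u) = Finite (AWnorm u).
Proof. apply normA_finite, AWfun_in_A. Qed.

Opaque AWnorm.

Definition AWmult (u v : AW) : AW :=
  mkAW _ _ (ball_A_mult A (Omega_0 omega) (Omega_plus omega) (Omega_opp omega) _ _ _ _ (AWfun_ball_A u) (AWfun_ball_A v)).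
Definition AWconj (u : AW) : AW := mkAW _ _ (ball_A_conj A (Omega_opp omega) _ _ (AWfun_ball_A u)).
Definition AWone : AW := mkAW _ _ (ball_A_expi A 0 (Omega_0 omega)).
Definition AWflow (t : R) (u : AW) : AW := mkAW _ _ (ball_A_free_flow A (Omega_0 omega) _ t _ (AWfun_ball_A u)).

Lemma AWnorm_mult u v : AWnorm (AWmult u v) <= AWnorm u * AWnorm v.
Proof. apply AWnorm_le, ball_A_mult; try apply AWfun_ball_A. apply Omega_0. apply Omega_plus. apply Omega_opp. Qed.

Lemma AWnorm_conj u : AWnorm (AWconj u) <= AWnorm u.
Proof. apply AWnorm_le, ball_A_conj; try apply AWfun_ball_A. apply Omega_opp. Qed.

Lemma AWnorm_flow t u : AWnorm (AWflow t u) <= AWnorm u.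
Proof. apply AWnorm_le, ball_A_free_flow; try apply AWfun_ball_A. apply Omega_0. Qed.

Lemma fourier_AWflow t u al : fourier (AWfun (AWflow t u)) al = (fourier (AWfun u) al * expi (- (al ^ 2 * t)))%C.
Proof. apply (fourier_free_flow A (Omega_0 omega) (AWnorm u)). apply AWfun_ball_A. Qed.

Lemma fourier_AWplus u v al : fourier (AWfun (AWplus u v)) al = (fourier (AWfun u) al + fourier (AWfun v) al)%C.
Proof. apply fourier_plus; apply AWfun_AP. Qed.

Lemma fourier_AWcscal c u al : fourier (AWfun (AWcscal c u)) al = (c * fourier (AWfun u) al)%C.
Proof. apply fourier_scal; apply AWfun_AP. Qed.

Lemma AWflow_plus t u v : AWflow t (AWplus u v) = AWplus (AWflow t u) (AWflow t v).
Proof. apply AW_eq_fourier; intros al. rewrite fourier_AWflow, !fourier_AWplus, !fourier_AWflow. ring. Qed.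

Lemma AWflow_cscal t c u : AWflow t (AWcscal c u) = AWcscal c (AWflow t u).
Proof. apply AW_eq_fourier; intros al. rewrite fourier_AWflow, !fourier_AWcscal, !fourier_AWflow. ring. Qed.

Lemma AWflow_minus t u v : AWflow t (AWminus u v) = AWminus (AWflow t u) (AWflow t v).
Proof. unfold AWminus, AWopp. rewrite AWflow_plus, AWflow_cscal. reflexivity. Qed.

Lemma AWflow_add t s u : AWflow t (AWflow s u) = AWflow (t + s) u.
Proof.
  apply AW_eq_fourier; intros al. rewrite !fourier_AWflow, <- Cmult_assoc, <- expi_plus. do 2 f_equal. ring.
Qed.

Lemma AWflow_0 u : AWflow 0 u = u.
Proof.
  apply AW_eq_fourier; intros al. rewrite !fourier_AWflow.
  replace (- (al ^ 2 * 0)) with 0 by ring. rewrite expi_0. ring.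
Qed.

Lemma AWflow_cont u t eps : 0 < eps -> exists d, 0 < d /\ forall s, Rabs (s - t) < d -> AWnorm (AWminus (AWflow s u) (AWflow t u)) <= eps.
Proof.
  intros He. destruct (free_flow_continuity A (Omega_0 omega) (AWnorm u) (AWfun u) t eps (AWfun_ball_A u) He) as [d [Hd H]].
  exists d. split; auto. intros s Hs. apply AWnorm_le. simpl.
  assert (E : (fun x => free_flow A s (AWfun u) x + RtoC (-1) * free_flow A t (AWfun u) x)%C = (fun x => free_flow A s (AWfun u) x - free_flow A t (AWfun u) x)%C)
    by (apply functional_extensionality; intros; ring).
  rewrite E. apply H; auto.
Qed.

(** Boundedness is the comparison of supremum and norm. With [is_linear_fourier] it allows an
    integral with values in the algebra to be computed at a point or at one frequency. *)
Lemma is_linear_eval x : is_linear (U := AW_NormedModule) (V := CV) (fun u => AWfun u x : CV).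
Proof.
  split.
  - intros u v. reflexivity.
  - intros k u. rewrite scal_R_Cmult. reflexivity.
  - exists 1. split. lra. intros u. rewrite norm_C_R, Rmult_1_l. apply AWfun_sup.
Qed.

Lemma is_linear_fourier al : is_linear (U := AW_NormedModule) (V := CV) (fun u => fourier (AWfun u) al : CV).
Proof.
  split.
  - intros u v. exact (fourier_AWplus u v al).
  - intros k u. rewrite scal_R_Cmult. exact (fourier_AWcscal (RtoC k) u al).
  - exists 1. split. lra. intros u. rewrite norm_C_R, Rmult_1_l. eapply ball_A_fourier. apply Omega_0. apply AWfun_ball_A.
Qed.

Lemma is_linear_cscal c : is_linear (U := AW_NormedModule) (V := AW_NormedModule) (AWcscal c).
Proof.
  split.
  - intros u v. apply AW_eq. intros x. simpl. ring.
  - intros k u. apply AW_eq. intros x. simpl. ring.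
  - exists (Cmod c + 1). pose proof (Cmod_ge_0 c). split. lra. intros u. eapply Rle_trans. apply AWnorm_cscal.
    apply Rmult_le_compat_r. apply AWnorm_ge0. lra.
Qed.

Lemma is_linear_flow t : is_linear (U := AW_NormedModule) (V := AW_NormedModule) (AWflow t).
Proof.
  split.
  - intros u v. apply AWflow_plus.
  - intros k u. apply (AWflow_cscal t (RtoC k) u).
  - exists 1. split. lra. intros u. rewrite Rmult_1_l. apply AWnorm_flow.
Qed.

Fixpoint AWpow (u : AW) (k : nat) : AW := match k with O => AWone | S k => AWmult u (AWpow u k) end.

Definition AWsq (u : AW) : AW := AWmult u (AWconj u).

Definition AWabs (k : nat) (u : AW) : AW := AWpow (AWsq u) k.

Lemma AWfun_AWabs k u x : AWfun (AWabs k u) x = RtoC (Cmod (AWfun u x) ^ (2 * k)).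
Proof.
  unfold AWabs. rewrite pow_mult. induction k.
  - simpl. rewrite Rmult_0_l. apply expi_0.
  - change (AWfun (AWpow (AWsq u) (S k)) x) with (AWfun (AWsq u) x * AWfun (AWpow (AWsq u) k) x)%C.
    rewrite IHk. change (AWfun (AWsq u) x) with (AWfun u x * Cconj (AWfun u x))%C. rewrite <- Cmod2_conj, <- RtoC_mult. reflexivity.
Qed.

Lemma AWnorm_pow_bound M k : 0 <= M -> exists K, 0 <= K /\ forall u, AWnorm u <= M -> AWnorm (AWpow u k) <= K.
Proof.
  intros HM. induction k as [|k [K [HK IH]]].
  - exists (AWnorm AWone). split. apply AWnorm_ge0. intros; simpl; lra.
  - exists (M * K). split. apply Rmult_le_pos; auto. intros u Hu. simpl. eapply Rle_trans. apply AWnorm_mult.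
    apply Rmult_le_compat; auto; apply AWnorm_ge0.
Qed.

Lemma mult_minus u u' v v' : AWnorm (AWminus (AWmult u v) (AWmult u' v')) <= AWnorm (AWminus u u') * AWnorm v + AWnorm u' * AWnorm (AWminus v v').
Proof.
  replace (AWminus (AWmult u v) (AWmult u' v')) with (AWplus (AWmult (AWminus u u') v) (AWmult u' (AWminus v v'))).
  eapply Rle_trans. apply AWnorm_plus. apply Rplus_le_compat; apply AWnorm_mult.
  apply AW_eq; intros x; simpl; ring.
Qed.

Lemma pow_Lipschitz M k : 0 <= M -> exists L, 0 <= L /\ forall u v, AWnorm u <= M -> AWnorm v <= M ->
  AWnorm (AWminus (AWpow u k) (AWpow v k)) <= L * AWnorm (AWminus u v).
Proof.
  intros HM. induction k as [|k [L [HL IH]]].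
  - exists 0. split. lra. intros u v _ _. simpl. unfold AWminus at 1. rewrite AWplus_opp_r, AWnorm_zero. lra.
  - destruct (AWnorm_pow_bound M k HM) as [K [HK HK']]. exists (K + M * L). split. pose proof (Rmult_le_pos _ _ HM HL); lra.
    intros u v Hu Hv. simpl. eapply Rle_trans. apply mult_minus.
    pose proof (AWnorm_ge0 (AWminus u v)). specialize (IH u v Hu Hv). specialize (HK' u Hu).
    assert (AWnorm (AWminus u v) * AWnorm (AWpow u k) <= AWnorm (AWminus u v) * K) by (apply Rmult_le_compat_l; [exact H | exact HK']).
    assert (AWnorm v * AWnorm (AWminus (AWpow u k) (AWpow v k)) <= M * (L * AWnorm (AWminus u v)))
      by (apply Rmult_le_compat; [apply AWnorm_ge0 | apply AWnorm_ge0 | exact Hv | exact IH]).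
    lra.
Qed.

Lemma abs_Lipschitz M k : 0 <= M -> exists L, 0 <= L /\ forall u v, AWnorm u <= M -> AWnorm v <= M ->
  AWnorm (AWminus (AWabs k u) (AWabs k v)) <= L * AWnorm (AWminus u v).
Proof.
  intros HM. destruct (pow_Lipschitz (M * M) k ltac:(nra)) as [L [HL H]].
  exists (L * (2 * M)). split. nra. intros u v Hu Hv.
  assert (Hsq : forall w, AWnorm w <= M -> AWnorm (AWsq w) <= M * M).
  { intros w Hw. eapply Rle_trans. apply AWnorm_mult. pose proof (AWnorm_conj w).
    apply Rmult_le_compat; [apply AWnorm_ge0 | apply AWnorm_ge0 | exact Hw | lra]. }
  eapply Rle_trans. apply H; apply Hsq; [exact Hu | exact Hv]. rewrite Rmult_assoc. apply Rmult_le_compat_l; [exact HL|].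
  eapply Rle_trans. apply mult_minus.
  assert (HC : AWnorm (AWminus (AWconj u) (AWconj v)) <= AWnorm (AWminus u v)).
  { replace (AWminus (AWconj u) (AWconj v)) with (AWconj (AWminus u v)). apply AWnorm_conj.
    apply AW_eq; intros x; simpl. destruct (AWfun u x), (AWfun v x). unfold Cconj, Cplus, Cmult, RtoC; simpl. f_equal; ring. }
  pose proof (AWnorm_ge0 (AWminus u v)). pose proof (AWnorm_conj u). pose proof (AWnorm_ge0 v).
  assert (AWnorm (AWminus u v) * AWnorm (AWconj u) <= AWnorm (AWminus u v) * M) by (apply Rmult_le_compat_l; lra).
  assert (AWnorm v * AWnorm (AWminus (AWconj u) (AWconj v)) <= M * AWnorm (AWminus u v)).
  { apply Rmult_le_compat; [apply AWnorm_ge0 | apply AWnorm_ge0 | exact Hv | exact HC]. }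
  lra.
Qed.

End AWspace.

(** * Integration in the algebra *)

Section Evolution.
Variable omega : nat -> R.
Notation AW := (AW omega).
Notation AV := (AW_CompleteNormedModule omega).
Notation AWnorm := (AWnorm omega).
Notation AWfun := (AWfun omega).
Notation AWminus := (AWminus omega).
Notation AWplus := (AWplus omega).

Lemma AWcont_iff (g : R -> AW) (x : R) :
  continuous (U := AV) g x <->
  (forall eps, 0 < eps -> exists d, 0 < d /\ forall y, Rabs (y - x) < d -> AWnorm (AWminus (g y) (g x)) < eps).
Proof.
  unfold continuous. split.
  - intros H eps He.
    pose proof (proj1 (filterlim_locally (U := AW_UniformSpace omega) g (g x)) H (mkposreal eps He)) as P.
    apply locally_R_iff in P. exact P.
  - intros H. apply (filterlim_locally (U := AW_UniformSpace omega)). intros eps. apply locally_R_iff.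
    exact (H eps (cond_pos eps)).
Qed.

Lemma AWcont_ext_loc (g h : R -> AW) x d : 0 < d -> (forall y, Rabs (y - x) < d -> g y = h y) ->
  continuous (U := AV) g x -> continuous (U := AV) h x.
Proof.
  intros Hd H Hg. apply AWcont_iff. intros eps He. destruct (proj1 (AWcont_iff g x) Hg eps He) as [d' [Hd' H']].
  exists (Rmin d d'). split. apply Rmin_glb_lt; auto. intros y Hy.
  pose proof (Rmin_l d d'). pose proof (Rmin_r d d').
  rewrite <- !H. apply H'. lra. rewrite Rminus_diag, Rabs_R0; auto. lra.
Qed.

Definition AWint (g : R -> AW) (a b : R) : AW := RInt (V := AV) g a b.

Definition ex_AWint (g : R -> AW) (a b : R) : Prop := ex_RInt (V := AV) g a b.

Lemma ex_AWint_continuous g a b : (forall z, Rmin a b <= z <= Rmax a b -> continuous (U := AV) g z) -> ex_AWint g a b.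
Proof. intros H. apply (ex_RInt_continuous (V := AV)). exact H. Qed.

Lemma AWint_correct g a b : ex_AWint g a b -> is_RInt (V := AV) g a b (AWint g a b).
Proof. intros H. apply (RInt_correct (V := AV)). exact H. Qed.

Lemma AWint_unique g a b l : is_RInt (V := AV) g a b l -> AWint g a b = l.
Proof. apply (is_RInt_unique (V := AV)). Qed.

Lemma AWint_ext g h a b : (forall x, Rmin a b < x < Rmax a b -> g x = h x) -> AWint g a b = AWint h a b.
Proof. intros H. apply (RInt_ext (V := AV)). exact H. Qed.

Lemma ex_AWint_ext g h a b : (forall x, Rmin a b < x < Rmax a b -> g x = h x) -> ex_AWint g a b -> ex_AWint h a b.
Proof. intros H. apply (ex_RInt_ext (V := AV)). exact H. Qed.

Lemma AWint_point g a : AWint g a a = AWzero omega.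
Proof. exact (RInt_point (V := AV) a g). Qed.

Lemma AWint_bound g a b M : ex_AWint g a b -> (forall x, Rmin a b <= x <= Rmax a b -> AWnorm (g x) <= M) ->
  AWnorm (AWint g a b) <= Rabs (b - a) * M.
Proof.
  intros Hi H. exact (norm_RInt_le_const_abs (V := AV) g a b (AWint g a b) M H (AWint_correct g a b Hi)).
Qed.

Lemma AWint_minus g h a b : ex_AWint g a b -> ex_AWint h a b ->
  AWint (fun x => AWminus (g x) (h x)) a b = AWminus (AWint g a b) (AWint h a b).
Proof.
  intros Hg Hh. apply AWint_unique. exact (is_RInt_minus (V := AV) g h a b _ _ (AWint_correct g a b Hg) (AWint_correct h a b Hh)).
Qed.

Lemma ex_AWint_minus g h a b : ex_AWint g a b -> ex_AWint h a b -> ex_AWint (fun x => AWminus (g x) (h x)) a b.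
Proof. intros Hg Hh. exact (ex_RInt_minus (V := AV) g h a b Hg Hh). Qed.

Lemma AWint_Chasles g a b c : ex_AWint g a b -> ex_AWint g b c -> AWint g a c = AWplus (AWint g a b) (AWint g b c).
Proof.
  intros H1 H2. apply AWint_unique.
  exact (is_RInt_Chasles (V := AV) g a b c _ _ (AWint_correct g a b H1) (AWint_correct g b c H2)).
Qed.

Lemma AWint_linear (l : AW -> AW) g a b : is_linear (U := AV) (V := AV) l -> ex_AWint g a b ->
  AWint (fun x => l (g x)) a b = l (AWint g a b).
Proof.
  intros Hl H. apply AWint_unique. exact (is_RInt_linear (U := AV) (V := AV) l g a b _ Hl (AWint_correct g a b H)).
Qed.

Lemma AWint_linear_C (l : AW -> C) g a b : is_linear (U := AV) (V := CV) l -> ex_AWint g a b ->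
  is_RInt (V := CV) (fun x => l (g x)) a b (l (AWint g a b)).
Proof.
  intros Hl H. exact (is_RInt_linear (U := AV) (V := CV) l g a b _ Hl (AWint_correct g a b H)).
Qed.

Lemma AWint_shift g a b c : ex_AWint g (a + c) (b + c) ->
  is_RInt (V := AV) (fun x => g (x + c)) a b (AWint g (a + c) (b + c)).
Proof.
  intros H. pose proof (is_RInt_comp_lin (V := AV) g 1 c a b (AWint g (a + c) (b + c))) as P.
  rewrite !Rmult_1_l in P. specialize (P (AWint_correct _ _ _ H)).
  eapply (is_RInt_ext (V := AV)); [|exact P].
  intros x _. transitivity (g (1 * x + c)). exact (scal_one (V := AV) (g (1 * x + c))). f_equal. ring.
Qed.

(** * Picard iteration *)

Section Picard.
Variable G : R -> AW -> AW.
Hypothesis Gcont : forall w : R -> AW, (forall x, continuous (U := AV) w x) -> forall x, continuous (U := AV) (fun t => G t (w t)) x.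
Hypothesis GLip : forall M, 0 <= M -> exists L, 0 <= L /\ forall t u v, AWnorm u <= M -> AWnorm v <= M ->
  AWnorm (AWminus (G t u) (G t v)) <= L * AWnorm (AWminus u v).
Hypothesis Gbd : forall M, 0 <= M -> exists K, 0 <= K /\ forall t u, AWnorm u <= M -> AWnorm (G t u) <= K.

Section Local.
Variables (M L K : R) (f : AW).
Hypothesis HM : 0 <= M.
Hypothesis HL : 0 <= L.
Hypothesis HK : 0 <= K.
Hypothesis HGL : forall t u v, AWnorm u <= M + 1 -> AWnorm v <= M + 1 -> AWnorm (AWminus (G t u) (G t v)) <= L * AWnorm (AWminus u v).
Hypothesis HGK : forall t u, AWnorm u <= M + 1 -> AWnorm (G t u) <= K.
Hypothesis Hf : AWnorm f <= M.

(** Small enough that [picard_time * K <= 1], which keeps the iterates in the ball of radius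
    [M + 1], and [picard_time * L <= / 2], which makes the step a contraction. *)
Definition picard_time := / (2 * (K + L + 1)).

Lemma picard_time_pos : 0 < picard_time. Proof. apply Rinv_0_lt_compat. lra. Qed.
Lemma picard_time_K : picard_time * K <= 1.
Proof. pose proof picard_time_pos. assert (picard_time * (2 * (K + L + 1)) = 1) by (unfold picard_time; field; lra). nra. Qed.
Lemma picard_time_L : picard_time * L <= / 2.
Proof. pose proof picard_time_pos. assert (picard_time * (2 * (K + L + 1)) = 1) by (unfold picard_time; field; lra). nra. Qed.

(** Clamping the time makes all estimates on the iterates global in [t]. *)
Definition clamp (t : R) : R := Rmax (- picard_time) (Rmin picard_time t).

Lemma clamp_id t : Rabs t <= picard_time -> clamp t = t.
Proof. intros H. apply Rabs_le_between in H. unfold clamp. rewrite Rmin_right, Rmax_right; lra. Qed.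

Lemma clamp_abs t : Rabs (clamp t) <= picard_time.
Proof. pose proof picard_time_pos. unfold clamp. apply Rabs_le. unfold Rmax, Rmin. repeat destruct Rle_dec; lra. Qed.

Lemma clamp_lip s t : Rabs (clamp s - clamp t) <= Rabs (s - t).
Proof.
  pose proof picard_time_pos. unfold clamp, Rmax, Rmin. repeat destruct Rle_dec; unfold Rabs; repeat destruct Rcase_abs; lra.
Qed.

Definition picard_step (w : R -> AW) (t : R) : AW := AWplus f (AWint (fun s => G s (w s)) 0 (clamp t)).

Definition admissible (w : R -> AW) : Prop := (forall x, continuous (U := AV) w x) /\ forall t, AWnorm (w t) <= M + 1.

Lemma admissible_ex_AWint w a b : admissible w -> ex_AWint (fun s => G s (w s)) a b.
Proof. intros [H _]. apply ex_AWint_continuous. intros z _. apply Gcont. exact H. Qed.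

Lemma picard_step_admissible w : admissible w -> admissible (picard_step w).
Proof.
  intros Hw. pose proof Hw as [Hc Hb]. split.
  - intros x. apply AWcont_iff. intros eps He. exists (eps / (K + 1)). split. apply Rdiv_lt_0_compat; lra. intros y Hy.
    assert (E : AWminus (picard_step w y) (picard_step w x) = AWint (fun s => G s (w s)) (clamp x) (clamp y)).
    { unfold picard_step. rewrite (AWint_Chasles _ 0 (clamp x) (clamp y)) by (apply admissible_ex_AWint; exact Hw).
      apply AW_eq. intros z. simpl. ring. }
    rewrite E. eapply Rle_lt_trans. apply (AWint_bound _ _ _ K). apply admissible_ex_AWint; exact Hw. intros s _. apply HGK, Hb.
    pose proof (clamp_lip y x). apply Rle_lt_trans with (eps / (K + 1) * K).
    apply Rmult_le_compat_r; lra.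
    assert (0 < eps / (K + 1)) by (apply Rdiv_lt_0_compat; lra).
    assert (eps / (K + 1) * (K + 1) = eps) by (field; lra). lra.
  - intros t. unfold picard_step. eapply Rle_trans. apply AWnorm_plus.
    assert (AWnorm (AWint (fun s => G s (w s)) 0 (clamp t)) <= Rabs (clamp t - 0) * K).
    { apply AWint_bound. apply admissible_ex_AWint; exact Hw. intros s _. apply HGK, Hb. }
    rewrite Rminus_0_r in H. pose proof (clamp_abs t). pose proof picard_time_K.
    assert (Rabs (clamp t) * K <= picard_time * K) by (apply Rmult_le_compat_r; lra). lra.
Qed.

Lemma picard_step_contract w v D : admissible w -> admissible v -> (forall t, AWnorm (AWminus (w t) (v t)) <= D) ->
  forall t, AWnorm (AWminus (picard_step w t) (picard_step v t)) <= D / 2.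
Proof.
  intros Hw Hv HD t.
  assert (E : AWminus (picard_step w t) (picard_step v t) = AWint (fun s => AWminus (G s (w s)) (G s (v s))) 0 (clamp t)).
  { rewrite AWint_minus by (apply admissible_ex_AWint; assumption). apply AW_eq. intros z. unfold picard_step. simpl. ring. }
  rewrite E. eapply Rle_trans. apply (AWint_bound _ _ _ (L * D)).
  - apply ex_AWint_minus; apply admissible_ex_AWint; assumption.
  - intros s _. eapply Rle_trans. apply HGL. apply Hw. apply Hv. apply Rmult_le_compat_l; [exact HL | apply HD].
  - rewrite Rminus_0_r. pose proof (clamp_abs t). pose proof picard_time_L. pose proof (HD 0). pose proof (AWnorm_ge0 omega (AWminus (w 0) (v 0))).
    assert (Rabs (clamp t) * (L * D) <= picard_time * (L * D)). { apply Rmult_le_compat_r; [|lra]. apply Rmult_le_pos; lra. }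
    nra.
Qed.

Fixpoint picard_iter (n : nat) : R -> AW := match n with O => fun _ => f | S n => picard_step (picard_iter n) end.

Lemma picard_iter_admissible n : admissible (picard_iter n).
Proof.
  induction n. 2: apply picard_step_admissible; exact IHn.
  split. 2: intros t; simpl; lra. intros x. apply AWcont_iff. intros eps He. exists 1. split. lra. intros y _. simpl.
  replace (AWminus f f) with (AWzero omega) by (apply AW_eq; intros z; simpl; ring). rewrite AWnorm_zero. exact He.
Qed.

Lemma picard_iter_step n : forall t, AWnorm (AWminus (picard_iter (S n) t) (picard_iter n t)) <= (/ 2) ^ n * (2 * M + 2).
Proof.
  induction n; intros t.
  - rewrite pow_O, Rmult_1_l. pose proof (proj2 (picard_iter_admissible 1) t). pose proof (proj2 (picard_iter_admissible 0) t).
    pose proof (AWnorm_triangle omega (picard_iter 1 t) (AWzero omega) (picard_iter 0 t)) as P.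
    rewrite (AWnorm_minus_sym omega (AWzero omega)) in P.
    assert (Z : forall u, AWminus u (AWzero omega) = u) by (intros; apply AW_eq; intros z; simpl; ring).
    rewrite !Z in P. lra.
  - pose proof (picard_step_contract (picard_iter (S n)) (picard_iter n) _ (picard_iter_admissible (S n)) (picard_iter_admissible n) IHn t) as P.
    change (AWnorm (AWminus (picard_step (picard_iter (S n)) t) (picard_step (picard_iter n) t)) <= (/ 2) ^ S n * (2 * M + 2)).
    eapply Rle_trans. exact P. simpl pow. right. field.
Qed.

(** The factor [1 - (/ 2) ^ k] is the partial sum of the geometric series; keeping it makes the
    induction on [k] close exactly. *)
Lemma picard_iter_cauchy n k t : AWnorm (AWminus (picard_iter (n + k) t) (picard_iter n t)) <= (/ 2) ^ n * (4 * M + 4) * (1 - (/ 2) ^ k).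
Proof.
  induction k.
  - rewrite Nat.add_0_r. replace (AWminus (picard_iter n t) (picard_iter n t)) with (AWzero omega) by (apply AW_eq; intros z; simpl; ring).
    rewrite AWnorm_zero. simpl. lra.
  - rewrite Nat.add_succ_r. pose proof (AWnorm_triangle omega (picard_iter (S (n + k)) t) (picard_iter (n + k) t) (picard_iter n t)).
    pose proof (picard_iter_step (n + k) t). rewrite pow_add in H0. simpl pow. nra.
Qed.

Lemma pow_half_small e : 0 < e -> exists n : nat, (/ 2) ^ n * (4 * M + 4) < e.
Proof.
  intros He. destruct (pow_lt_1_zero (/ 2) ltac:(rewrite Rabs_pos_eq; lra) (e / (4 * M + 4))) as [n Hn].
  apply Rdiv_lt_0_compat; lra. exists n. specialize (Hn n ltac:(lia)).
  rewrite Rabs_pos_eq in Hn by (apply pow_le; lra).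
  apply Rmult_lt_compat_r with (r := 4 * M + 4) in Hn; [|lra].
  replace (e / (4 * M + 4) * (4 * M + 4)) with e in Hn by (field; lra). exact Hn.
Qed.

Lemma picard_iter_limit t : exists w : AW, forall n, AWnorm (AWminus w (picard_iter n t)) <= (/ 2) ^ n * (4 * M + 4).
Proof.
  assert (HC : exists w : AV, filterlim (fun n => picard_iter n t : AV) eventually (locally w)).
  { apply (filterlim_locally_cauchy (U := AV)). intros eps. pose proof (cond_pos eps).
    destruct (pow_half_small (eps / 2) ltac:(lra)) as [n Hn].
    exists (fun m => (n <= m)%nat). split. exists n. auto.
    assert (Q : forall m, (n <= m)%nat -> AWnorm (AWminus (picard_iter m t) (picard_iter n t)) < eps / 2).
    { intros m Hm. pose proof (picard_iter_cauchy n (m - n) t) as P. replace (n + (m - n))%nat with m in P by lia.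
      assert (0 < (/ 2) ^ (m - n)) by (apply pow_lt; lra).
      assert (0 < (/ 2) ^ n) by (apply pow_lt; lra).
      assert (0 <= (/ 2) ^ n * (4 * M + 4) * (/ 2) ^ (m - n)) by (repeat apply Rmult_le_pos; lra). lra. }
    intros u v Hu Hv. change (AWnorm (AWminus (picard_iter v t) (picard_iter u t)) < eps).
    pose proof (AWnorm_triangle omega (picard_iter v t) (picard_iter n t) (picard_iter u t)) as P. rewrite (AWnorm_minus_sym omega (picard_iter n t)) in P.
    pose proof (Q u Hu). pose proof (Q v Hv). lra. }
  destruct HC as [w Hw]. exists w. intros n. apply Rnot_lt_le. intros Hn.
  assert (He : 0 < AWnorm (AWminus w (picard_iter n t)) - (/ 2) ^ n * (4 * M + 4)) by lra.
  pose proof (proj1 (filterlim_locally (U := AW_UniformSpace omega) (fun n => picard_iter n t) w) Hw (mkposreal _ He)) as [m Hm].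
  specialize (Hm (n + m)%nat ltac:(lia)).
  change (AWnorm (AWminus (picard_iter (n + m) t) w) < AWnorm (AWminus w (picard_iter n t)) - (/ 2) ^ n * (4 * M + 4)) in Hm.
  pose proof (AWnorm_triangle omega w (picard_iter (n + m) t) (picard_iter n t)) as P. rewrite (AWnorm_minus_sym omega w (picard_iter (n + m) t)) in P.
  pose proof (picard_iter_cauchy n m t) as Q. assert (0 < (/ 2) ^ m) by (apply pow_lt; lra).
  assert (0 < (/ 2) ^ n) by (apply pow_lt; lra).
  assert (0 <= (/ 2) ^ n * (4 * M + 4) * (/ 2) ^ m) by (repeat apply Rmult_le_pos; lra). lra.
Qed.

Definition picard_limit (t : R) : AW := proj1_sig (constructive_indefinite_description _ (picard_iter_limit t)).

Lemma picard_limit_close t n : AWnorm (AWminus (picard_limit t) (picard_iter n t)) <= (/ 2) ^ n * (4 * M + 4).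
Proof. unfold picard_limit. exact (proj2_sig (constructive_indefinite_description _ (picard_iter_limit t)) n). Qed.

Lemma picard_limit_admissible : admissible picard_limit.
Proof.
  split.
  - intros x. apply AWcont_iff. intros eps He. destruct (pow_half_small (eps / 3) ltac:(lra)) as [n Hn].
    destruct (proj1 (AWcont_iff _ x) (proj1 (picard_iter_admissible n) x) (eps / 3) ltac:(lra)) as [d [Hd H]].
    exists d. split; [exact Hd|]. intros y Hy. specialize (H y Hy).
    pose proof (picard_limit_close y n). pose proof (picard_limit_close x n) as Hx. rewrite AWnorm_minus_sym in Hx.
    pose proof (AWnorm_triangle omega (picard_limit y) (picard_iter n y) (picard_limit x)).
    pose proof (AWnorm_triangle omega (picard_iter n y) (picard_iter n x) (picard_limit x)). lra.
  - intros t. apply Rnot_lt_le. intros Hn. destruct (pow_half_small (AWnorm (picard_limit t) - (M + 1)) ltac:(lra)) as [n H].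
    pose proof (picard_limit_close t n). pose proof (proj2 (picard_iter_admissible n) t).
    assert (E : picard_limit t = AWplus (AWminus (picard_limit t) (picard_iter n t)) (picard_iter n t)) by (apply AW_eq; intros z; simpl; ring).
    pose proof (AWnorm_plus omega (AWminus (picard_limit t) (picard_iter n t)) (picard_iter n t)) as P. rewrite <- E in P. lra.
Qed.

Lemma picard_limit_fixpoint t : picard_limit t = picard_step picard_limit t.
Proof.
  assert (H : AWnorm (AWminus (picard_limit t) (picard_step picard_limit t)) = 0).
  { apply Rle_antisym; [|apply AWnorm_ge0]. apply Rnot_lt_le. intros Hn.
    destruct (pow_half_small (AWnorm (AWminus (picard_limit t) (picard_step picard_limit t)) / 2) ltac:(lra)) as [n H].
    pose proof (picard_limit_close t (S n)) as P1.
    pose proof (picard_step_contract picard_limit (picard_iter n) _ picard_limit_admissible (picard_iter_admissible n) (fun t => picard_limit_close t n) t) as P2.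
    change (picard_step (picard_iter n) t) with (picard_iter (S n) t) in P2. rewrite AWnorm_minus_sym in P2.
    pose proof (AWnorm_triangle omega (picard_limit t) (picard_iter (S n) t) (picard_step picard_limit t)) as P3.
    simpl pow in P1. assert (0 < (/ 2) ^ n) by (apply pow_lt; lra). nra. }
  apply AWnorm_eq0 in H. apply AW_eq. intros x. apply Ceq_minus.
  pose proof (f_equal (fun u => AWfun u x) H) as E. simpl in E. rewrite <- E. simpl. ring.
Qed.

End Local.

Theorem Picard_local M : 0 <= M -> exists d, 0 < d /\ forall f, AWnorm f <= M ->
  exists w : R -> AW, (forall x, continuous (U := AV) w x) /\
    forall t, Rabs t <= d -> w t = AWplus f (AWint (fun s => G s (w s)) 0 t).
Proof.
  intros HM. destruct (GLip (M + 1) ltac:(lra)) as [L [HL HGL]]. destruct (Gbd (M + 1) ltac:(lra)) as [K [HK HGK]].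
  exists (picard_time L K). split. apply picard_time_pos; assumption. intros f Hf.
  exists (picard_limit M L K f HM HL HK HGL HGK Hf). split.
  - apply picard_limit_admissible.
  - intros t Ht. rewrite (picard_limit_fixpoint M L K f HM HL HK HGL HGK Hf t) at 1. unfold picard_step. rewrite clamp_id by assumption. reflexivity.
Qed.
End Picard.
End Evolution.

(** * Mild solutions *)

Section Mild.
Variable omega : nat -> R.
Variable k : nat.
Variable c : C.
Notation AW := (AW omega).
Notation AV := (AW_CompleteNormedModule omega).
Notation AWnorm := (AWnorm omega).
Notation AWfun := (AWfun omega).
Notation AWminus := (AWminus omega).
Notation AWplus := (AWplus omega).
Notation AWflow := (AWflow omega).
Notation AWint := (AWint omega).
Notation ex_AWint := (ex_AWint omega).

Definition nonlin (u : AW) : AW := AWcscal omega c (AWabs omega k u).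

Lemma nonlin_Lipschitz M : 0 <= M -> exists L, 0 <= L /\ forall u v, AWnorm u <= M -> AWnorm v <= M ->
  AWnorm (AWminus (nonlin u) (nonlin v)) <= L * AWnorm (AWminus u v).
Proof.
  intros HM. destruct (abs_Lipschitz omega M k HM) as [L [HL H]].
  pose proof (Cmod_ge_0 c) as Hc. exists (Cmod c * L). split. apply Rmult_le_pos; lra. intros u v Hu Hv.
  assert (E : AWminus (nonlin u) (nonlin v) = AWcscal omega c (AWminus (AWabs omega k u) (AWabs omega k v))).
  { apply AW_eq. intros x. simpl. ring. }
  rewrite E. eapply Rle_trans. apply AWnorm_cscal. rewrite Rmult_assoc. apply Rmult_le_compat_l. exact Hc. exact (H u v Hu Hv).
Qed.

Lemma AWcont_nonlin (U : R -> AW) x : continuous (U := AV) U x -> continuous (U := AV) (fun s => nonlin (U s)) x.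
Proof.
  intros HU. apply AWcont_iff. intros eps He.
  pose proof (AWnorm_ge0 omega (U x)) as H0.
  destruct (nonlin_Lipschitz (AWnorm (U x) + 1) ltac:(lra)) as [L [HL H]].
  assert (Hp : 0 < eps / (L + 1)) by (apply Rdiv_lt_0_compat; lra).
  destruct (proj1 (AWcont_iff omega U x) HU (Rmin 1 (eps / (L + 1))) ltac:(apply Rmin_glb_lt; lra)) as [d [Hd Hd']].
  exists d. split. exact Hd. intros y Hy. specialize (Hd' y Hy).
  pose proof (Rmin_l 1 (eps / (L + 1))). pose proof (Rmin_r 1 (eps / (L + 1))).
  assert (Hy1 : AWnorm (U y) <= AWnorm (U x) + 1).
  { replace (U y) with (AWplus (AWminus (U y) (U x)) (U x)) by (apply AW_eq; intros z; simpl; ring).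
    eapply Rle_trans. apply AWnorm_plus. lra. }
  specialize (H (U y) (U x) Hy1 ltac:(lra)).
  eapply Rle_lt_trans. exact H. pose proof (AWnorm_ge0 omega (AWminus (U y) (U x))).
  apply Rle_lt_trans with (L * (eps / (L + 1))). apply Rmult_le_compat_l; lra.
  assert (eps / (L + 1) * (L + 1) = eps) by (field; lra). lra.
Qed.

(** Strong continuity is used only at the fixed vector [U x]; the difference [U y - U x] is
    controlled because the flow does not increase the norm. The condition on [phi] covers the times
    [s], [- s] and [t - s]. *)
Lemma AWcont_flow (phi : R -> R) (U : R -> AW) x : (forall y, Rabs (phi y - phi x) <= Rabs (y - x)) ->
  continuous (U := AV) U x -> continuous (U := AV) (fun s => AWflow (phi s) (U s)) x.
Proof.
  intros Hphi HU. apply AWcont_iff. intros eps He.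
  destruct (proj1 (AWcont_iff omega U x) HU (eps / 2) ltac:(lra)) as [d [Hd Hd']].
  destruct (AWflow_cont omega (U x) (phi x) (eps / 2) ltac:(lra)) as [d2 [Hd2 Hd2']].
  exists (Rmin d d2). split. apply Rmin_glb_lt; lra. intros y Hy.
  pose proof (Rmin_l d d2). pose proof (Rmin_r d d2).
  specialize (Hd' y ltac:(lra)). specialize (Hd2' (phi y) ltac:(specialize (Hphi y); lra)).
  eapply Rle_lt_trans. apply (AWnorm_triangle omega _ (AWflow (phi y) (U x))).
  replace (AWminus (AWflow (phi y) (U y)) (AWflow (phi y) (U x))) with (AWflow (phi y) (AWminus (U y) (U x))).
  - pose proof (AWnorm_flow omega (phi y) (AWminus (U y) (U x))). lra.
  - apply AWflow_minus.
Qed.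

Definition duhamel (t : R) (U : R -> AW) (s : R) : AW := AWflow (t - s) (nonlin (U s)).

Lemma AWcont_duhamel t U x : continuous (U := AV) U x -> continuous (U := AV) (duhamel t U) x.
Proof.
  intros HU. apply (AWcont_flow (fun s => t - s) (fun s => nonlin (U s))).
  - intros y. replace (t - y - (t - x)) with (- (y - x)) by ring. rewrite Rabs_Ropp. lra.
  - apply AWcont_nonlin. exact HU.
Qed.

Theorem mild_local M : 0 <= M -> exists d, 0 < d /\ forall f, AWnorm f <= M ->
  exists U : R -> AW, (forall x, continuous (U := AV) U x) /\
    forall t, Rabs t <= d -> U t = AWplus (AWflow t f) (AWint (duhamel t U) 0 t).
Proof.
  intros HM. set (G := fun t u => AWflow (- t) (nonlin (AWflow t u))).
  assert (Hid : forall x y : R, Rabs (y - x) <= Rabs (y - x)) by (intros; lra).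
  assert (Hop : forall x y : R, Rabs (- y - - x) <= Rabs (y - x)).
  { intros. replace (- y - - x) with (- (y - x)) by ring. rewrite Rabs_Ropp. lra. }
  assert (GC : forall w : R -> AW, (forall x, continuous (U := AV) w x) -> forall x, continuous (U := AV) (fun t => G t (w t)) x).
  { intros w Hw x. apply (AWcont_flow (fun s => - s) (fun s => nonlin (AWflow s (w s)))). exact (Hop x).
    apply AWcont_nonlin. apply (AWcont_flow (fun s => s)). exact (Hid x). apply Hw. }
  assert (GL : forall M, 0 <= M -> exists L, 0 <= L /\ forall t u v, AWnorm u <= M -> AWnorm v <= M ->
    AWnorm (AWminus (G t u) (G t v)) <= L * AWnorm (AWminus u v)).
  { intros M' HM'. destruct (nonlin_Lipschitz M' HM') as [L [HL HLip]]. exists L. split. exact HL.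
    intros t u v Hu Hv. unfold G.
    rewrite <- AWflow_minus. eapply Rle_trans. apply AWnorm_flow. pose proof (AWnorm_flow omega t u). pose proof (AWnorm_flow omega t v).
    eapply Rle_trans. apply HLip; lra. rewrite <- AWflow_minus. apply Rmult_le_compat_l. exact HL. apply AWnorm_flow. }
  assert (GB : forall M, 0 <= M -> exists K, 0 <= K /\ forall t u, AWnorm u <= M -> AWnorm (G t u) <= K).
  { intros M' HM'. destruct (nonlin_Lipschitz M' HM') as [L [HL HLip]].
    pose proof (AWnorm_ge0 omega (nonlin (AWzero omega))) as Hz.
    exists (L * M' + AWnorm (nonlin (AWzero omega))). split. pose proof (Rmult_le_pos _ _ HL HM'). lra.
    intros t u Hu. unfold G. eapply Rle_trans. apply AWnorm_flow. pose proof (AWnorm_flow omega t u).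
    specialize (HLip (AWflow t u) (AWzero omega)). rewrite AWnorm_zero in HLip. specialize (HLip ltac:(lra) HM').
    replace (AWminus (AWflow t u) (AWzero omega)) with (AWflow t u) in HLip by (apply AW_eq; intros z; simpl; ring).
    set (v := nonlin (AWflow t u)) in *.
    replace v with (AWplus (AWminus v (nonlin (AWzero omega))) (nonlin (AWzero omega))) by (apply AW_eq; intros z; simpl; ring).
    eapply Rle_trans. apply AWnorm_plus. assert (L * AWnorm (AWflow t u) <= L * M') by (apply Rmult_le_compat_l; lra). lra. }
  destruct (Picard_local omega G GC GL GB M HM) as [d [Hd H]].
  exists d. split. exact Hd. intros f Hf. destruct (H f Hf) as [w [Hw1 Hw2]].
  assert (HU : forall x, continuous (U := AV) (fun t => AWflow t (w t)) x).
    { intros x. apply (AWcont_flow (fun s => s)). exact (Hid x). apply Hw1. }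
  exists (fun t => AWflow t (w t)). split. exact HU. intros t Ht. rewrite (Hw2 t Ht) at 1. rewrite AWflow_plus. f_equal.
  rewrite <- (AWint_linear omega (AWflow t)).
    + apply AWint_ext. intros s _. unfold duhamel, G. rewrite AWflow_add. f_equal.
    + apply is_linear_flow.
    + apply ex_AWint_continuous. intros s _. apply (AWcont_flow (fun s => - s) (fun s => nonlin (AWflow s (w s)))). exact (Hop s).
      apply AWcont_nonlin. apply HU.
Qed.

(** The integral takes values in the algebra, while that of [is_solution] is computed for each [x]
    separately; restarting and gluing are done in this form. *)
Definition mild (Tm Tp : Rbar) (f : AW) (U : R -> AW) : Prop :=
  (forall t, in_interval Tm Tp t -> continuous (U := AV) U t) /\
  forall t, in_interval Tm Tp t -> U t = AWplus (AWflow t f) (AWint (duhamel t U) 0 t).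

Lemma in_interval_between Tm Tp a b s : in_interval Tm Tp a -> in_interval Tm Tp b ->
  Rmin a b <= s <= Rmax a b -> in_interval Tm Tp s.
Proof.
  intros [Ha1 Ha2] [Hb1 Hb2] [Hs1 Hs2]. split.
  - eapply Rbar_lt_le_trans with (Finite (Rmin a b)); [|exact Hs1]. unfold Rmin; destruct Rle_dec; assumption.
  - eapply Rbar_le_lt_trans with (Finite (Rmax a b)); [exact Hs2|]. unfold Rmax; destruct Rle_dec; assumption.
Qed.

(** [W] follows [U] from [0] to [t0] and the solution [V] restarted at [t0] from [t0] to [t]; [t0] and [t - t0] may
    have any sign. *)
Lemma duhamel_restart (f : AW) (U V W : R -> AW) t0 t :
  U t0 = AWplus (AWflow t0 f) (AWint (duhamel t0 U) 0 t0) ->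
  V (t - t0) = AWplus (AWflow (t - t0) (U t0)) (AWint (duhamel (t - t0) V) 0 (t - t0)) ->
  (forall s, Rmin 0 t0 < s < Rmax 0 t0 -> W s = U s) ->
  (forall s, Rmin t0 t < s < Rmax t0 t -> W s = V (s - t0)) ->
  (forall s, Rmin 0 t0 <= s <= Rmax 0 t0 -> continuous (U := AV) U s) ->
  (forall s, continuous (U := AV) V s) ->
  V (t - t0) = AWplus (AWflow t f) (AWint (duhamel t W) 0 t).
Proof.
  intros HU HV H1 H2 CU CV'.
  assert (I1 : ex_AWint (duhamel t0 U) 0 t0) by (apply ex_AWint_continuous; intros s Hs; apply AWcont_duhamel, CU, Hs).
  assert (I1' : ex_AWint (duhamel t U) 0 t0) by (apply ex_AWint_continuous; intros s Hs; apply AWcont_duhamel, CU, Hs).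
  assert (I2 : forall a b, ex_AWint (duhamel (t - t0) V) a b) by (intros; apply ex_AWint_continuous; intros s Hs; apply AWcont_duhamel, CV').
  assert (E1 : forall s, Rmin 0 t0 < s < Rmax 0 t0 -> duhamel t U s = duhamel t W s).
  { intros s Hs. unfold duhamel. rewrite H1 by exact Hs. reflexivity. }
  assert (E2 : forall s, Rmin t0 t < s < Rmax t0 t -> duhamel (t - t0) V (s + - t0) = duhamel t W s).
  { intros s Hs. unfold duhamel. rewrite H2 by exact Hs. f_equal. ring. }
  pose proof (AWint_shift omega (duhamel (t - t0) V) t0 t (- t0) (I2 _ _)) as Sh.
  assert (A2 : ex_AWint (fun s => duhamel (t - t0) V (s + - t0)) t0 t) by (eexists; exact Sh).
  assert (V2 : AWint (duhamel t W) t0 t = AWint (duhamel (t - t0) V) 0 (t - t0)).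
  { rewrite <- (AWint_ext omega _ _ t0 t E2). rewrite (AWint_unique omega _ _ _ _ Sh). f_equal; ring. }
  assert (V1 : AWint (duhamel t W) 0 t0 = AWflow (t - t0) (AWint (duhamel t0 U) 0 t0)).
  { rewrite <- (AWint_ext omega _ _ 0 t0 E1). rewrite <- (AWint_linear omega (AWflow (t - t0))).
    - apply AWint_ext. intros s _. unfold duhamel. rewrite AWflow_add. f_equal. ring.
    - apply is_linear_flow.
    - exact I1. }
  rewrite (AWint_Chasles omega (duhamel t W) 0 t0 t).
  - rewrite V1, V2, HV, HU, AWflow_plus, AWflow_add. replace (t - t0 + t0) with t by ring. symmetry. apply AWplus_assoc.
  - exact (ex_AWint_ext omega _ _ 0 t0 E1 I1').
  - exact (ex_AWint_ext omega _ _ t0 t E2 A2).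
Qed.

Lemma glue_cont (U V W : R -> AW) t0 : V 0 = U t0 -> W t0 = U t0 ->
  (forall s, W s = U s \/ W s = V (s - t0)) ->
  continuous (U := AV) U t0 -> continuous (U := AV) V 0 -> continuous (U := AV) W t0.
Proof.
  intros HV HW H CU CV'. apply AWcont_iff. intros eps He.
  destruct (proj1 (AWcont_iff omega U t0) CU eps He) as [d [Hd Hd']].
  destruct (proj1 (AWcont_iff omega V 0) CV' eps He) as [d2 [Hd2 Hd2']].
  exists (Rmin d d2). split. apply Rmin_glb_lt; lra. intros y Hy.
  pose proof (Rmin_l d d2). pose proof (Rmin_r d d2). rewrite HW. destruct (H y) as [-> | ->].
  - apply Hd'. lra.
  - rewrite <- HV. apply Hd2'. rewrite Rminus_0_r. lra.
Qed.

Lemma AWcont_shift (V : R -> AW) t0 t : continuous (U := AV) V (t - t0) -> continuous (U := AV) (fun s => V (s - t0)) t.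
Proof.
  intros HV. apply AWcont_iff. intros eps He. destruct (proj1 (AWcont_iff omega V (t - t0)) HV eps He) as [d [Hd Hd']].
  exists d. split. exact Hd. intros y Hy. apply Hd'. replace (y - t0 - (t - t0)) with (y - t) by ring. exact Hy.
Qed.

Lemma local_at_0 (V : R -> AW) f d : 0 < d -> (forall t, Rabs t <= d -> V t = AWplus (AWflow t f) (AWint (duhamel t V) 0 t)) -> V 0 = f.
Proof.
  intros Hd H. rewrite H by (rewrite Rabs_R0; lra). rewrite AWint_point, AWflow_0. apply AWplus_zero_r.
Qed.

(** [sg = 1] continues a solution to the right of [t0 >= 0], [sg = -1] to the left of [t0 <= 0]. *)
Lemma extend_mild Tm Tp Tm' Tp' f U t0 d V sg : mild Tm Tp f U -> sg = 1 \/ sg = -1 -> 0 <= sg * t0 ->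
  in_interval Tm Tp 0 -> in_interval Tm Tp t0 -> 0 < d ->
  (forall x, continuous (U := AV) V x) ->
  (forall t, Rabs t <= d -> V t = AWplus (AWflow t (U t0)) (AWint (duhamel t V) 0 t)) ->
  (forall t, in_interval Tm' Tp' t -> sg * (t - t0) <= 0 -> in_interval Tm Tp t) ->
  (forall t, in_interval Tm' Tp' t -> 0 < sg * (t - t0) -> Rabs (t - t0) <= d) ->
  exists W, mild Tm' Tp' f W.
Proof.
  intros [CU HU] Hsg Ht0 I0 I1 Hd CV' HV Hin Hout. pose proof (local_at_0 V (U t0) d Hd HV) as HV0.
  set (W := fun t => if Rle_dec (sg * (t - t0)) 0 then U t else V (t - t0)). exists W.
  assert (WU : forall s, sg * (s - t0) <= 0 -> W s = U s) by (intros s Hs; unfold W; destruct Rle_dec; [reflexivity | lra]).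
  assert (WV : forall s, 0 < sg * (s - t0) -> W s = V (s - t0)) by (intros s Hs; unfold W; destruct Rle_dec; [lra | reflexivity]).
  split.
  - intros t It. destruct (Rtotal_order (sg * (t - t0)) 0) as [h|[h|h]].
    + apply (AWcont_ext_loc omega U W t (Rabs (t - t0))).
      * apply Rabs_pos_lt. nra.
      * intros y Hy. rewrite WU; [reflexivity|]. unfold Rabs in Hy. destruct Hsg; subst sg; repeat destruct Rcase_abs; lra.
      * apply CU, Hin; [exact It | lra].
    + assert (t = t0) by (destruct Hsg; subst sg; lra). subst t. apply (glue_cont U V W t0 HV0).
      * apply WU. lra.
      * intros s. destruct (Rle_lt_dec (sg * (s - t0)) 0); [left; apply WU | right; apply WV]; assumption.
      * apply CU, I1.
      * apply CV'.
    + apply (AWcont_ext_loc omega (fun s => V (s - t0)) W t (Rabs (t - t0))).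
      * apply Rabs_pos_lt. nra.
      * intros y Hy. rewrite WV; [reflexivity|]. unfold Rabs in Hy. destruct Hsg; subst sg; repeat destruct Rcase_abs; lra.
      * apply AWcont_shift, CV'.
  - intros t It. destruct (Rle_lt_dec (sg * (t - t0)) 0) as [h|h].
    + rewrite WU by exact h. rewrite (HU t (Hin t It h)). f_equal. apply AWint_ext. intros s Hs. unfold duhamel. rewrite WU. reflexivity.
      unfold Rmin, Rmax in Hs. destruct Hsg; subst sg; repeat destruct Rle_dec; lra.
    + rewrite WV by exact h. apply (duhamel_restart f U V W t0 t).
      * apply HU, I1.
      * apply HV, Hout; assumption.
      * intros s Hs. apply WU. unfold Rmin, Rmax in Hs. destruct Hsg; subst sg; repeat destruct Rle_dec; lra.
      * intros s Hs. apply WV. unfold Rmin, Rmax in Hs. destruct Hsg; subst sg; repeat destruct Rle_dec; lra.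
      * intros s Hs. apply CU. apply (in_interval_between Tm Tp 0 t0); assumption.
      * exact CV'.
Qed.

End Mild.

(** * Maximal solutions *)

Section Link.
Variable omega : nat -> R.
Variable k : nat.
Variable lambda : C.
Let c : C := (- (Ci * lambda))%C.
Notation AW := (AW omega).
Notation AV := (AW_CompleteNormedModule omega).
Notation AWnorm := (AWnorm omega).
Notation AWfun := (AWfun omega).

(** Evaluation at [x] is continuous and linear on the algebra, so it commutes with the integral;
    this identifies the two forms of the Duhamel formula. *)
Lemma Duhamel_pointwise (f : AW) (U : R -> AW) (u : R -> R -> C) t x :
  (forall s, Rmin 0 t <= s <= Rmax 0 t -> continuous (U := AV) U s) ->
  (forall s, Rmin 0 t < s < Rmax 0 t -> AWfun (U s) = u s) ->
  (schrodinger omega t (AWfun f) x - Ci * lambda * RInt (V := C_R_CompleteNormedModule)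
     (fun t' => schrodinger omega (t - t') (fun y => RtoC (Cmod (u t' y) ^ (2 * k))) x) 0 t)%C =
  AWfun (AWplus omega (AWflow omega t f) (AWint omega (duhamel omega k c t U) 0 t)) x.
Proof.
  intros CU HU.
  set (g := fun s => AWflow omega (t - s) (AWabs omega k (U s))).
  (* [g] is the Duhamel integrand with constant 1, which is how its integrability is obtained. *)
  assert (Cg1 : forall s, Rmin 0 t <= s <= Rmax 0 t -> continuous (U := AV) (duhamel omega k (RtoC 1) t U) s).
  { intros s Hs. apply AWcont_duhamel, CU, Hs. }
  assert (E1 : forall s, duhamel omega k (RtoC 1) t U s = g s).
  { intros s. unfold duhamel, nonlin, g. f_equal. apply AW_eq. intros z. simpl. ring. }
  assert (Ig : ex_AWint omega g 0 t).
  { apply (ex_AWint_ext omega (duhamel omega k (RtoC 1) t U)). intros s _. apply E1. apply ex_AWint_continuous. exact Cg1. }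
  assert (E2 : AWint omega (duhamel omega k c t U) 0 t = AWcscal omega c (AWint omega g 0 t)).
  { rewrite <- (AWint_linear omega (AWcscal omega c)); [|apply is_linear_cscal | exact Ig].
    apply AWint_ext. intros s _. unfold duhamel, nonlin, g. apply AWflow_cscal. }
  assert (E3 : RInt (V := C_R_CompleteNormedModule)
     (fun t' => schrodinger omega (t - t') (fun y => RtoC (Cmod (u t' y) ^ (2 * k))) x) 0 t = AWfun (AWint omega g 0 t) x).
  { rewrite <- (Cint_unique _ _ _ _ (AWint_linear_C omega (fun v => AWfun v x) g 0 t (is_linear_eval omega x) Ig)).
    apply (RInt_ext (V := CV)). intros s Hs. rewrite <- HU by exact Hs.
    assert (E : (fun y => RtoC (Cmod (AWfun (U s) y) ^ (2 * k))) = AWfun (AWabs omega k (U s))).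
    { apply functional_extensionality. intros y. symmetry. apply AWfun_AWabs. }
    rewrite E. reflexivity. }
  rewrite E2, E3.
  change (AWfun (AWplus omega (AWflow omega t f) (AWcscal omega c (AWint omega g 0 t))) x) with
    (schrodinger omega t (AWfun f) x + c * AWfun (AWint omega g 0 t) x)%C.
  unfold c. ring.
Qed.

Lemma normA_minus (U V : AW) : normA omega (fun x => AWfun U x - AWfun V x)%C = Finite (AWnorm (AWminus omega U V)).
Proof.
  rewrite <- normA_AWfun. f_equal. apply functional_extensionality. intros x. simpl. ring.
Qed.

Lemma solution_of_mild Tm Tp (f : AW) (U : R -> AW) : in_interval Tm Tp 0 -> mild omega k c Tm Tp f U ->
  is_solution (2 * k) omega lambda (AWfun f) Tm Tp (fun t => AWfun (U t)).
Proof.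
  intros I0 [CU HU]. split.
  - intros t It. split. apply AWfun_in_A. intros P [e He].
    destruct (proj1 (AWcont_iff omega U t) (CU t It) e (cond_pos e)) as [d [Hd H]].
    apply locally_R_iff. exists d. split. exact Hd. intros y Hy. rewrite normA_minus. apply He.
    change (Rabs (AWnorm (AWminus omega (U y) (U t)) - 0) < e).
    rewrite Rminus_0_r, Rabs_pos_eq. apply H, Hy. apply AWnorm_ge0.
  - intros t It x. rewrite (Duhamel_pointwise f U); auto.
    + rewrite <- (HU t It). reflexivity.
    + intros s Hs. apply CU. apply (in_interval_between Tm Tp 0 t); assumption.
Qed.

(** The default zero occurs only where [u t] lies outside the algebra, hence never on the interval
    of a solution. *)
Definition to_AW (u : R -> R -> C) (t : R) : AW :=
  match excluded_middle_informative (in_A omega (u t)) with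
  | left H => exist _ (u t) H
  | right _ => AWzero omega
  end.

Lemma AWfun_to_AW u t : in_A omega (u t) -> AWfun (to_AW u t) = u t.
Proof. intros H. unfold to_AW. destruct excluded_middle_informative; [reflexivity | contradiction]. Qed.

Lemma in_interval_nbhd Tm Tp t : in_interval Tm Tp t -> exists d, 0 < d /\ forall s, Rabs (s - t) < d -> in_interval Tm Tp s.
Proof.
  intros [H1 H2].
  assert (P1 : exists d, 0 < d /\ forall s, t - d < s -> Rbar_lt (Rbar_opp Tm) s).
  { destruct Tm as [r| |]; simpl in *; try contradiction.
    - exists (t - - r). split. lra. intros s Hs. lra.
    - exists 1. split. lra. intros; exact I. }
  assert (P2 : exists d, 0 < d /\ forall s, s < t + d -> Rbar_lt s Tp).
  { destruct Tp as [r| |]; simpl in *; try contradiction.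
    - exists (r - t). split. lra. intros s Hs. lra.
    - exists 1. split. lra. intros; exact I. }
  destruct P1 as [d1 [Hd1 P1]]. destruct P2 as [d2 [Hd2 P2]].
  exists (Rmin d1 d2). split. apply Rmin_glb_lt; assumption. intros s Hs. apply Rabs_def2 in Hs.
  pose proof (Rmin_l d1 d2). pose proof (Rmin_r d1 d2). split. apply P1; lra. apply P2; lra.
Qed.

Lemma mild_of_solution Tm Tp (f : AW) u : in_interval Tm Tp 0 ->
  is_solution (2 * k) omega lambda (AWfun f) Tm Tp u -> mild omega k c Tm Tp f (to_AW u).
Proof.
  intros I0 [CA HE].
  assert (HA : forall t, in_interval Tm Tp t -> AWfun (to_AW u t) = u t) by (intros t It; apply AWfun_to_AW, CA, It).
  assert (CU : forall t, in_interval Tm Tp t -> continuous (U := AV) (to_AW u) t).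
  { intros t It. apply AWcont_iff. intros eps He. destruct (CA t It) as [_ Hlim].
    specialize (Hlim (fun y => Rabs (real y - 0) < eps)).
    assert (Hb : Rbar_locally 0 (fun y => Rabs (real y - 0) < eps)) by (exists (mkposreal eps He); intros y Hy; exact Hy).
    specialize (Hlim Hb). apply locally_R_iff in Hlim. destruct Hlim as [d [Hd H]].
    destruct (in_interval_nbhd Tm Tp t It) as [d' [Hd' H']].
    exists (Rmin d d'). split. apply Rmin_glb_lt; assumption. intros y Hy.
    pose proof (Rmin_l d d'). pose proof (Rmin_r d d').
    specialize (H y ltac:(lra)). specialize (H' y ltac:(lra)). cbv beta in H.
    rewrite <- (HA y H'), <- (HA t It), normA_minus in H.
    change (Rabs (AWnorm (AWminus omega (to_AW u y) (to_AW u t)) - 0) < eps) in H.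
    apply Rabs_def2 in H. lra. }
  split. exact CU. intros t It. apply AW_eq. intros x.
  rewrite <- (Duhamel_pointwise f (to_AW u) u t x).
  - rewrite (HA t It). apply HE. exact It.
  - intros s Hs. apply CU. apply (in_interval_between Tm Tp 0 t); assumption.
  - intros s Hs. apply HA. apply (in_interval_between Tm Tp 0 t); try assumption. lra.
Qed.

(** A lower bound [M] valid on one set of the filter bounds the infimum over that set, and the outer
    supremum dominates it. *)
Lemma LimInf_infty {T : Type} (F : (T -> Prop) -> Prop) (g : T -> Rbar) :
  (forall M : R, exists A, F A /\ forall t, A t -> Rbar_le M (g t)) -> LimInf_filter F g = p_infty.
Proof.
  intros H. unfold LimInf_filter.
  unfold Rbar_lub. destruct Rbar_ex_lub as [l [Hub Hl0]]. simpl.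
  assert (Hl : forall M : R, Rbar_le M l).
  { intros M. destruct (H M) as [A [HA HM]].
    eapply Rbar_le_trans; [|apply Hub; exists A; split; [exact HA | reflexivity]].
    unfold Rbar_glb. destruct Rbar_ex_glb as [m [Hm0 Hm]]. apply (Hm (Finite M)). intros y [t [Ht ->]]. apply HM, Ht. }
  destruct l as [r| |]; auto.
  - specialize (Hl (r + 1)). simpl in Hl. lra.
  - destruct (Hl 0).
Qed.

Lemma in_interval_0 Tm Tp : Rbar_lt 0 Tm -> Rbar_lt 0 Tp -> in_interval Tm Tp 0.
Proof. intros H1 H2. split; auto. destruct Tm; simpl in *; auto. lra. Qed.

Section Maximal.
Variables (f : AW) (Tm Tp : Rbar) (u : R -> R -> C).
Hypothesis Hmax : is_maximal_solution (2 * k) omega lambda (AWfun f) Tm Tp u.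

Let I0 : in_interval Tm Tp 0.
Proof. destruct Hmax as [H1 [H2 _]]. apply in_interval_0; assumption. Qed.

Lemma maximal_mild : mild omega k c Tm Tp f (to_AW u).
Proof. apply mild_of_solution. exact I0. apply Hmax. Qed.

Lemma maximal_normA t : in_interval Tm Tp t -> normA omega (u t) = Finite (AWnorm (to_AW u t)).
Proof.
  intros It. rewrite <- normA_AWfun, AWfun_to_AW. reflexivity. destruct Hmax as [_ [_ [[CA _] _]]]. apply CA, It.
Qed.

Lemma blowup_right (r : R) : Tp = Finite r -> LimInf_filter (at_left r) (fun t => normA omega (u t)) = p_infty.
Proof.
  intros ETp. pose proof Hmax as [Hm0 [Hp0 [_ Hext]]]. pose proof maximal_mild as Hmild.
  assert (Hr : 0 < r) by (rewrite ETp in Hp0; exact Hp0).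
  apply LimInf_infty. intros M.
  destruct (mild_local omega k c (Rmax M 0) (Rmax_r M 0)) as [d [Hd HV]].
  pose proof (Rmin_l d r). pose proof (Rmin_r d r). assert (0 < Rmin d r) by (apply Rmin_glb_lt; assumption).
  (* A norm below [M] at a time [t0] in this stretch would allow a restart reaching [t0 + d > r],
     against maximality. The minimum with [r] keeps [t0] positive. *)
  exists (fun t => r - Rmin d r < t < r). split.
  - apply locally_R_iff. exists (Rmin d r). split. assumption. intros y Hy Hyr. apply Rabs_def2 in Hy. lra.
  - intros t0 Ht0.
    assert (It0 : in_interval Tm Tp t0).
    { split. eapply Rbar_lt_trans. apply I0. simpl; lra. rewrite ETp. simpl; lra. }
    rewrite (maximal_normA t0 It0). simpl. apply Rnot_lt_le. intros Hlt.
    destruct (HV (to_AW u t0)) as [V [CV' HV']]. pose proof (Rmax_l M 0). lra.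
    assert (Hpos : Rbar_lt 0 (Finite (t0 + d))) by (simpl; lra).
    destruct (extend_mild omega k c Tm Tp Tm (Finite (t0 + d)) f (to_AW u) t0 d V 1 Hmild ltac:(lra) ltac:(lra) I0 It0 Hd CV' HV') as [W HW].
    { intros t [A1 A2] Ht. split. exact A1. rewrite ETp. simpl. lra. }
    { intros t [A1 A2] Ht. simpl in A2. rewrite Rabs_pos_eq; lra. }
    pose proof (solution_of_mild Tm (Finite (t0 + d)) f W (in_interval_0 _ _ Hm0 Hpos) HW) as Hsol.
    destruct (Hext Tm (Finite (t0 + d)) _ Hm0 Hpos Hsol) as [_ Hle]. rewrite ETp in Hle. simpl in Hle. lra.
Qed.

Lemma blowup_left (r : R) : Tm = Finite r -> LimInf_filter (at_right (- r)) (fun t => normA omega (u t)) = p_infty.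
Proof.
  intros ETm. pose proof Hmax as [Hm0 [Hp0 [_ Hext]]]. pose proof maximal_mild as Hmild.
  assert (Hr : 0 < r) by (rewrite ETm in Hm0; exact Hm0).
  apply LimInf_infty. intros M.
  destruct (mild_local omega k c (Rmax M 0) (Rmax_r M 0)) as [d [Hd HV]].
  pose proof (Rmin_l d r). pose proof (Rmin_r d r). assert (0 < Rmin d r) by (apply Rmin_glb_lt; assumption).
  exists (fun t => - r < t < - r + Rmin d r). split.
  - apply locally_R_iff. exists (Rmin d r). split. assumption. intros y Hy Hyr. apply Rabs_def2 in Hy. lra.
  - intros t0 Ht0.
    assert (It0 : in_interval Tm Tp t0).
    { split. rewrite ETm. simpl; lra. eapply Rbar_lt_trans. 2: apply I0. simpl; lra. }
    rewrite (maximal_normA t0 It0). simpl. apply Rnot_lt_le. intros Hlt.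
    destruct (HV (to_AW u t0)) as [V [CV' HV']]. pose proof (Rmax_l M 0). lra.
    (* The left end is recorded by its opposite: the extended interval begins at [t0 - d], which
       lies to the left of [- r]. *)
    assert (Hpos : Rbar_lt 0 (Finite (d - t0))) by (simpl; lra).
    destruct (extend_mild omega k c Tm Tp (Finite (d - t0)) Tp f (to_AW u) t0 d V (-1) Hmild ltac:(lra) ltac:(lra) I0 It0 Hd CV' HV') as [W HW].
    { intros t [A1 A2] Ht. split. rewrite ETm. simpl. lra. exact A2. }
    { intros t [A1 A2] Ht. simpl in A1. rewrite Rabs_left; lra. }
    pose proof (solution_of_mild (Finite (d - t0)) Tp f W (in_interval_0 _ _ Hpos Hp0) HW) as Hsol.
    destruct (Hext (Finite (d - t0)) Tp _ Hpos Hp0 Hsol) as [Hle _]. rewrite ETm in Hle. simpl in Hle. lra.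
Qed.

End Maximal.

(** * Evolution of the mean value *)

Definition zero_mode (U : R -> AW) (t : R) : C := fourier (AWfun (U t)) 0.
Definition moment (U : R -> AW) (t : R) : C := fourier (AWfun (AWabs omega k (U t))) 0.

(** The coefficient at 0 is a bounded linear functional, invariant under the free flow because the
    phase [al ^ 2 * t] vanishes there. Applied to the Duhamel formula it leaves the integrated
    equation of the zero mode. *)
Lemma mean_evolution Tm Tp f U t : mild omega k c Tm Tp f U -> in_interval Tm Tp 0 -> in_interval Tm Tp t ->
  exists J : C, is_RInt (V := CV) (moment U) 0 t J /\ zero_mode U t = (fourier (AWfun f) 0 + c * J)%C.
Proof.
  intros [CU HU] I0 It.
  assert (CU' : forall s, Rmin 0 t <= s <= Rmax 0 t -> continuous (U := AV) U s).
  { intros s Hs. apply CU. apply (in_interval_between Tm Tp 0 t); assumption. }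
  set (g := fun s => AWabs omega k (U s)).
  assert (Ig : ex_AWint omega g 0 t).
  { apply (ex_AWint_ext omega (fun s => nonlin omega k (RtoC 1) (U s))). intros s _. apply AW_eq. intros z. unfold g, nonlin. simpl. ring.
    apply ex_AWint_continuous. intros s Hs. apply AWcont_nonlin, CU', Hs. }
  assert (Id : ex_AWint omega (duhamel omega k c t U) 0 t) by (apply ex_AWint_continuous; intros s Hs; apply AWcont_duhamel, CU', Hs).
  exists (fourier (AWfun (AWint omega g 0 t)) 0). split.
  - exact (AWint_linear_C omega (fun v => fourier (AWfun v) 0) g 0 t (is_linear_fourier omega 0) Ig).
  - assert (E0 : forall s v, fourier (AWfun (AWflow omega s v)) 0 = fourier (AWfun v) 0).
    { intros s v. rewrite fourier_AWflow. replace (- (0 ^ 2 * s)) with 0 by ring. rewrite expi_0. ring. }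
    unfold zero_mode. rewrite (HU t It), fourier_AWplus, E0. f_equal.
    rewrite <- (Cint_unique _ _ _ _ (AWint_linear_C omega (fun v => fourier (AWfun v) 0) _ 0 t (is_linear_fourier omega 0) Id)).
    rewrite <- fourier_AWcscal. rewrite <- (AWint_linear omega (AWcscal omega c)); [|apply is_linear_cscal | exact Ig].
    rewrite <- (Cint_unique _ _ _ _ (AWint_linear_C omega (fun v => fourier (AWfun v) 0) (fun s => AWcscal omega c (g s)) 0 t (is_linear_fourier omega 0)
      ltac:(apply (ex_AWint_ext omega (fun s => nonlin omega k c (U s))); [intros s _; reflexivity | apply ex_AWint_continuous; intros s Hs; apply AWcont_nonlin, CU', Hs]))).
    apply Cint_ext. intros s. unfold duhamel. apply E0.
Qed.

Lemma moment_cont U t : continuous (U := AV) U t -> forall eps, 0 < eps -> exists d, 0 < d /\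
  forall s, Rabs (s - t) < d -> Cmod (moment U s - moment U t) < eps.
Proof.
  intros HU eps He. pose proof (AWcont_nonlin omega k (RtoC 1) U t HU) as H.
  destruct (proj1 (AWcont_iff omega _ t) H eps He) as [d [Hd H']]. exists d. split. exact Hd. intros s Hs.
  eapply Rle_lt_trans; [|exact (H' s Hs)].
  assert (E : (moment U s - moment U t)%C = fourier (AWfun (AWminus omega (nonlin omega k (RtoC 1) (U s)) (nonlin omega k (RtoC 1) (U t)))) 0).
  { unfold AWminus, AWopp, nonlin, moment. rewrite fourier_AWplus, !fourier_AWcscal. ring. }
  rewrite E. apply (ball_A_fourier (Omega omega) (Omega_0 omega)). apply AWfun_ball_A.
Qed.

End Link.

(** * Convexity of means and superlinear differential inequalities *)

(** The graph of a convex power lies above its tangent at [w]. Multiplying the inequality for [n] by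
    [x] leaves the nonnegative remainder [(INR n + 1) * w ^ n * (x - w) ^ 2]. *)
Lemma bernoulli_tangent (x w : R) (n : nat) : 0 <= x -> 0 <= w ->
  w ^ S n + (INR n + 1) * w ^ n * (x - w) <= x ^ S n.
Proof.
  intros Hx Hw. induction n.
  - simpl. lra.
  - rewrite S_INR. pose proof (pow_le w n Hw) as Hwn. pose proof (pos_INR n) as Hn.
    apply Rmult_le_compat_l with (r := x) in IHn; [|exact Hx].
    change (x ^ S (S n)) with (x * x ^ S n). eapply Rle_trans; [|exact IHn].
    assert (0 <= (INR n + 1) * w ^ n * (x - w) ^ 2).
    { apply Rmult_le_pos. apply Rmult_le_pos; lra. apply pow2_ge_0. }
    simpl in *. nra.
Qed.

(** The mean of [Cmod (g x - z) ^ 2] is nonnegative and, expanded, equals [q - z * Cconj z]. *)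
Lemma mean_abs_sq (g : R -> C) : AP g -> exists q, is_mean (fun x => RtoC (Cmod (g x) ^ 2)) q /\ Cmod (mean g) ^ 2 <= Re q.
Proof.
  intros Hg. set (z := mean g).
  assert (Hz : is_mean g z) by (apply AP_mean; exact Hg).
  assert (Hgc : AP (fun x => Cconj (g x))) by (apply AP_conj; exact Hg).
  assert (Hzc : is_mean (fun x => Cconj (g x)) (Cconj z)) by (apply is_mean_conj; [apply Hg | exact Hz]).
  assert (HA : AP (fun x => RtoC (Cmod (g x) ^ 2))).
  { replace (fun x => RtoC (Cmod (g x) ^ 2)) with (fun x => g x * Cconj (g x))%C. apply AP_mult; assumption.
    apply functional_extensionality. intros x. symmetry. apply Cmod2_conj. }
  destruct (AP_is_mean_ex _ HA) as [q Hq]. exists q. split. exact Hq.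
  assert (H : is_mean (fun x => RtoC (Cmod (g x) ^ 2) + ((- Cconj z) * g x + ((- z) * Cconj (g x) + z * Cconj z)))%C
     (q + ((- Cconj z) * z + ((- z) * Cconj z + z * Cconj z)))%C).
  { pose proof (AP_scal (- Cconj z) g Hg) as A1. pose proof (AP_scal (- z) _ Hgc) as A2. pose proof (AP_const (z * Cconj z)) as A3.
    pose proof (AP_plus _ _ A2 A3) as A4. pose proof (AP_plus _ _ A1 A4) as A5.
    apply (is_mean_plus (fun x => RtoC (Cmod (g x) ^ 2))); [apply HA | apply A5 | exact Hq |].
    apply (is_mean_plus (fun x => - Cconj z * g x)%C); [apply A1 | apply A4 | apply is_mean_mult; [apply Hg | exact Hz] |].
    apply (is_mean_plus (fun x => - z * Cconj (g x))%C); [apply A2 | apply A3 | apply is_mean_mult; [apply Hgc | exact Hzc] | apply is_mean_const]. }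
  assert (HE : forall x, (RtoC (Cmod (g x) ^ 2) + ((- Cconj z) * g x + ((- z) * Cconj (g x) + z * Cconj z)))%C = RtoC (Cmod (g x - z) ^ 2)).
  { intros x. rewrite !Cmod2_conj. replace (Cconj (g x - z)) with (Cconj (g x) - Cconj z)%C. ring.
    destruct (g x), z. unfold Cconj, Cminus, Cplus, Copp; simpl. f_equal; ring. }
  assert (HR : 0 <= Re (q + ((- Cconj z) * z + ((- z) * Cconj z + z * Cconj z)))).
  { eapply is_mean_Re_ge0; [|exact H|].
    - apply AP_plus. exact HA. apply AP_plus. apply AP_scal; exact Hg. apply AP_plus. apply AP_scal; exact Hgc. apply AP_const.
    - intros x. cbv beta. rewrite HE. simpl. apply Rmult_le_pos. apply Cmod_ge_0. rewrite Rmult_1_r. apply Cmod_ge_0. }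
  replace (q + ((- Cconj z) * z + ((- z) * Cconj z + z * Cconj z)))%C with (q - z * Cconj z)%C in HR by ring.
  rewrite <- Cmod2_conj in HR. change (0 <= Re q - Cmod z ^ 2) in HR. lra.
Qed.

(** Jensen's inequality in two steps, for the square and then for the power [S n] of it: the tangent
    at [w] is averaged, and its slope [b] is nonnegative, so [mean_abs_sq] may be inserted. The
    integrand is real, hence so is its mean. *)
Lemma mean_abs_pow (g : R -> C) (n : nat) (m : C) : AP g -> Ccont (fun x => RtoC (Cmod (g x) ^ (2 * S n))) ->
  is_mean (fun x => RtoC (Cmod (g x) ^ (2 * S n))) m ->
  Cmod (mean g) ^ (2 * S n) <= Re m /\ Im m = 0.
Proof.
  intros Hg Hc Hm. split.
  - destruct (mean_abs_sq g Hg) as [q [Hq Hle]]. set (w := Cmod (mean g) ^ 2) in *.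
    assert (Hw : 0 <= w) by apply pow2_ge_0.
    rewrite pow_mult. fold w.
    set (b := (INR n + 1) * w ^ n). assert (Hb : 0 <= b).
    { unfold b. apply Rmult_le_pos. pose proof (pos_INR n); lra. apply pow_le, Hw. }
    assert (Cq : Ccont (fun x => RtoC (Cmod (g x) ^ 2))).
    { replace (fun x => RtoC (Cmod (g x) ^ 2)) with (fun x => g x * Cconj (g x))%C. apply Ccont_mult; [apply Hg | apply Ccont_conj, Hg].
      apply functional_extensionality. intros x. symmetry. apply Cmod2_conj. }
    assert (H : is_mean (fun x => RtoC (Cmod (g x) ^ (2 * S n)) + (RtoC (- b) * RtoC (Cmod (g x) ^ 2) + RtoC (b * w - w ^ S n)))%C
       (m + (RtoC (- b) * q + RtoC (b * w - w ^ S n)))%C).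
    { apply (is_mean_plus _ (fun x => RtoC (- b) * RtoC (Cmod (g x) ^ 2) + RtoC (b * w - w ^ S n))%C); [exact Hc | | exact Hm |].
      - apply Ccont_plus. apply (Ccont_mult (fun _ => RtoC (- b))). apply Ccont_const. exact Cq. apply Ccont_const.
      - apply is_mean_plus. apply (Ccont_mult (fun _ => RtoC (- b))). apply Ccont_const. exact Cq. apply Ccont_const.
        apply is_mean_mult; assumption. apply is_mean_const. }
    assert (HR : 0 <= Re (m + (RtoC (- b) * q + RtoC (b * w - w ^ S n)))).
    { eapply is_mean_Re_ge0; [|exact H|].
      - apply Ccont_plus. exact Hc. apply Ccont_plus. apply (Ccont_mult (fun _ => RtoC (- b))). apply Ccont_const. exact Cq. apply Ccont_const.
      - intros x. cbv beta. rewrite pow_mult. set (y := Cmod (g x) ^ 2).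
        change (Re (RtoC (y ^ S n) + (RtoC (- b) * RtoC y + RtoC (b * w - w ^ S n)))) with (y ^ S n + ((- b * y - 0 * 0) + (b * w - w ^ S n))).
        pose proof (bernoulli_tangent y w n (pow2_ge_0 _) Hw) as P. fold b in P. lra. }
    change (Re (m + (RtoC (- b) * q + RtoC (b * w - w ^ S n)))) with (Re m + ((- b * Re q - 0 * Im q) + (b * w - w ^ S n))) in HR.
    assert (b * w <= b * Re q) by (apply Rmult_le_compat_l; assumption). lra.
  - pose proof (is_mean_conj _ m Hc Hm) as H.
    assert (E : (fun x => Cconj (RtoC (Cmod (g x) ^ (2 * S n)))) = (fun x => RtoC (Cmod (g x) ^ (2 * S n)))).
    { apply functional_extensionality. intros x. unfold Cconj, RtoC. simpl fst; simpl snd. f_equal. ring. }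
    cbv beta in H; rewrite E in H. pose proof (mean_of_is_mean _ _ H) as E1. rewrite (mean_of_is_mean _ _ Hm) in E1.
    apply (f_equal snd) in E1. unfold Cconj in E1; simpl in E1. unfold Im. lra.
Qed.

(** Since [y] does not fall below [y 0], the inequality implies one of Riccati type with constant
    [K' = K * y 0 ^ (p - 2)]. Then [/ y t + K' * t] is nonincreasing, although its second term is
    unbounded and its first one positive. *)
Lemma no_global_superlinear (y m : R -> R) K p : 0 < K -> (2 <= p)%nat -> 0 < y 0 ->
  (forall t, 0 <= t -> continuous m t) ->
  (forall t, 0 <= t -> is_RInt m 0 t (y t - y 0)) ->
  (forall t, 0 <= t -> K * Rabs (y t) ^ p <= m t) -> False.
Proof.
  intros HK Hp Hy0 Hc Hi Hm.
  assert (Hm0 : forall t, 0 <= t -> 0 <= m t).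
  { intros t Ht. eapply Rle_trans; [|apply Hm, Ht]. apply Rmult_le_pos. lra. apply pow_le, Rabs_pos. }
  assert (Hy : forall t, 0 <= t -> y 0 <= y t).
  { intros t Ht. assert (0 <= y t - y 0); [|lra]. apply (is_RInt_ge_0 m 0 t _ Ht (Hi t Ht)).
    intros x Hx. apply Hm0. lra. }
  assert (Hd : forall t, 0 < t -> is_derive y t (m t)).
  { intros t Ht. assert (H : is_derive (fun b => y b - y 0) t (m t)).
    { apply (is_derive_RInt m (fun b => y b - y 0) 0 t); [|apply Hc; lra].
      apply locally_R_iff. exists t. split. exact Ht. intros s Hs. apply Rabs_def2 in Hs. apply Hi. lra. }
    apply (is_derive_ext (fun b => (y b - y 0) + y 0)). intros s. simpl. ring.
    replace (m t) with (m t + 0) by ring. apply (is_derive_plus (fun b => y b - y 0) (fun _ => y 0)). exact H.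
    apply (is_derive_const (y 0) t). }
  set (K' := K * y 0 ^ (p - 2)).
  assert (HK' : 0 < K') by (unfold K'; apply Rmult_lt_0_compat; [exact HK | apply pow_lt, Hy0]).
  set (h := fun t => / y t + K' * t).
  assert (Hh : forall t, 0 < t -> is_derive h t (- m t / y t ^ 2 + K')).
  { intros t Ht. unfold h. apply (is_derive_plus (fun t => / y t) (fun t => K' * t)).
    - apply is_derive_inv. apply Hd, Ht. specialize (Hy t ltac:(lra)). lra.
    - auto_derive. exact I. ring. }
  assert (Hneg : forall t, 0 <= t -> - m t / y t ^ 2 + K' <= 0).
  { intros t Ht. pose proof (Hy t Ht) as Hyt. pose proof (Hm t Ht) as Hmt. rewrite Rabs_pos_eq in Hmt by lra.
    replace p with (2 + (p - 2))%nat in Hmt by lia. rewrite pow_add in Hmt.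
    assert (Hy2 : 0 < y t ^ 2) by (apply pow_lt; lra).
    assert (y 0 ^ (p - 2) <= y t ^ (p - 2)) by (apply pow_incr; lra).
    assert (K' <= m t / y t ^ 2); [|lra].
    apply Rmult_le_reg_r with (y t ^ 2). exact Hy2. unfold Rdiv. rewrite Rmult_assoc, Rinv_l, Rmult_1_r by lra.
    eapply Rle_trans; [|exact Hmt]. unfold K'. replace (K * y 0 ^ (p - 2) * y t ^ 2) with (K * (y t ^ 2 * y 0 ^ (p - 2))) by ring.
    apply Rmult_le_compat_l. lra. apply Rmult_le_compat_l; lra. }
  (* The mean value theorem is used from time 1, because the derivative is established at positive
     times only. The length [T - 1] is such that [K' * (T - 1) = K' + / y 0], more than the decrease
     of [/ y] permits. *)
  set (T := 2 + / (y 0 * K')).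
  assert (HT : 0 < / (y 0 * K')) by (apply Rinv_0_lt_compat, Rmult_lt_0_compat; assumption).
  destruct (MVT_gen h 1 T (fun t => - m t / y t ^ 2 + K')) as [s [Hs E]].
  - intros x Hx. apply Hh. rewrite Rmin_left in Hx by (unfold T; lra). lra.
  - intros x Hx. rewrite Rmin_left in Hx by (unfold T; lra). apply derivable_continuous_pt.
    exists (- m x / y x ^ 2 + K'). apply is_derive_Reals, Hh. lra.
  - rewrite Rmin_left, Rmax_right in Hs by (unfold T; lra).
    assert (h T - h 1 <= 0). { rewrite E. specialize (Hneg s ltac:(lra)). unfold T. nra. }
    unfold h in H.
    pose proof (Hy 1 ltac:(lra)) as Y1. pose proof (Hy T ltac:(unfold T; lra)) as YT.
    assert (/ y 1 <= / y 0) by (apply Rinv_le_contravar; lra).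
    assert (0 < / y T) by (apply Rinv_0_lt_compat; lra).
    assert (K' * (T - 1) = K' + / y 0) by (unfold T; field; lra). lra.
Qed.

(** For [y = a * zeta] the derivative is [a * a * rho]: the square removes the sign of [a], so only
    the sign of [a * zeta 0] matters. The constant [a * a / Rabs a ^ p] rewrites the bound on [rho]
    in terms of [y]. *)
Lemma no_global_forward (rho zeta RJ : R -> R) a p : (2 <= p)%nat -> 0 < a * zeta 0 ->
  (forall t, 0 <= t -> continuous rho t) ->
  (forall t, 0 <= t -> is_RInt rho 0 t (RJ t) /\ zeta t = zeta 0 + a * RJ t) ->
  (forall t, 0 <= t -> Rabs (zeta t) ^ p <= rho t) -> False.
Proof.
  intros Hp Ha Hc Hi Hr.
  assert (Ha0 : a <> 0) by (intros ->; lra). assert (Haa : 0 < Rabs a) by (apply Rabs_pos_lt, Ha0).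
  assert (Ha2 : 0 < a * a) by nra.
  apply (no_global_superlinear (fun t => a * zeta t) (fun t => a * a * rho t) (a * a / Rabs a ^ p) p).
  - apply Rdiv_lt_0_compat. exact Ha2. apply pow_lt, Haa.
  - exact Hp.
  - exact Ha.
  - intros t Ht. apply (continuous_scal_r (a * a) rho). apply Hc, Ht.
  - intros t Ht. destruct (Hi t Ht) as [H1 H2]. replace (a * zeta t - a * zeta 0) with (a * a * RJ t) by (rewrite H2; ring).
    apply (is_RInt_scal (V := R_NormedModule) rho 0 t (a * a)). exact H1.
  - intros t Ht. rewrite Rabs_mult, Rpow_mult_distr.
    replace (a * a / Rabs a ^ p * (Rabs a ^ p * Rabs (zeta t) ^ p)) with (a * a * Rabs (zeta t) ^ p) by (field; apply pow_nonzero; lra).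
    apply Rmult_le_compat_l. lra. apply Hr, Ht.
Qed.

(** Reversing time changes the sign of the integral, which is absorbed by replacing [a] with
    [- a]. *)
Lemma no_global_backward (rho zeta RJ : R -> R) a p : (2 <= p)%nat -> a * zeta 0 < 0 ->
  (forall t, t <= 0 -> continuous rho t) ->
  (forall t, t <= 0 -> is_RInt rho 0 t (RJ t) /\ zeta t = zeta 0 + a * RJ t) ->
  (forall t, t <= 0 -> Rabs (zeta t) ^ p <= rho t) -> False.
Proof.
  intros Hp Ha Hc Hi Hr.
  apply (no_global_forward (fun t => rho (- t)) (fun t => zeta (- t)) (fun t => - RJ (- t)) (- a) p).
  - exact Hp.
  - rewrite Ropp_0. lra.
  - intros t Ht. apply (continuous_comp (fun t => - t) rho). apply (continuous_opp (V := R_NormedModule) (fun t : R => t)), continuous_id. apply Hc. lra.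
  - intros t Ht. destruct (Hi (- t) ltac:(lra)) as [H1 H2]. rewrite Ropp_0. split; [|rewrite H2; ring].
    apply (is_RInt_ext (V := R_NormedModule) (fun s => opp (opp (rho (- s))))). intros s _. apply opp_opp.
    apply (is_RInt_opp (V := R_NormedModule)). apply (is_RInt_comp_opp (V := R_NormedModule)). rewrite Ropp_0. exact H1.
  - intros t Ht. apply Hr. lra.
Qed.

(** * Finite existence time from the zero mode *)

Section MeanODE.
Variable omega : nat -> R.
Variable n : nat.
Variable lambda : C.
Let k := S n.

(** The two real coordinates [phi] of the zero mode, with the factor [a] by which the (real) moment drives them. *)
Definition driven (a : R) (phi : C -> R) : Prop := (a = Im lambda /\ phi = Re) \/ (a = - Re lambda /\ phi = Im).

(** As the moment is real, multiplying its integral by [- (Ci * lambda)] gives a vector with the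
    fixed coordinates [Im lambda] and [- Re lambda], so the real and imaginary parts of the zero
    mode decouple. Each is dominated by the modulus, to which convexity applies. *)
Lemma mean_coordinates Tm Tp (f : AW omega) U a phi : mild omega k (- (Ci * lambda))%C Tm Tp f U -> in_interval Tm Tp 0 ->
  driven a phi ->
  exists rho RJ : R -> R, forall t, in_interval Tm Tp t ->
    continuous rho t /\ (is_RInt rho 0 t (RJ t) /\ phi (zero_mode omega U t) = phi (mean (AWfun omega f)) + a * RJ t) /\
    Rabs (phi (zero_mode omega U t)) ^ (2 * k) <= rho t.
Proof.
  intros Hmild I0 Hphi.
  assert (Hmom : forall t, Cmod (zero_mode omega U t) ^ (2 * k) <= Re (moment omega k U t) /\ Im (moment omega k U t) = 0).
  { intros t. unfold zero_mode. rewrite fourier_0.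
    assert (E : AWfun omega (AWabs omega k (U t)) = (fun x => RtoC (Cmod (AWfun omega (U t) x) ^ (2 * k)))).
    { apply functional_extensionality. intros x. apply AWfun_AWabs. }
    pose proof (AWfun_AP omega (AWabs omega k (U t))) as HA. rewrite E in HA.
    apply mean_abs_pow. apply AWfun_AP. apply HA. unfold moment. rewrite fourier_0, E. apply AP_mean, HA. }
  assert (HJ : forall t, in_interval Tm Tp t -> exists J : R, is_RInt (fun t => Re (moment omega k U t)) 0 t J /\
    zero_mode omega U t = (mean (AWfun omega f) + - (Ci * lambda) * RtoC J)%C).
  { intros t It. destruct (mean_evolution omega k lambda Tm Tp f U t Hmild I0 It) as [[J1 J2] [HJ HZ]].
    pose proof (is_RInt_fct_extend_fst (U := R_NormedModule) (V := R_NormedModule) _ 0 t _ HJ) as H1.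
    pose proof (is_RInt_fct_extend_snd (U := R_NormedModule) (V := R_NormedModule) _ 0 t _ HJ) as H2.
    exists J1. split. exact H1.
    (* The second component of [J] is the integral of the imaginary part of the moment, which is
       identically zero. *)
    assert (H3 : is_RInt (V := R_NormedModule) (fun s => snd (moment omega k U s)) 0 t (scal (t - 0) 0)).
    { apply (is_RInt_ext (V := R_NormedModule) (fun _ => 0)). intros s _. symmetry. apply Hmom. apply (is_RInt_const (V := R_NormedModule)). }
    pose proof (is_RInt_unique (V := R_CompleteNormedModule) _ _ _ _ H2) as E2.
    pose proof (is_RInt_unique (V := R_CompleteNormedModule) _ _ _ _ H3) as E3.
    assert (E4 : J2 = 0).
    { transitivity ((t - 0) * 0); [|ring]. exact (eq_trans (eq_sym E2) E3). }
    rewrite HZ, fourier_0, E4. reflexivity. }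
  exists (fun t => Re (moment omega k U t)), (fun t => RInt (fun t => Re (moment omega k U t)) 0 t).
  intros t It. split; [|split; [split|]].
  - apply filterlim_locally. intros eps. apply locally_R_iff.
    destruct (moment_cont omega k U t (proj1 Hmild t It) eps (cond_pos eps)) as [d [Hd H]].
    exists d. split. exact Hd. intros s Hs. specialize (H s Hs).
    change (Rabs (Re (moment omega k U s) - Re (moment omega k U t)) < eps).
    eapply Rle_lt_trans; [|exact H]. apply (re_le_Cmod (moment omega k U s - moment omega k U t)).
  - destruct (HJ t It) as [J [H1 _]]. apply (RInt_correct (V := R_CompleteNormedModule)). exists J. exact H1.
  - destruct (HJ t It) as [J [H1 HZ]]. rewrite HZ, (is_RInt_unique (V := R_CompleteNormedModule) _ _ _ _ H1).
    destruct Hphi as [[-> ->] | [-> ->]]; unfold Re, Im; destruct lambda; simpl; ring.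
  - eapply Rle_trans; [|apply Hmom]. apply pow_incr. split. apply Rabs_pos.
    destruct Hphi as [[_ ->] | [_ ->]]; [apply re_le_Cmod | apply Im_le_Cmod].
Qed.

Lemma zero_mode_0 Tm Tp (f : AW omega) U : mild omega k (- (Ci * lambda))%C Tm Tp f U -> in_interval Tm Tp 0 -> zero_mode omega U 0 = mean (AWfun omega f).
Proof.
  intros [_ HU] I0. unfold zero_mode. rewrite (HU 0 I0), AWint_point, AWflow_0. rewrite <- fourier_0. f_equal. f_equal. apply AWplus_zero_r.
Qed.

Lemma finite_right Tm Tp (f : AW omega) U a phi : mild omega k (- (Ci * lambda))%C Tm Tp f U -> in_interval Tm Tp 0 ->
  driven a phi -> 0 < a * phi (mean (AWfun omega f)) -> Rbar_lt Tp p_infty.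
Proof.
  intros Hmild I0 Hphi H. destruct Tp as [r| |]; simpl; auto. exfalso.
  destruct (mean_coordinates Tm p_infty f U a phi Hmild I0 Hphi) as [rho [RJ HH]].
  assert (It : forall t, 0 <= t -> in_interval Tm p_infty t).
  { intros t Ht. split; [|exact I]. eapply Rbar_lt_le_trans. apply I0. exact Ht. }
  rewrite <- (zero_mode_0 _ _ _ _ Hmild I0) in H, HH.
  apply (no_global_forward rho (fun t => phi (zero_mode omega U t)) RJ a (2 * k)); [unfold k; lia | exact H | | |]; intros t Ht; apply HH, It, Ht.
Qed.

Lemma finite_left Tm Tp (f : AW omega) U a phi : mild omega k (- (Ci * lambda))%C Tm Tp f U -> in_interval Tm Tp 0 ->
  driven a phi -> a * phi (mean (AWfun omega f)) < 0 -> Rbar_lt Tm p_infty.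
Proof.
  intros Hmild I0 Hphi H. destruct Tm as [r| |]; simpl; auto. exfalso.
  destruct (mean_coordinates p_infty Tp f U a phi Hmild I0 Hphi) as [rho [RJ HH]].
  assert (It : forall t, t <= 0 -> in_interval p_infty Tp t).
  { intros t Ht. split; [exact I|]. eapply Rbar_le_lt_trans; [|apply I0]. exact Ht. }
  rewrite <- (zero_mode_0 _ _ _ _ Hmild I0) in H, HH.
  apply (no_global_backward rho (fun t => phi (zero_mode omega U t)) RJ a (2 * k)); [unfold k; lia | exact H | | |]; intros t Ht; apply HH, It, Ht.
Qed.

End MeanODE.

Theorem theorem1p9 :
  forall (p : nat) (hp : (0 < p)%nat) (hp_even : Nat.Even p)
    (omega : nat -> R) (lambda : C) (f : R -> C) (hf : in_A omega f)
    (Tm Tp : Rbar) (u : R -> R -> C)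
    (hu : is_maximal_solution p omega lambda f Tm Tp u)
    (hcond : Re lambda * Im (mean f) <> 0 \/ Im lambda * Re (mean f) <> 0),
  Rbar_lt (Rbar_min Tm Tp) p_infty /\
  (Re lambda * Im (mean f) < 0 \/ Im lambda * Re (mean f) > 0 ->
     Rbar_lt Tp p_infty /\
     LimInf_filter (at_left (real Tp)) (fun t => normA omega (u t)) = p_infty) /\
  (Re lambda * Im (mean f) > 0 \/ Im lambda * Re (mean f) < 0 ->
     Rbar_lt Tm p_infty /\
     LimInf_filter (at_right (- real Tm)) (fun t => normA omega (u t)) = p_infty).
Proof.
  intros p hp [k Hk] omega lambda f hf Tm Tp u hu hcond. subst p.
  destruct k as [|n]; [lia|].
  set (f' := exist _ f hf : AW omega).
  pose proof (in_interval_0 Tm Tp (proj1 hu) (proj1 (proj2 hu))) as I0.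
  pose proof (maximal_mild omega (S n) lambda f' Tm Tp u hu) as Hmild.
  assert (HR : Re lambda * Im (mean f) < 0 \/ Im lambda * Re (mean f) > 0 -> Rbar_lt Tp p_infty).
  { intros [h|h].
    - apply (finite_right omega n lambda Tm Tp f' _ (- Re lambda) Im Hmild I0 ltac:(right; split; reflexivity)).
      change (0 < - Re lambda * Im (mean f)). lra.
    - exact (finite_right omega n lambda Tm Tp f' _ (Im lambda) Re Hmild I0 ltac:(left; split; reflexivity) h). }
  assert (HL : Re lambda * Im (mean f) > 0 \/ Im lambda * Re (mean f) < 0 -> Rbar_lt Tm p_infty).
  { intros [h|h].
    - apply (finite_left omega n lambda Tm Tp f' _ (- Re lambda) Im Hmild I0 ltac:(right; split; reflexivity)).
      change (- Re lambda * Im (mean f) < 0). lra.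
    - exact (finite_left omega n lambda Tm Tp f' _ (Im lambda) Re Hmild I0 ltac:(left; split; reflexivity) h). }
  split; [|split].
  - assert (HLR : Rbar_lt Tm p_infty \/ Rbar_lt Tp p_infty).
    { destruct hcond as [h|h]; destruct (Rdichotomy _ _ h) as [h'|h'].
      - right. apply HR. left. exact h'.
      - left. apply HL. left. exact h'.
      - left. apply HL. right. exact h'.
      - right. apply HR. right. exact h'. }
    destruct HLR as [h|h]; eapply Rbar_le_lt_trans; [apply Rbar_min_l | exact h | apply Rbar_min_r | exact h].
  - intros h. specialize (HR h). split. exact HR.
    destruct Tp as [r| |]; [|destruct HR|destruct I0 as [_ []]].
    apply (blowup_right omega (S n) lambda f' Tm (Finite r) u hu r). reflexivity.
  - intros h. specialize (HL h). split. exact HL.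
    pose proof (proj1 hu) as Hpos.
    destruct Tm as [r| |]; [|destruct HL|destruct Hpos].
    apply (blowup_left omega (S n) lambda f' (Finite r) Tp u hu r). reflexivity.
Qed.
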